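(* Let $(K,G)$ be a flow on a nonempty compact space $K$ such that $K$ is locally path-connected with finite first Betti number $b_1(K)$, the group $G$ is abelian, and such that $K$ is metrizable or $G$ is separable. Suppose that all $G$-invariant functions $f\in C(K)$ are constant. Then every equicontinuous factor of $(K,G)$ is isomorphic to a minimal flow on some compact abelian Lie group of dimension at most $b_1(K)/b_0(K)$. More precisely, for every equicontinuous factor $(L,G)$ of $(K,G)$ there are a finite abelian group $F$ of order $|F|\le b_0(K)$ and an integer $m\ge 0$ with $m\le b_1(K)/b_0(K)$ such that $(L,G)$ is isomorphic to a minimal action of $G$ on $F\times\mathbb{T}^m$ via rotations.
   Context: Compact spaces are Hausdorff. A flow $(K,G)$ is a continuous action $G\times K\to K$ of a topological group $G$ on a compact space $K$. $C(K)$ is the space of continuous complex-valued functions on $K$; $f\in C(K)$ is $G$-invariant if $f(gx)=f(x)$ for all $g\in G$, $x\in K$. A factor of $(K,G)$ is a flow $(L,G)$ for which there is a continuous, surjective, $G$-equivariant map $K\to L$. A flow $(L,G)$ is equicontinuous if the family of maps $\{x\mapsto gx \mid g\in G\}\subset C(L,L)$ is (uniformly) equicontinuous, and minimal if every orbit is dense. Two flows of $G$ are isomorphic if there is a $G$-equivariant homeomorphism between them. $\mathbb{T}$ is the circle group; an action of $G$ on a compact abelian group $H$ is via rotations if each $g\in G$ acts as $x\mapsto a_g+x$ for some $a_g\in H$. $b_i(K)$ is the $i$-th Betti number, i.e. the torsion-free rank $\dim_{\mathbb{Q}}(\mathbb{Q}\otimes H_i(K))$ of the $i$-th singular homology group with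 integer coefficients; for compact locally path-connected $K$, $b_0(K)$ is the (finite) number of connected components. *)

(* Defs.v *)
From HB Require Import structures.
(* [freeg] comes first: it rebinds [lift], which must remain [fintype.lift]. *)
From mathcomp.multinomials Require Import freeg.
From mathcomp Require Import all_boot all_order all_algebra.
From mathcomp Require Import all_classical all_reals all_analysis.
From mathcomp Require Import complex.

Set Implicit Arguments.
Unset Strict Implicit.
Unset Printing Implicit Defensive.

Import Order.TTheory GRing.Theory Num.Theory.
Import numFieldNormedType.Exports.

Local Open Scope classical_set_scope.
Local Open Scope ring_scope.

Definition homeomorphism (X Y : topologicalType) (f : X -> Y) :=
  continuous f /\
  exists g : Y -> X, [/\ continuous g, cancel f g & cancel g f].

Definition metrizable (R : realType) (X : topologicalType) :=
  exists (M : metricType R) (f : X -> M), homeomorphism f.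

Definition separable (X : topologicalType) :=
  exists D : set X, countable D /\ dense D.

Definition path_connected (R : realType) (X : topologicalType) (A : set X) :=
  A !=set0 /\
  forall x y, A x -> A y -> exists p : R -> X,
    [/\ {within `[0, 1], continuous p}, p 0 = x, p 1 = y
      & p @` `[0, 1] `<=` A].

Definition locally_path_connected (R : realType) (X : topologicalType) :=
  forall (x : X) (U : set X), nbhs x U ->
    exists V : set X, [/\ open V, V x, V `<=` U & path_connected R V].

Definition is_flow (G : topologicalZmodType) (X : topologicalType)
    (act : G -> X -> X) :=
  [/\ compact [set: X], hausdorff_space X,
      forall x, act 0 x = x,
      forall g h x, act (g + h) x = act g (act h x)
    & continuous (fun p : G * X => act p.1 p.2)].

Definition equivariant (G X Y : Type) (actX : G -> X -> X) (actY : G -> Y -> Y)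
    (f : X -> Y) :=
  forall g x, f (actX g x) = actY g (f x).

Definition is_factor (G : topologicalZmodType) (X Y : topologicalType)
    (actX : G -> X -> X) (actY : G -> Y -> Y) :=
  is_flow actY /\
  exists f : X -> Y,
    [/\ continuous f, set_surj setT setT f & equivariant actX actY f].

Definition isomorphic_flows (G : Type) (X Y : topologicalType)
    (actX : G -> X -> X) (actY : G -> Y -> Y) :=
  exists f : X -> Y, homeomorphism f /\ equivariant actX actY f.

Definition invariant_fun (G X Z : Type) (act : G -> X -> X) (f : X -> Z) :=
  forall g x, f (act g x) = f x.

Definition minimal_flow (G : Type) (X : topologicalType) (act : G -> X -> X) :=
  forall x, dense (range (act^~ x)).

(* A compact Hausdorff space carries exactly one compatible uniformity, so
   taking the phase space in [uniformType] amounts to naming that uniformity.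
   The library's [equicontinuous] is the pointwise notion; this is the uniform
   one. *)
Definition uniformly_equicontinuous (G : Type) (X : uniformType)
    (act : G -> X -> X) :=
  forall E : set (X * X), entourage E ->
    exists2 D : set (X * X), entourage D &
      forall g x y, D (x, y) -> E (act g x, act g y).

Definition acts_by_rotations (G : Type) (H : zmodType) (act : G -> H -> H) :=
  forall g, exists a : H, forall x, act g x = a + x.

Definition circle (R : realType) : Type := [set z : R[i]^o | `|z| = 1].

HB.instance Definition _ (R : realType) :=
  Topological.copy (circle R) (set_type [set z : R[i]^o | `|z| = 1]).

Section CircleGroup.
Variable R : realType.
Implicit Types x y z : circle R.

Let circleP x : `|\val x| = 1 :> R[i].
Proof. by have /set_mem := valP x. Qed.

Definition circle_mk (z : R[i]) (z1 : `|z| = 1) : circle R :=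
  @exist R[i] _ z (mem_set z1).

Let one_proof : `|1 : R[i]| = 1. Proof. exact: normr1. Qed.
Let mul_proof x y : `|(\val x : R[i]) * \val y| = 1.
Proof. by rewrite normrM !circleP mulr1. Qed.
Let inv_proof x : `|(\val x : R[i])^-1| = 1.
Proof. by rewrite normfV circleP invr1. Qed.

(* Complex multiplication, written additively. *)
Definition circle_zero : circle R := circle_mk one_proof.
Definition circle_add x y : circle R := circle_mk (mul_proof x y).
Definition circle_opp x : circle R := circle_mk (inv_proof x).

Let circle_addA : associative circle_add.
Proof. by move=> x y z; apply: val_inj; rewrite /= mulrA. Qed.
Let circle_addC : commutative circle_add.
Proof. by move=> x y; apply: val_inj; rewrite /= mulrC. Qed.
Let circle_add0 : left_id circle_zero circle_add.
Proof. by move=> x; apply: val_inj; rewrite /= mul1r. Qed.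
Let circle_addN : left_inverse circle_zero circle_opp circle_add.
Proof.
move=> x; apply: val_inj => /=; rewrite mulVf//.
by rewrite -normr_gt0 circleP ltr01.
Qed.

HB.instance Definition _ :=
  GRing.isZmodule.Build (circle R)
    circle_addA circle_addC circle_add0 circle_addN.

End CircleGroup.

(* F x T^m, with F discrete and T^m carrying the product topology. *)
Definition fin_torus (R : realType) (F : finZmodType) (m : nat) : Type :=
  (discrete_topology F * prod_topology (fun _ : 'I_m => circle R))%type.

HB.instance Definition _ (R : realType) (F : finZmodType) (m : nat) :=
  GRing.Zmodule.copy (fin_torus R F m) (F * ('I_m -> circle R))%type.
HB.instance Definition _ (R : realType) (F : finZmodType) (m : nat) :=
  Topological.copy (fin_torus R F m)
    (discrete_topology F * prod_topology (fun _ : 'I_m => circle R))%type.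

Definition std_simplex (R : realType) (n : nat) : set 'rV[R]_n.+1 :=
  [set x | (forall j, 0 <= x 0 j) /\ \sum_j x 0 j = 1].
Arguments std_simplex : clear implicits.

Section Faces.
Variables (R : realType) (n : nat) (i : 'I_n.+2).

(* The i-th face inserts a zero at position i. *)
Definition face_row (x : 'rV[R]_n.+1) : 'rV[R]_n.+2 :=
  \row_j (if unlift i j is Some k then x 0 k else 0).

Lemma face_row_simplex x : std_simplex R n x -> std_simplex R n.+1 (face_row x).
Proof.
move=> [x0 x1]; split=> [j|]; first by rewrite mxE; case: unlift.
rewrite (bigD1 i)//= mxE unlift_none add0r -x1.
rewrite (reindex_omap (lift i) (unlift i)) => [|j ji]; last first.
  by case: unliftP ji => [k ->//|->]; rewrite eqxx.
apply: eq_big => [k|k _]; last by rewrite mxE liftK.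
by rewrite liftK eqxx eq_sym neq_lift.
Qed.

Definition face (x : std_simplex R n) : std_simplex R n.+1 :=
  @exist _ _ (face_row (\val x))
    (mem_set (face_row_simplex (set_mem (valP x)))).

Lemma continuous_face : continuous face.
Proof.
have valc : continuous (set_val : std_simplex R n -> 'rV[R]_n.+1).
  by move=> y; apply: (@initial_continuous _ _ set_val).
have coordc j :
    continuous (fun y : std_simplex R n => face_row (set_val y) 0 j).
  rewrite /face_row; case ij : (unlift i j) => [k|] y.
    rewrite (_ : (fun _ => _) = (fun z : 'rV[R]_n.+1 => z 0 k) \o set_val).
      by apply: continuous_comp (valc y) (@coord_continuous _ _ _ _ _ _).
    by apply/funext => z; rewrite mxE ij.
  rewrite (_ : (fun _ => _) = cst 0); first exact: cst_continuous.
  by apply/funext => z; rewrite mxE ij.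
apply: continuous_comp_initial => x A [P Px PA].
have : \forall y \near (x : std_simplex R n),
    forall j, P 0 j (face_row (set_val y) 0 j).
  by apply: (@filter_forall _ _ _ (nbhs (x : std_simplex R n))) => j;
    exact: (coordc j x _ (Px 0 j)).
apply: filterS => y yP; apply: PA => i0 j; rewrite ord1.
exact: yP.
Qed.

HB.instance Definition _ := isContinuous.Build _ _ face continuous_face.

End Faces.

Notation singular_simplex R X n := (continuousType (std_simplex R n) X).

Definition chain (R : realType) (X : topologicalType) (n : nat) :
    lmodType int :=
  {freeg (singular_simplex R X n) / int}.

Section Homology.
Variables (R : realType) (X : topologicalType).

Definition simplex_boundary n (s : singular_simplex R X n.+1) : chain R X n :=
  \sum_(i < n.+2) (-1) ^+ i *:
    (<< (s \o @face R n i : singular_simplex R X n) >> : chain R X n).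

Definition boundary n (c : chain R X n.+1) : chain R X n :=
  fglift (@simplex_boundary n) c.

Lemma boundary_is_additive n : additive (@boundary n).
Proof. exact: lift_is_additive. Qed.

HB.instance Definition _ n :=
  GRing.isAdditive.Build (chain R X n.+1) (chain R X n) (@boundary n)
    (@boundary_is_additive n).

(* Homology is unreduced: every 0-chain is a cycle. *)
Definition is_cycle n : {pred chain R X n} :=
  if n is k.+1 then fun c => boundary (n:=k) c == 0 else predT.

Lemma is_cycle_zmod_closed n : zmod_closed (@is_cycle n).
Proof.
case: n => [|n]; split=> [|c d]; rewrite ?unfold_in//= ?raddf0//.
by move=> /eqP c0 /eqP d0; rewrite raddfB /= c0 d0 subrr.
Qed.

HB.instance Definition _ n :=
  GRing.isZmodClosed.Build (chain R X n) (@is_cycle n)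
    (@is_cycle_zmod_closed n).

Definition cycle n : Type := {c : chain R X n | c \in @is_cycle n}.

HB.instance Definition _ n := Choice.on (cycle n).
HB.instance Definition _ n := SubChoice.on (cycle n).
HB.instance Definition _ n :=
  [SubChoice_isSubZmodule of cycle n by <:].

Definition is_boundary n : {pred cycle n} :=
  [pred z : cycle n | `[< exists d, \val z = boundary d >]].

Lemma is_boundary_zmod_closed n : zmod_closed (@is_boundary n).
Proof.
split=> [|z w]; rewrite !unfold_in /=.
  by apply/asboolP; exists 0; rewrite raddf0.
move=> /asboolP[c zc] /asboolP[d wd]; apply/asboolP; exists (c - d).
by rewrite !raddfB /= zc wd.
Qed.

HB.instance Definition _ n :=
  GRing.isZmodClosed.Build (cycle n) (@is_boundary n)
    (@is_boundary_zmod_closed n).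

Definition homology n : zmodType := Quotient.quot (@is_boundary n).

End Homology.

Section RatTensor.
Variable A : zmodType.

(* Q (x) A as the free rational vector space on A modulo additivity: q (x) a is
   the class of the monomial [<< q *g a >>], which is already linear in q. *)
Definition tensor_relator : set {freeg A / rat} :=
  [set x | exists a b, x = << a + b >> - << a >> - << b >>].

(* The linear span of the relators, as the intersection of all subspaces that
   contain them. *)
Definition tensor_rel : {pred {freeg A / rat}} :=
  [pred x | `[< forall S : set {freeg A / rat},
    tensor_relator `<=` S -> S 0 ->
    (forall (q : rat) u v, S u -> S v -> S (q *: u + v)) -> S x >]].

Lemma tensor_rel_submod_closed : submod_closed tensor_rel.
Proof.
split=> [|q u v]; rewrite !unfold_in /=; first by apply/asboolP => S.
move=> /asboolP uR /asboolP vR; apply/asboolP => S genS S0 linS.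
exact: linS (uR S genS S0 linS) (vR S genS S0 linS).
Qed.

HB.instance Definition _ :=
  GRing.isSubmodClosed.Build rat {freeg A / rat} tensor_rel
    tensor_rel_submod_closed.

Definition rat_tensor : Type := Quotient.quot tensor_rel.

HB.instance Definition _ := GRing.Zmodule.on rat_tensor.
HB.instance Definition _ :=
  EqQuotient.copy rat_tensor (Quotient.quot tensor_rel).

Local Open Scope quotient_scope.

Definition tensor_scale (q : rat) (x : rat_tensor) : rat_tensor :=
  \pi_rat_tensor (q *: repr x).

Lemma pi_tensor_scale q (u : {freeg A / rat}) :
  tensor_scale q (\pi_rat_tensor u) = \pi_rat_tensor (q *: u).
Proof.
apply/eqP; rewrite -Quotient.idealrBE -scalerBr rpredZ//.
by rewrite Quotient.idealrBE reprK.
Qed.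

Let pi_tensor_add (u v : {freeg A / rat}) :
  \pi_rat_tensor (u + v) = \pi_rat_tensor u + \pi_rat_tensor v.
Proof. exact: (raddfD \pi_(Quotient.quot tensor_rel)). Qed.

Let tensor_scaleA p q x :
  tensor_scale p (tensor_scale q x) = tensor_scale (p * q) x.
Proof.
by elim/quotW: x => u; rewrite (pi_tensor_scale q u) !pi_tensor_scale scalerA.
Qed.

Let tensor_scale1 : left_id 1 tensor_scale.
Proof. by elim/quotW=> u; rewrite pi_tensor_scale scale1r. Qed.

Let tensor_scaleDr : right_distributive tensor_scale +%R.
Proof.
move=> q; elim/quotW=> u; elim/quotW=> v.
by rewrite -pi_tensor_add !pi_tensor_scale scalerDr pi_tensor_add.
Qed.

Let tensor_scaleDl x :
  {morph tensor_scale^~ x : p q / p + q >-> p + q}.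
Proof.
elim/quotW: x => u p q.
by rewrite /= !pi_tensor_scale scalerDl pi_tensor_add.
Qed.

HB.instance Definition _ :=
  GRing.Zmodule_isLmodule.Build rat rat_tensor
    tensor_scaleA tensor_scale1 tensor_scaleDr tensor_scaleDl.

End RatTensor.

Definition has_dim (V : lmodType rat) (n : nat) :=
  exists b : 'I_n -> V,
    (forall c : 'I_n -> rat, \sum_i c i *: b i = 0 -> forall i, c i = 0) /\
    (forall v, exists c : 'I_n -> rat, v = \sum_i c i *: b i).

Definition betti_spec (R : realType) (X : topologicalType) (i n : nat) :=
  has_dim (rat_tensor (homology R X i)) n.

Definition finite_betti (R : realType) (X : topologicalType) (i : nat) :=
  exists n, betti_spec R X i n.

(* The junk value 0 is taken when the i-th Betti number is infinite. *)
Definition betti (R : realType) (X : topologicalType) (i : nat) : nat :=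
  xget 0%N [set n | betti_spec R X i n].

(* Main.v *)
Require Import Defs.
From HB Require Import structures.
From mathcomp.multinomials Require Import freeg.
From mathcomp Require Import all_boot all_order all_algebra.
From mathcomp Require Import all_classical all_reals all_analysis.
From mathcomp Require Import complex.
From mathcomp Require Import ring lra.

(** An equicontinuous factor [L] whose invariant functions are constant is
    minimal, and a minimal equicontinuous flow of an abelian group is a
    rotation on a compact abelian group. That group is a finite group times a
    torus as soon as its dual is finitely generated, and the topology of [K]
    bounds the dual.

    Eigenfunctions. Averages over orbits converge uniformly to an invariant
    mean on [L] ([mean_exists]). With it, every continuous [u] yields an
    integral operator whose kernel is the invariant pseudometric [orbit_dist
    u]; the operator is compact, symmetric and commutes with the action. Its
    eigenspaces are finite-dimensional, and the commuting action splits them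
    into joint eigenfunctions. These separate points
    ([eigenfunctions_separate]) and can be normalised to circle-valued
    functions [chi] with [chi (g x) = chi (g y0) + chi x], which form an
    abelian group of characters.

    The bound. Pulled back to [K], a character has winding numbers along the
    1-cycles. If they all vanish, it has a real logarithm on each component of
    [K]; the increments of this logarithm along the stabiliser of a component
    are additive and bounded, hence zero, and the character has finite order
    ([torsion_of_logarithm]). So the characters modulo torsion form a lattice
    with a finite basis [b 1 .. b m] ([character_basis]). As a logarithm on a
    single component is enough, the restrictions of the [b j] to the [n]
    components are independent in cohomology, which gives [n * m <= b_1]
    ([character_rank]). A character of finite order is constant on the image
    of each component, so the joint level sets of these characters are at most
    [n] in number; the acting group permutes them like the cosets of a
    subgroup with finite quotient [F] ([torsion_classes]).

    The isomorphism. The level set, as an element of [F], and the values of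
    the [b j] embed [L] in the product of [F] and a torus, because
    eigenfunctions separate points ([coordinates_injective]). The embedding is
    onto by Weyl's argument: on each level set every nontrivial combination of
    the [b j] has mean zero, so that the means of trigonometric polynomials do
    not change under translations of the torus, and no point can be avoided
    ([coordinates_surjective]). The action becomes the rotation by the
    coordinates of [g y0]. *)

Set Implicit Arguments.
Unset Strict Implicit.
Unset Printing Implicit Defensive.

Import Order.TTheory GRing.Theory Num.Theory.
Import numFieldNormedType.Exports.

Local Open Scope classical_set_scope.
Local Open Scope ring_scope.

(** * Commuting matrices, lattices and rational tensor products *)

(** The eigenspaces of one non-scalar member are proper and stable under all
    the others: induction on the dimension. *)
Lemma common_eigenvector_family (C : numClosedFieldType) (I : Type) n
    (A : I -> 'M[C]_n) : (0 < n)%N -> (forall i j, A i *m A j = A j *m A i) ->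
  exists2 v : 'rV[C]_n, v != 0 & forall i, exists c, v *m A i = c *: v.
Proof.
have [k] := ubnP n; elim: k n A => [//|k IH] n A; rewrite ltnS => nk n0 AC.
have [sc|/existsNP[i iNsc]] := pselect (forall i, exists a, A i = a%:M).
  exists (const_mx 1) => [|i].
    apply/negP => /eqP/rowP/(_ (Ordinal n0)).
    by rewrite !mxE => /eqP; rewrite oner_eq0.
  by have [a ->] := sc i; exists a; rewrite mul_mx_scalar.
have [a a_eigen] := eigenvalue_closed (A i) n0.
pose E := eigenspace (A i) a.
have stE j : stablemx E (A j) by apply: comm_mx_stable_eigenspace; exact: AC.
have rE : (\rank E < n)%N.
  rewrite ltn_neqAle rank_leq_row andbT; apply/negP => E1; apply: iNsc; exists a.
  have /eigenspaceP : (1%:M <= E)%MS by rewrite sub1mx.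
  by rewrite mul1mx scalemx1.
have [|||v v0 vP] := IH (\rank E) (fun j => restrictmx E (A j)).
- exact: leq_trans rE nk.
- by rewrite lt0n mxrank_eq0.
- by move=> j j'; rewrite -!conjmxM ?inE ?stablemx_row_base ?stE// AC.
exists (v *m row_base E); first by rewrite mulmx_free_eq0 ?row_base_free.
move=> j; have : stablemx v (restrictmx E (A j)).
  by have [c vc] := vP j; rewrite vc scalemx_sub.
rewrite stablemx_restrict//.
by move=> /eigenvectorP[c /eigenspaceP cP]; exists c.
Qed.

Section ZmodMorphism.
Variables (A B : zmodType) (f : A -> B).
Hypothesis fB : zmod_morphism f.

Lemma zmod_morph0 : f 0 = 0.
Proof. by rewrite -[in LHS](subrr 0) fB subrr. Qed.

Lemma zmod_morphN a : f (- a) = - f a.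
Proof. by rewrite -sub0r fB zmod_morph0 sub0r. Qed.

Lemma zmod_morphD a b : f (a + b) = f a + f b.
Proof. by rewrite -{1}[b]opprK fB zmod_morphN opprK. Qed.

Lemma zmod_morphMn a n : f (a *+ n) = f a *+ n.
Proof. by elim: n => [|n IH]; rewrite ?mulr0n ?zmod_morph0// !mulrS zmod_morphD IH. Qed.

Lemma zmod_morphMz a (n : int) : f (a *~ n) = f a *~ n.
Proof.
by case: n => n; [exact: zmod_morphMn|rewrite NegzE !mulrNz zmod_morphN zmod_morphMn].
Qed.

Lemma zmod_morph_sum (I : Type) (r : seq I) (F : I -> A) :
  f (\sum_(i <- r) F i) = \sum_(i <- r) f (F i).
Proof. exact: (big_morph f zmod_morphD zmod_morph0). Qed.

End ZmodMorphism.

(** The image of [S] under the first [r] coordinates is a subgroup of a free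
    abelian group of rank [r], hence free; [b] lifts a basis of it. By
    induction on [r]: the last coordinate takes on [S] the multiples of its
    least positive value [d], attained at some [z], and [z] completes a basis
    for the elements of [S] with vanishing last coordinate. *)
Lemma image_lattice_basis (X : zmodType) (r : nat) (S : X -> Prop) (phi : nat -> X -> int) :
  S 0 -> (forall x y, S x -> S y -> S (x - y)) ->
  (forall i x y, S x -> S y -> phi i (x - y) = phi i x - phi i y) ->
  exists m (b : 'I_m -> X), [/\ forall j, S (b j),
    forall x, S x -> exists c : 'I_m -> int,
      forall i, (i < r)%N -> phi i (x - \sum_j b j *~ c j) = 0 &
    forall c : 'I_m -> int,
      (forall i, (i < r)%N -> phi i (\sum_j b j *~ c j) = 0) -> forall j, c j = 0].
Proof.
elim: r S => [|r IH] S S0 SB phiB.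
  exists 0%N, (fun=> 0); split=> [[]//|x _|c _ []//].
  by exists (fun=> 0).
have SN x : S x -> S (- x) by move=> Sx; rewrite -sub0r; exact: SB.
have SD x y : S x -> S y -> S (x + y) by move=> Sx Sy; rewrite -[y]opprK; apply: SB => //; exact: SN.
have SMn x n : S x -> S (x *+ n) by move=> Sx; elim: n => [|n IHn]; rewrite ?mulr0n// mulrS; exact: SD.
have SM x (n : int) : S x -> S (x *~ n) by move=> Sx; case: n => n; [exact: SMn|rewrite NegzE mulrNz; apply/SN/SMn].
have Ssum m (b : 'I_m -> X) (c : 'I_m -> int) : (forall j, S (b j)) -> S (\sum_j b j *~ c j).
  by move=> Sb; elim/big_ind: _ => // j _; exact: SM.
have phi0 i : phi i 0 = 0 by rewrite -[in LHS](subrr 0) phiB ?subrr.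
have phiN i x : S x -> phi i (- x) = - phi i x by move=> Sx; rewrite -sub0r phiB// phi0 sub0r.
have phiD i x y : S x -> S y -> phi i (x + y) = phi i x + phi i y.
  by move=> Sx Sy; rewrite -{1}[y]opprK phiB ?phiN ?opprK//; exact: SN.
have phiM i x (n : int) : S x -> phi i (x *~ n) = phi i x * n.
  move=> Sx; have pn k : phi i (x *+ k) = phi i x * k%:Z.
    elim: k => [|k IHk]; first by rewrite mulr0n phi0 mulr0.
    by rewrite mulrS phiD ?IHk//; [rewrite intS mulrDr mulr1|exact: SMn].
  by case: n => n; [exact: pn|rewrite NegzE mulrNz phiN ?pn ?mulrN//; exact: SMn].
pose S' x := S x /\ phi r x = 0.
have [|||m [b [bS' bgen bind]]] := IH S'.
- by split.
- by move=> x y [Sx x0] [Sy y0]; split; [exact: SB|rewrite phiB// x0 y0 subr0].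
- by move=> i x y [Sx _] [Sy _]; exact: phiB.
have bS j : S (b j) by case: (bS' j).
have bsum c : S' (\sum_j b j *~ c j).
  split; first exact: Ssum.
  have [_ //] : S' (\sum_j b j *~ c j).
  elim/big_ind: _ => [//|x y [Sx x0] [Sy y0]|j _]; first by split; [exact: SD|rewrite phiD// x0 y0].
  by split; [exact: SM|rewrite phiM//; case: (bS' j) => _ ->; rewrite mul0r].
pose Q d := `[< (0 < d)%N /\ exists2 x, S x & phi r x = d%:Z >].
have [/asboolP exQ|nQ] := boolP `[< exists d, Q d >]; last first.
  have all0 x : S x -> phi r x = 0.
    move=> Sx; apply: contrapT => /eqP px; move/asboolP: nQ; apply.
    exists `|phi r x|%N; apply/asboolP; rewrite absz_gt0; split=> //.
    have [p0|p0] := lerP 0 (phi r x); first by exists x; rewrite // gez0_abs.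
    by exists (- x); [exact: SN|rewrite phiN// ltz0_abs].
  exists m, b; split=> // [x Sx|c c0].
    have [c cP] := bgen x (conj Sx (all0 x Sx)); exists c => i.
    rewrite ltnS leq_eqVlt => /predU1P[->|]; last exact: cP.
    by apply: all0; apply: SB => //; exact: Ssum.
  by apply: bind => i ir; apply: c0; rewrite ltnS ltnW.
(* The last coordinate of an element of [S] is divisible by [d], since its
   remainder is again a value. *)
case: (ex_minnP exQ) => d /asboolP[d0 [z Sz zd]] dmin.
have dn0 : d%:Z != 0 by rewrite eqz_nat -lt0n.
have dvd x : S x -> phi r x = (phi r x %/ d)%Z * d%:Z.
  move=> Sx; set q := (_ %/ _)%Z; apply/eqP; rewrite -subr_eq0.
  have E : phi r x - q * d%:Z = (phi r x %% d)%Z by rewrite /modz.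
  rewrite E; apply/negPn/negP => rn0.
  have r0 : (0 <= (phi r x %% d)%Z)%R by exact: modz_ge0.
  have rd : ((phi r x %% d)%Z < d%:Z)%R by rewrite ltz_pmod.
  have := dmin `|(phi r x %% d)%Z|%N; case: leqP => [dle _|_ H].
    by move: rd; rewrite -(gez0_abs r0) ltz_nat ltnNge dle.
  suff /H : Q `|(phi r x %% d)%Z|%N by [].
  apply/asboolP; rewrite absz_gt0; split=> //.
  exists (x - z *~ q); first by apply: SB => //; exact: SM.
  by rewrite phiB ?phiM//; [rewrite zd mulrC E gez0_abs|exact: SM].
pose b' (j : 'I_m.+1) := if unlift ord0 j is Some j' then b j' else z.
have sumE (c : 'I_m.+1 -> int) : \sum_j b' j *~ c j = z *~ c ord0 + \sum_j b j *~ c (lift ord0 j).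
  rewrite big_ord_recl /b' unlift_none; congr (_ + _).
  by apply: eq_bigr => j _; rewrite liftK.
exists m.+1, b'; split.
- by move=> j; rewrite /b'; case: unlift.
- move=> x Sx; set q := (phi r x %/ d)%Z.
  have Sy : S' (x - z *~ q).
    split; first by apply: SB => //; exact: SM.
    by rewrite phiB ?phiM//; [rewrite zd (dvd x Sx) mulrC subrr|exact: SM].
  have [c cP] := bgen _ Sy.
  exists (fun j => if unlift ord0 j is Some j' then c j' else q) => i.
  rewrite sumE unlift_none opprD addrA.
  under eq_bigr do rewrite liftK.
  rewrite ltnS leq_eqVlt => /predU1P[->|]; last exact: cP.
  by rewrite phiB; [case: Sy => _ ->; case: (bsum c) => _ ->|case: Sy|case: (bsum c)].
- move=> c c0.
  have c00 : c ord0 = 0.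
    have := c0 r (ltnSn r); rewrite sumE phiD; [|exact: SM|exact: Ssum].
    rewrite phiM// zd; case: (bsum (fun j => c (lift ord0 j))) => _ ->.
    by rewrite addr0 => /eqP; rewrite mulf_eq0 (negbTE dn0) => /eqP.
  move=> j; case: (unliftP ord0 j) => [j' ->|->//].
  apply: (bind (fun j => c (lift ord0 j))) => i ir.
  by have := c0 i (ltnW ir); rewrite sumE c00 mulr0z add0r.
Qed.

Section FreeSum.
Variables (K : choiceType) (M : zmodType).

Definition free_sum (f : K -> M) (c : {freeg K / int}) : M :=
  fglift (f : K -> zmodule M) c.

Lemma free_sumB f : zmod_morphism (free_sum f).
Proof. exact: (@lift_is_additive int K (zmodule M) f). Qed.

Lemma free_sumU f k x : free_sum f << k *g x >> = f x *~ k.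
Proof. by rewrite /free_sum liftU. Qed.

Lemma free_sum1 f x : free_sum f << x >> = f x.
Proof. by rewrite free_sumU mulr1z. Qed.

End FreeSum.

Lemma freegU_scale (K : choiceType) (A : nzRingType) (q : A) (x : K) :
  << q *g x >> = q *: << x >> :> {freeg K / A}.
Proof.
by apply/eqP/freeg_eqP => y; rewrite coeffZ !coeffU mul1r.
Qed.

Lemma freeg_ind (K : choiceType) (A : nzRingType) (P : {freeg K / A} -> Prop) :
  P 0 -> (forall q x d, P d -> P (q *: << x >> + d)) -> forall d, P d.
Proof.
move=> P0 PD d; rewrite -[d]freeg_sumE; elim: (dom d) => [|x r IH].
  by rewrite big_nil.
by rewrite big_cons freegU_scale; exact: PD.
Qed.

Lemma free_additive_eq (K : choiceType) (M : zmodType) (f g : {freeg K / int} -> M) :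
  zmod_morphism f -> zmod_morphism g -> (forall x, f << x >> = g << x >>) -> f =1 g.
Proof.
move=> fB gB fg; elim/freeg_ind => [|q x d IH]; first by rewrite !zmod_morph0.
have -> : q *: << x >> = << x >> *~ q :> {freeg K / int} by rewrite -scaler_int intz.
by rewrite !(zmod_morphD fB, zmod_morphD gB) IH !(zmod_morphMz fB, zmod_morphMz gB) fg.
Qed.

Section Tensor.
Variable A : zmodType.
Local Open Scope quotient_scope.

Definition tens (a : A) : rat_tensor A := \pi_(rat_tensor A) << a >>.

Lemma pi_tensD (u v : {freeg A / rat}) :
  \pi_(rat_tensor A) (u + v) = \pi_(rat_tensor A) u + \pi_(rat_tensor A) v.
Proof. exact: (raddfD \pi_(Quotient.quot (@tensor_rel A))). Qed.

Lemma pi_tensZ q (u : {freeg A / rat}) :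
  \pi_(rat_tensor A) (q *: u) = q *: \pi_(rat_tensor A) u.
Proof. by rewrite -pi_tensor_scale. Qed.

Lemma pi_tens0 : \pi_(rat_tensor A) 0 = 0.
Proof. exact: (raddf0 \pi_(Quotient.quot (@tensor_rel A))). Qed.

Lemma tensD a b : tens (a + b) = tens a + tens b.
Proof.
apply/eqP; rewrite /tens -pi_tensD -Quotient.idealrBE unfold_in /=.
apply/asboolP => S gen _ _; apply: gen; exists a, b.
by rewrite opprD addrA.
Qed.

Lemma tens0 : tens 0 = 0.
Proof. by apply: (addrI (tens 0)); rewrite -tensD !addr0. Qed.

Lemma tensN a : tens (- a) = - tens a.
Proof. by apply: (addIr (tens a)); rewrite -tensD !addNr tens0. Qed.

Lemma tensMn a n : tens (a *+ n) = tens a *+ n.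
Proof. by elim: n => [|n IH]; rewrite ?mulr0n ?tens0// !mulrS tensD IH. Qed.

Lemma tensMz a (n : int) : tens (a *~ n) = tens a *~ n.
Proof. by case: n => n; [exact: tensMn|rewrite NegzE !mulrNz tensN tensMn]. Qed.

Lemma tens_gen (x : rat_tensor A) : exists n a, (0 < n)%N /\ x *+ n = tens a.
Proof.
elim/quotW: x; elim/freeg_ind => [|q x d [n [a [n0 na]]]].
  by exists 1%N, 0; rewrite tens0 pi_tens0.
exists (`|denq q| * n)%N, (x *~ (numq q * n%:Z) + a *+ `|denq q|%N); split.
  by rewrite muln_gt0 absz_gt0 denq_neq0.
rewrite pi_tensD mulrnDl tensD tensMn; congr (_ + _); last by rewrite mulnC mulrnA na.
rewrite tensMz -[X in X *+ _]/(\pi_(rat_tensor A) _) pi_tensZ -/(tens x).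
rewrite -scaler_nat scalerA -scaler_int; congr (_ *: _).
rewrite natrM intrM mulrAC; congr (_ * _).
have -> : (`|denq q|%N%:R : rat) = (denq q)%:~R by rewrite pmulrn gez0_abs// ltW ?denq_gt0.
by rewrite -[X in _ * X]divq_num_den mulrC divfK// intr_eq0 denq_neq0.
Qed.

(** The universal property of the scalar extension to the rationals. *)
Lemma tens_ext (M : lmodType rat) (delta : A -> M) : zmod_morphism delta ->
  exists D : rat_tensor A -> M, (forall a, D (tens a) = delta a) /\
    forall q x y, D (q *: x + y) = q *: D x + D y.
Proof.
move=> dB; pose F : {freeg A / rat} -> M := fglift delta.
have FB : zmod_morphism F by exact: (@lift_is_additive rat A M delta).
have FU q x : F (q *: << x >>) = q *: delta x by rewrite -freegU_scale /F liftU.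
have F1 x : F << x >> = delta x by rewrite /F liftU scale1r.
have FZ q u : F (q *: u) = q *: F u.
  elim/freeg_ind: u => [|p x d IH]; first by rewrite scaler0 zmod_morph0// scaler0.
  by rewrite scalerDr !(zmod_morphD FB) IH scalerA !FU scalerDr scalerA.
have Frel u : u \in @tensor_rel A -> F u = 0.
  rewrite unfold_in /= => /asboolP/(_ [set u | F u = 0]); apply => /=.
  - move=> _ [a [b ->]] /=; rewrite !FB !F1 (zmod_morphD dB).
    by rewrite [delta a + _]addrC addrK subrr.
  - exact: zmod_morph0.
  - by move=> q v w /= v0 w0; rewrite (zmod_morphD FB) FZ v0 w0 scaler0 addr0.
pose D (x : rat_tensor A) := F (repr x).
have Dpi u : D (\pi_(rat_tensor A) u) = F u.
  apply/eqP; rewrite -subr_eq0 -FB; apply/eqP/Frel.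
  by rewrite Quotient.idealrBE reprK.
exists D; split=> [a|q x y]; first by rewrite Dpi F1.
by elim/quotW: x => u; elim/quotW: y => v; rewrite -pi_tensZ -pi_tensD !Dpi (zmod_morphD FB) FZ.
Qed.

(** The [a i] are the elements of a basis of the rationalisation, cleared of
    denominators. *)
Lemma has_dim_detect n : has_dim (rat_tensor A) n ->
  exists a : 'I_n -> A, forall delta : A -> rat,
    zmod_morphism delta ->
    (forall i, delta (a i) = 0) -> forall x, delta x = 0.
Proof.
move=> [b [_ bgen]].
pose a i := projT1 (cid (projT2 (cid (tens_gen (b i))))).
exists a => delta dB da x; have [D [Dt Dl]] := @tens_ext rat^o delta dB.
have D0 : D 0 = 0 by rewrite -tens0 Dt -(subrr 0) dB subrr.
have DZ q y : D (q *: y) = q * D y by have := Dl q y 0; rewrite !addr0 D0 addr0.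
have DD y z : D (y + z) = D y + D z by have := Dl 1 y z; rewrite !scale1r.
have Db i : D (b i) = 0.
  have := projT2 (cid (projT2 (cid (tens_gen (b i))))); rewrite -/(a i).
  move: (projT1 _) => k [k0 ka].
  have : D (b i *+ k) = 0 by rewrite ka Dt.
  by rewrite -scaler_nat DZ => /eqP; rewrite mulf_eq0 pnatr_eq0 gtn_eqF// => /eqP.
rewrite -Dt; have [c ->] := bgen (tens x).
by elim/big_rec: _ => [//|i y _ y0]; rewrite DD y0 DZ Db mulr0 addr0.
Qed.

(** If there were more homomorphisms than detecting elements, the matrix of
    their values would have a kernel; a kernel vector, cleared of
    denominators, is a relation between the homomorphisms themselves. *)
Lemma has_dim_independent n m (delta : 'I_m -> A -> int) :
  has_dim (rat_tensor A) n ->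
  (forall l, zmod_morphism (delta l)) ->
  (forall c : 'I_m -> int, (forall a, \sum_l c l * delta l a = 0) -> forall l, c l = 0) ->
  (m <= n)%N.
Proof.
move=> /has_dim_detect[a aP] dB ind; rewrite leqNgt; apply/negP => nm.
pose B : 'M[rat]_(m, n) := \matrix_(l, i) (delta l (a i))%:~R.
have : kermx B != 0.
  by rewrite -mxrank_eq0 mxrank_ker subn_eq0 -ltnNge (leq_ltn_trans (rank_leq_col _)).
move=> /rowV0Pn[v /sub_kermxP vB v0].
pose N := \prod_l denq (v 0 l).
have N0 : N%:~R != 0 :> rat by rewrite intr_eq0; apply/prodf_neq0 => l _; exact: denq_neq0.
pose c l : int := numq (v 0 l) * \prod_(l' | l' != l) denq (v 0 l').
have cE l : (c l)%:~R = N%:~R * v 0 l :> rat.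
  rewrite /c /N [in RHS](bigD1 l)//= !rmorphM/= mulrAC; congr (_ * _).
  by rewrite mulrC -[X in _ = X * _]divq_num_den divfK// intr_eq0 denq_neq0.
have {}ind := ind c; have : forall l, c l = 0.
  apply: ind => x; apply: (@intr_inj rat).
  apply: (aP (fun x => (\sum_l c l * delta l x)%:~R)) => [y z|i].
    by rewrite -rmorphB/= -sumrB; congr (_ %:~R); apply: eq_bigr => l _; rewrite dB mulrBr.
  rewrite rmorph_sum/=; transitivity (N%:~R * (v *m B) 0 i); last by rewrite vB mxE mulr0.
  by rewrite mxE mulr_sumr; apply: eq_bigr => l _; rewrite mxE rmorphM/= cE mulrA.
move=> c0; move/negP: v0; apply; apply/eqP/rowP => l; rewrite mxE.
by have /eqP := cE l; rewrite c0 eq_sym mulf_eq0 (negbTE N0) => /eqP.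
Qed.

(** This computes the dimension for zeroth homology, where the [p i] are
    points of the components and [w i] counts the points of a chain that lie
    in the [i]-th one. *)
Lemma has_dim_coordinates n (p : 'I_n -> A) (w : 'I_n -> A -> int) :
  (forall i, zmod_morphism (w i)) ->
  (forall i j, w i (p j) = (i == j)%:R) ->
  (forall a, exists c : 'I_n -> int, a = \sum_i p i *~ c i) ->
  has_dim (rat_tensor A) n.
Proof.
move=> wB wp gen; exists (fun i => tens (p i)); split=> [c c0 i|x].
  have [|D [Dt Dl]] := @tens_ext rat^o (fun a => (w i a)%:~R).
    by move=> a b; rewrite wB rmorphB.
  have D0 : D 0 = 0.
    rewrite -tens0 Dt -(subrr 0) wB subrr; exact: rmorph0.
  have DZ q y : D (q *: y) = q * D y by have := Dl q y 0; rewrite !addr0 D0 addr0.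
  have DD y z : D (y + z) = D y + D z by have := Dl 1 y z; rewrite !scale1r.
  have : D (\sum_i c i *: tens (p i)) = 0 by rewrite c0.
  rewrite (big_morph D DD D0) (bigD1 i)//= big1 ?addr0; last first.
    by move=> j ji; rewrite DZ Dt wp eq_sym (negbTE ji) mulr0.
  by rewrite DZ Dt wp eqxx mulr1.
have [n' [a [n0 na]]] := tens_gen x; have [c ac] := gen a.
exists (fun i => n'%:R^-1 * (c i)%:~R).
have -> : x = n'%:R^-1 *: (x *+ n').
  by rewrite -scaler_nat scalerA mulVf ?scale1r// pnatr_eq0 -lt0n.
rewrite na ac (big_morph tens tensD tens0) scaler_sumr; apply: eq_bigr => i _.
by rewrite tensMz -scaler_int scalerA.
Qed.

End Tensor.

Lemma has_dim_unique (V : lmodType rat) m n : has_dim V m -> has_dim V n -> m = n.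
Proof.
suff le k l : has_dim V k -> has_dim V l -> (k <= l)%N.
  by move=> Vm Vn; apply/eqP; rewrite eqn_leq !le.
move=> [b [bf bg]] [d [df dg]].
pose P : 'M[rat]_(k, l) := \matrix_(i, j) projT1 (cid (dg (b i))) j.
pose Q : 'M[rat]_(l, k) := \matrix_(i, j) projT1 (cid (bg (d i))) j.
apply: (@mulmx1_min _ _ _ P Q); apply/matrixP => i j0; apply/eqP; rewrite -subr_eq0; apply/eqP.
apply: (bf (fun j => (P *m Q) i j - (1%:M : 'M[rat]_k) i j)).
have bE : b i = \sum_j (P *m Q) i j *: b j.
  rewrite [LHS](projT2 (cid (dg (b i)))).
  under eq_bigr => k0 _ do rewrite [d k0](projT2 (cid (bg (d k0)))) scaler_sumr.
  rewrite exchange_big/=; apply: eq_bigr => k0 _; rewrite mxE scaler_suml.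
  by apply: eq_bigr => l0 _; rewrite !mxE scalerA.
under eq_bigr do rewrite scalerBl.
rewrite sumrB -bE (bigD1 i)//= mxE eqxx scale1r big1 ?addr0 ?subrr// => j ji.
by rewrite mxE eq_sym (negbTE ji) scale0r.
Qed.

(** * The circle and its universal covering *)

Section Circle.
Variable R : realType.
Implicit Types z w : circle R.

Definition cre z : R := complex.Re (\val z).
Definition cim z : R := complex.Im (\val z).

Lemma circle_eq z w : cre z = cre w -> cim z = cim w -> z = w.
Proof.
move=> re im; apply: val_inj; move: re im; rewrite /cre /cim.
by case: (\val z) (\val w) => [a b] [c d] /= -> ->.
Qed.

Lemma cre2Dcim2 z : cre z ^+ 2 + cim z ^+ 2 = 1.
Proof.
have : `|\val z| = 1 :> R[i] by have /set_mem := valP z.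
rewrite normc_def => -[] H.
rewrite -[LHS]sqr_sqrtr ?addr_ge0 ?sqr_ge0// /cre /cim H expr1n//.
Qed.

Lemma circle_norm1 (c s : R) : c ^+ 2 + s ^+ 2 = 1 -> `|(c +i* s)%C| = 1 :> R[i].
Proof. by move=> h; rewrite normc_def /= h sqrtr1. Qed.

Definition circle_pt (c s : R) (h : c ^+ 2 + s ^+ 2 = 1) : circle R :=
  circle_mk (circle_norm1 h).

Lemma creD z w : cre (z + w) = cre z * cre w - cim z * cim w.
Proof. by rewrite /cre /cim /=; case: (\val z) (\val w) => [a b] [c d]. Qed.

Lemma cimD z w : cim (z + w) = cre z * cim w + cim z * cre w.
Proof. by rewrite /cre /cim /=; case: (\val z) (\val w) => [a b] [c d]. Qed.

Lemma cre0 : cre 0 = 1. Proof. by []. Qed.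
Lemma cim0 : cim 0 = 0. Proof. by []. Qed.

Lemma circle_oppE z : cre (- z) = cre z /\ cim (- z) = - cim z.
Proof.
have := cre2Dcim2 z; rewrite /cre /cim /=; case: (\val z) => a b /= -> /=.
by rewrite !divr1.
Qed.

Lemma creN z : cre (- z) = cre z. Proof. by case: (circle_oppE z). Qed.
Lemma cimN z : cim (- z) = - cim z. Proof. by case: (circle_oppE z). Qed.

Lemma cre_le1 z : cre z <= 1.
Proof. by have := cre2Dcim2 z; have := sqr_ge0 (cim z); nra. Qed.

Lemma cre_eq1 z : cre z = 1 -> z = 0.
Proof.
move=> z1; apply: circle_eq => //; have := cre2Dcim2 z; rewrite z1 cim0 expr1n.
by move=> h; apply/eqP; rewrite -sqrf_eq0; apply/eqP; lra.
Qed.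

Lemma continuous_val_circle : continuous (\val : circle R -> R[i]^o).
Proof. exact: (@initial_continuous _ _ (set_val : [set z : R[i]^o | `|z| = 1] -> R[i]^o)). Qed.

Lemma continuous_Re : continuous (@complex.Re R : R[i]^o -> R).
Proof.
move=> z U /nbhs_ballP[e /= e0 eU]; apply/nbhs_ballP; exists e%:C%C => /=.
  by rewrite ltcR.
move=> w; rewrite -ball_normE /= => zw; apply: eU; rewrite -ball_normE /=.
rewrite -ltcR; apply: le_lt_trans zw; rewrite -raddfB; exact: normc_ge_Re.
Qed.

Lemma continuous_Im : continuous (@complex.Im R : R[i]^o -> R).
Proof.
move=> z U /nbhs_ballP[e /= e0 eU]; apply/nbhs_ballP; exists e%:C%C => /=.
  by rewrite ltcR.
move=> w; rewrite -ball_normE /= => zw; apply: eU; rewrite -ball_normE /=.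
rewrite -ltcR; apply: le_lt_trans zw; rewrite -raddfB; rewrite normc_def lecR -sqrtr_sqr ler_sqrt ?addr_ge0 ?sqr_ge0//.
by rewrite lerDr sqr_ge0.
Qed.

Lemma continuous_complex (T : topologicalType) (a b : T -> R) :
  continuous a -> continuous b ->
  continuous (fun x => (a x +i* b x)%C : R[i]^o).
Proof.
move=> ca cb x; apply/cvgrPdist_lt => e; rewrite ltcE /= => /andP[/eqP e2 e0].
have -> : e = (complex.Re e)%:C%C by move: e2; case: e {e0} => e1 e2 /= ->.
move: (complex.Re e) e0 => {e2}e e0.
have e2 : 0 < e / 2 by rewrite divr_gt0.
near=> y.
have ay : `|a x - a y| < e / 2 by near: y; have /cvgrPdist_lt := ca x; apply.
have by_ : `|b x - b y| < e / 2 by near: y; have /cvgrPdist_lt := cb x; apply.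
rewrite normc_def ltcR /= -[e]ger0_norm ?ltW// -sqrtr_sqr ltr_sqrt ?exprn_gt0//.
move: ay by_; rewrite !ltr_norml => /andP[? ?] /andP[? ?]; nra.
Unshelve. all: by end_near. Qed.

Lemma continuous_cre : continuous cre.
Proof.
move=> z; apply: (@continuous_comp _ _ _ (\val : circle R -> R[i]^o) (@complex.Re R : R[i]^o -> R)).
  exact: continuous_val_circle.
exact: continuous_Re.
Qed.

Lemma continuous_cim : continuous cim.
Proof.
move=> z; apply: (@continuous_comp _ _ _ (\val : circle R -> R[i]^o) (@complex.Im R : R[i]^o -> R)).
  exact: continuous_val_circle.
exact: continuous_Im.
Qed.

Lemma continuous_circle (T : topologicalType) (f : T -> circle R) :
  continuous (cre \o f) -> continuous (cim \o f) -> continuous f.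
Proof.
move=> cr ci.
apply: (@continuous_comp_initial _ _ _ (set_val : [set z : R[i]^o | `|z| = 1] -> R[i]^o)).
have -> : set_val \o f = (fun x => (cre (f x) +i* cim (f x))%C : R[i]^o).
  by apply/funext => x /=; rewrite /cre /cim set_valE; case: (\val (f x)).
exact: continuous_complex cr ci.
Qed.

Lemma cont_cre (T : topologicalType) (f : T -> circle R) :
  continuous f -> continuous (fun x => cre (f x)).
Proof. by move=> cf x; apply: continuous_comp; [exact: cf|exact: continuous_cre]. Qed.

Lemma cont_cim (T : topologicalType) (f : T -> circle R) :
  continuous f -> continuous (fun x => cim (f x)).
Proof. by move=> cf x; apply: continuous_comp; [exact: cf|exact: continuous_cim]. Qed.

Lemma cont_circleD (T : topologicalType) (f g : T -> circle R) :
  continuous f -> continuous g -> continuous (fun x => f x + g x).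
Proof.
move=> cf cg; apply: continuous_circle.
  have -> : cre \o (fun x => f x + g x) = fun x => cre (f x) * cre (g x) - cim (f x) * cim (g x).
    by apply/funext => x /=; rewrite creD.
  by move=> x; apply: cvgB; apply: cvgM; first [exact: cont_cre|exact: cont_cim].
have -> : cim \o (fun x => f x + g x) = fun x => cre (f x) * cim (g x) + cim (f x) * cre (g x).
  by apply/funext => x /=; rewrite cimD.
by move=> x; apply: cvgD; apply: cvgM; first [exact: cont_cre|exact: cont_cim].
Qed.

Lemma cont_circleN (T : topologicalType) (f : T -> circle R) :
  continuous f -> continuous (fun x => - f x).
Proof.
move=> cf; apply: continuous_circle.
  have -> : cre \o (fun x => - f x) = fun x => cre (f x) by apply/funext => x /=; rewrite creN.
  exact: cont_cre.
have -> : cim \o (fun x => - f x) = fun x => - cim (f x) by apply/funext => x /=; rewrite cimN.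
by move=> x; apply: cvgN; exact: cont_cim.
Qed.

Lemma cont_circleB (T : topologicalType) (f g : T -> circle R) :
  continuous f -> continuous g -> continuous (fun x => f x - g x).
Proof. by move=> cf cg; apply: cont_circleD => //; exact: cont_circleN. Qed.

(** The universal covering of the circle. *)
Definition cexp (t : R) : circle R := circle_pt (cos2Dsin2 t).

Lemma cre_cexp t : cre (cexp t) = cos t. Proof. by []. Qed.
Lemma cim_cexp t : cim (cexp t) = sin t. Proof. by []. Qed.

Lemma cexpD s t : cexp (s + t) = cexp s + cexp t.
Proof.
apply: circle_eq; first by rewrite creD !cre_cexp !cim_cexp cosD.
by rewrite cimD !cre_cexp !cim_cexp sinD addrC.
Qed.

Lemma cexp0 : cexp 0 = 0.
Proof. by apply: cre_eq1; rewrite cre_cexp cos0. Qed.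

Lemma cexpN t : cexp (- t) = - cexp t.
Proof. by apply/eqP; rewrite -addr_eq0 -cexpD addNr cexp0. Qed.

Lemma cexpB s t : cexp (s - t) = cexp s - cexp t.
Proof. by rewrite cexpD cexpN. Qed.

Lemma cexp_eq0_small t : cexp t = 0 -> `|t| < pi *+ 2 -> t = 0.
Proof.
wlog t0 : t / 0 <= t.
  move=> H e0 tp; have [/H|/ltW t0] := lerP 0 t; first exact.
  by apply/eqP; rewrite -oppr_eq0; apply/eqP/H; rewrite ?oppr_ge0 ?cexpN ?e0 ?oppr0 ?normrN.
move=> /(congr1 cre); rewrite cre_cexp cre0 (ger0_norm t0) => c1 tp.
have [tpi|tpi] := leP t pi.
  by apply: (@cos_inj R); rewrite ?in_itv/= ?lexx ?pi_ge0 ?t0 ?tpi// cos0.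
have : pi *+ 2 - t = 0.
  apply: (@cos_inj R); rewrite ?in_itv/= ?lexx ?pi_ge0//.
    by rewrite subr_ge0 ltW//= lerBlDr mulr2n lerD2l ltW.
  by rewrite cos0 cosB cos2pi sin2pi mul0r addr0 mul1r.
by move=> /eqP; rewrite subr_eq0 => /eqP E; rewrite E ltxx in tp.
Qed.

Lemma cexp_eq0 t : cexp t = 0 -> exists n : int, t = (pi *+ 2) * n%:~R.
Proof.
move=> et; have p2 : 0 < pi *+ 2 :> R by rewrite pmulrn_rgt0// pi_gt0.
exists (Num.floor (t / (pi *+ 2))); set n := Num.floor _.
apply/eqP; rewrite -subr_eq0; apply/eqP; apply: cexp_eq0_small.
  rewrite cexpB et sub0r; apply/eqP; rewrite oppr_eq0; apply/eqP.
  have ep : cexp (pi *+ 2) = 0 by apply: cre_eq1; rewrite cre_cexp cos2pi.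
  have en (k : nat) : cexp (pi *+ 2 * k%:R) = 0.
    by elim: k => [|k IH]; rewrite ?mulr0 ?cexp0// -natr1 mulrDr mulr1 cexpD IH ep addr0.
  by case: (n) => k; [exact: en|rewrite NegzE mulrNz mulrN cexpN en oppr0].
have : n%:~R <= t / (pi *+ 2) < (n + 1)%:~R by apply: floor_itv.
rewrite ler_pdivlMr// ltr_pdivrMr// intrD mulrDl mul1r => /andP[a b].
by rewrite ger0_norm ?subr_ge0 1?mulrC// ltrBlDl.
Qed.

(** The principal argument, on the right half of the circle. *)
Definition parg z : R := asin (cim z).

Lemma cim_bound z : 0 < cre z -> -1 < cim z < 1.
Proof. by have := cre2Dcim2 z => h c0; apply/andP; split; nra. Qed.

Lemma cexp_parg z : 0 < cre z -> cexp (parg z) = z.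
Proof.
move=> c0; have /andP[a b] := cim_bound c0.
have s1 : -1 <= cim z <= 1 by rewrite !ltW.
apply: circle_eq; last by rewrite cim_cexp asinK// in_itv/=.
by rewrite cre_cexp cos_asin// -(cre2Dcim2 z) addrK sqrtr_sqr ger0_norm// ltW.
Qed.

Lemma parg_bound z : 0 < cre z -> `|parg z| <= pi / 2.
Proof.
move=> c0; have /andP[a b] := cim_bound c0.
have s1 : -1 <= cim z <= 1 by rewrite !ltW.
by rewrite ler_norml asin_geNpi2 ?asin_lepi2.
Qed.

Lemma parg0 : parg 0 = 0.
Proof.
have p0 : 0 < cre (0 : circle R) by rewrite cre0 ltr01.
apply: cexp_eq0_small; first by rewrite cexp_parg.
apply: le_lt_trans (parg_bound p0) _.
by have := pi_gt0 R; rewrite -[pi *+ 2]mulr_natr; lra.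
Qed.

Lemma continuous_parg z : 0 < cre z -> {for z, continuous parg}.
Proof.
move=> c0; apply: continuous_comp; first exact: continuous_cim.
by apply: continuous_asin; exact: cim_bound.
Qed.

(** The fibres of the covering are discrete, so a path in a fibre is constant:
    a path with distinct ends would pass, by the intermediate value theorem,
    through points within [pi] of its origin. Uniqueness of lifts rests on
    this. *)
Lemma cexp_eq0_itv (f : R -> R) : continuous f ->
  (forall t, 0 <= t <= 1 -> cexp (f t) = 0) -> f 0 = f 1.
Proof.
move=> cf f0; have p2 : 0 < pi *+ 2 :> R by rewrite pmulrn_rgt0// pi_gt0.
pose g t := f t - f 0; have cg : continuous g.
  by move=> t; apply: cvgB; [exact: cf|exact: cvg_cst].
have e0 : cexp (f 0) = 0 by apply: f0; rewrite lexx ler01.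
have g0 t : 0 <= t <= 1 -> cexp (g t) = 0 by move=> /f0 H; rewrite /g cexpB H e0 subrr.
suff : g 1 = 0 by move=> /eqP; rewrite subr_eq0 => /eqP.
apply: contrapT => /eqP g1.
have pp := pi_gt0 R; have pp2 : pi < pi *+ 2 :> R by rewrite -[pi *+ 2]mulr_natr; lra.
have g00 : g 0 = 0 by rewrite /g subrr.
have key v : Num.min (g 0) (g 1) <= v <= Num.max (g 0) (g 1) -> `|v| <= pi -> v = 0.
  move=> vb vpi; have [c] := IVT ler01 (continuous_subspaceT cg) vb.
  rewrite in_itv/= => c01 gc; apply: cexp_eq0_small; last exact: le_lt_trans vpi pp2.
  by rewrite -gc g0.
have [gp|gn|g10] := ltgtP 0 (g 1); last by rewrite -g10 eqxx in g1.
  pose v := Num.min pi (g 1); have v0 : 0 < v by rewrite lt_min pp.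
  suff v00 : v = 0 by rewrite v00 ltxx in v0.
  have vpi : v <= pi by rewrite ge_min lexx.
  have vg : v <= g 1 by rewrite ge_min lexx orbT.
  apply: key; last by rewrite gtr0_norm.
  by apply/andP; split; [rewrite ge_min g00 (ltW v0)|rewrite le_max vg orbT].
pose v := Num.max (- pi) (g 1); have v0 : v < 0 by rewrite gt_max oppr_lt0 pp.
suff v00 : v = 0 by rewrite v00 ltxx in v0.
have vpi : - pi <= v by rewrite le_max lexx.
have vg : g 1 <= v by rewrite le_max lexx orbT.
apply: key; last by rewrite ltr0_norm// lerNl.
by apply/andP; split; [rewrite ge_min vg orbT|rewrite le_max g00 (ltW v0)].
Qed.

End Circle.

(** * Continuous functions on compact spaces *)

Lemma compact_nbhs_cover (T : topologicalType) (U : T -> set T) :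
  compact [set: T] -> (forall x, nbhs x (U x)) ->
  exists s : seq T, forall y, exists2 x, x \in s & U x y.
Proof.
move=> cT nU; apply: contrapT => /forallNP ncov.
pose F := [set A : set T | exists s : seq T,
  [set y | forall x, x \in s -> ~ U x y] `<=` A].
have FF : ProperFilter F.
  split; first by move=> [s s0]; apply: (ncov s) => y; apply: contrapT => sy;
    apply: (s0 y) => x xs Uxy; apply: sy; exists x.
  split; first by exists [::].
    move=> A B [s sA] [t tB]; exists (s ++ t) => y yst; split; [apply: sA|apply: tB];
    by move=> x xs; apply: yst; rewrite mem_cat xs ?orbT.
  by move=> A B AB [s sA]; exists s; exact: subset_trans sA AB.
have [|y [_ yF]] := cT F FF; first by exists [::].
have [z []] : [set z | ~ U y z] `&` U y !=set0; last by [].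
by apply: yF; [exists [:: y] => z /(_ y); apply; rewrite inE|exact: nU].
Qed.

Lemma compact_bound (R : realType) (T : topologicalType) (f : T -> R) :
  compact [set: T] -> continuous f -> exists2 M, 0 < M & forall x, `|f x| <= M.
Proof.
move=> cT cf; have : compact (f @` setT).
  by apply: continuous_compact => //; apply: continuous_subspaceT.
move/compact_bounded => [M [Mr MB]].
exists (Num.max (M + 1) 1); first by rewrite lt_max ltr01 orbT.
move=> x; apply: (MB (Num.max (M+1) 1)); last by exists x.
by rewrite lt_max ltrDl ltr01.
Qed.

Section RealContinuity.
Variables (R : realType) (T : topologicalType).
Implicit Types f g : T -> R.

Lemma contD f g : continuous f -> continuous g -> continuous (fun x => f x + g x).
Proof. by move=> cf cg x; apply: cvgD; [exact: cf|exact: cg]. Qed.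

Lemma contM f g : continuous f -> continuous g -> continuous (fun x => f x * g x).
Proof. by move=> cf cg x; apply: cvgM; [exact: cf|exact: cg]. Qed.

Lemma contZ (c : R) f : continuous f -> continuous (fun x => c * f x).
Proof. by move=> cf x; apply: cvgM; [exact: cvg_cst|exact: cf]. Qed.

Lemma contB f g : continuous f -> continuous g -> continuous (fun x => f x - g x).
Proof. by move=> cf cg x; apply: cvgB; [exact: cf|exact: cg]. Qed.

Lemma cont_norm f : continuous f -> continuous (fun x => `|f x|).
Proof. by move=> cf x; apply: cvg_norm; exact: cf. Qed.

Lemma cont_sum (I : Type) (r : seq I) (f : I -> T -> R) :
  (forall i, continuous (f i)) -> continuous (fun x => \sum_(i <- r) f i x).
Proof.
move=> cf; elim: r => [|i r IH].
  by under eq_fun do rewrite big_nil; move=> x; exact: cvg_cst.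
by under eq_fun do rewrite big_cons; exact: contD.
Qed.

End RealContinuity.

(** * The invariant mean of a minimal equicontinuous flow *)

Section Mean.
Variables (R : realType) (G : zmodType) (L : topologicalType).
Variable act : G -> L -> L.
Hypothesis cptL : compact [set: L].
Hypothesis act0 : forall x, act 0 x = x.
Hypothesis actD : forall g h x, act (g + h) x = act g (act h x).
Hypothesis act_cont : forall g, continuous (act g).
Hypothesis minL : minimal_flow act.
Hypothesis equi : forall u : L -> R, continuous u -> forall x (e : R), 0 < e ->
  \forall y \near x, forall g, `|u (act g x) - u (act g y)| < e.

Implicit Types f : L -> R.

Lemma cont_act g (f : L -> R) : continuous f -> continuous (fun x => f (act g x)).
Proof.
move=> cf x; apply: (@continuous_comp _ _ _ (act g) f); [exact: act_cont|exact: cf].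
Qed.

Definition avg (s : seq G) (f : L -> R) (x : L) : R :=
  (size s)%:R^-1 * \sum_(g <- s) f (act g x).

Lemma avg_le s f M x : (0 < size s)%N -> (forall y, f y <= M) -> avg s f x <= M.
Proof.
move=> s0 fM; rewrite /avg ler_pdivrMl ?ltr0n//.
apply: (@le_trans _ _ (\sum_(g <- s) M)); first exact: ler_sum.
by rewrite big_const_seq count_predT iter_addr_0 mulr_natl.
Qed.

Lemma avgD s f g x : avg s (fun y => f y + g y) x = avg s f x + avg s g x.
Proof. by rewrite /avg big_split mulrDr. Qed.

Lemma avgZ s c f x : avg s (fun y => c * f y) x = c * avg s f x.
Proof. by rewrite /avg -mulr_sumr mulrCA. Qed.

Lemma avg_cst s c x : (0 < size s)%N -> avg s (fun=> c) x = c.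
Proof.
move=> s0; rewrite /avg big_const_seq count_predT iter_addr_0 -[c *+ _]mulr_natl mulrA.
by rewrite mulVf ?mul1r// pnatr_eq0 -lt0n.
Qed.

Lemma avg_dist s f c e x :
  (0 < size s)%N -> (forall y, `|f y - c| <= e) -> `|avg s f x - c| <= e.
Proof.
move=> s0 fc; have -> : avg s f x - c = avg s (fun y => f y - c) x.
  by rewrite avgD avg_cst.
rewrite ler_norml -lerNl -mulN1r -avgZ; apply/andP; split.
  by apply: avg_le => // y; rewrite mulN1r lerNl; have := fc y; rewrite ler_norml => /andP[].
by apply: avg_le => // y; have := fc y; rewrite ler_norml => /andP[].
Qed.

Lemma avg_avg s t f x : avg s (avg t f) x = avg [seq g + h | g <- t, h <- s] f x.
Proof.
rewrite /avg size_allpairs natrM invfM -mulrA [in RHS]mulrCA; congr (_ * _).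
rewrite -mulr_sumr; congr (_ * _).
rewrite big_allpairs_dep exchange_big/=; apply: eq_bigr => g _.
by apply: eq_bigr => h _; rewrite actD.
Qed.

Lemma avg_avgC s t f x : avg s (avg t f) x = avg t (avg s f) x.
Proof.
rewrite /avg -mulr_sumr -mulr_sumr mulrCA; congr (_ * (_ * _)).
rewrite exchange_big/=; apply: eq_bigr => g _.
by apply: eq_bigr => h _; rewrite -!actD addrC.
Qed.

(** Uniform approximation by averages over the orbit; for an equicontinuous
    flow this pins down the integral against the unique invariant probability
    measure. *)
Definition is_mean (f : L -> R) (c : R) := forall e, 0 < e ->
  exists2 s, (0 < size s)%N & forall x, `|avg s f x - c| <= e.

Variable x0 : L.

(** Averages commute because the group is abelian, so an average of averages
    is close to both constants. *)
Lemma is_mean_unique f c d : is_mean f c -> is_mean f d -> c = d.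
Proof.
move=> fc fd; apply/eqP; rewrite -subr_eq0 -normr_le0.
apply/ler_addgt0Pl => e e0; rewrite addr0.
have e2 : 0 < e / 2 by rewrite divr_gt0.
have [s s0 sP] := fc _ e2; have [t t0 tP] := fd _ e2.
rewrite (splitr e) (le_trans _ (lerD (avg_dist x0 t0 sP) (avg_dist x0 s0 tP)))//.
by rewrite avg_avgC (distrC _ c) (le_trans _ (ler_normD _ _))// addrA subrK.
Qed.

Lemma equi_avg (f : L -> R) x (e : R) : continuous f -> 0 < e ->
  \forall y \near x, forall s, (0 < size s)%N -> `|avg s f x - avg s f y| <= e.
Proof.
move=> cf e0; near=> y => s s0.
have ye : forall g, `|f (act g x) - f (act g y)| < e by near: y; exact: equi.
rewrite /avg -mulrBr -sumrB normrM ger0_norm ?invr_ge0//.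
rewrite ler_pdivrMl ?ltr0n// (le_trans (ler_norm_sum _ _ _))//.
rewrite (@le_trans _ _ (\sum_(g <- s) e))//; first by apply: ler_sum => g _; exact: ltW.
by rewrite big_const_seq count_predT iter_addr_0 mulr_natl.
Unshelve. all: by end_near. Qed.

(** By minimality every orbit visits the neighbourhood, and by compactness the
    visits can be made with finitely many group elements. *)
Lemma orbit_cover (z : L) (U : set L) : nbhs z U ->
  exists t : seq G, forall x, exists2 g, g \in t & U (act g x).
Proof.
move=> nU; have zV (x : L) : exists g, U^° (act g x).
  have [w [wU [g _ gw]]] := minL x (ex_intro _ z nU) (open_interior U).
  by exists g; rewrite gw.
pose h x := projT1 (cid (zV x)).
have [xs xsP] := @compact_nbhs_cover _ (fun x => act (h x) @^-1` U^°) cptL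
  (fun x => act_cont (open_nbhs_nbhs (conj (open_interior U) (projT2 (cid (zV x)))))).
exists (map h xs) => x; have [x' xx' x'P] := xsP x.
by exists (h x'); [exact: map_f | exact: interior_subset x'P].
Qed.

Lemma uniform_return (U : L -> set L) : (forall y, nbhs y (U y)) ->
  exists t : seq G, forall x y, exists2 g, g \in t &
    exists2 z, U z y & U z (act g x).
Proof.
move=> nU; have [ys ysP] := compact_nbhs_cover cptL nU.
exists (flatten [seq projT1 (cid (orbit_cover (nU z))) | z <- ys]) => x y.
have [z zys zy] := ysP y; have [g gz gx] := projT2 (cid (orbit_cover (nU z))) x.
exists g; last by exists z.
by apply/flattenP; exists (projT1 (cid (orbit_cover (nU z)))) => //; exact: map_f.
Qed.

(** The candidate is the infimum of the uniform upper bounds of averages. An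
    average [A f] with an almost optimal bound cannot fall far below it
    anywhere: by equicontinuity every orbit returns, through one of finitely
    many elements, to points where [A f] is as low, and averaging over those
    elements would improve the bound. *)
Lemma mean_exists (f : L -> R) : continuous f -> exists c, is_mean f c.
Proof.
move=> cf; have [M M0 fM] := compact_bound cptL cf.
pose S := [set m : R | exists2 s, (0 < size s)%N & forall x, avg s f x <= m].
have SM : S M.
  exists [:: 0] => // x; apply: avg_le => // y.
  exact: le_trans (ler_norm _) (fM y).
have Slb : lbound S (- M).
  move=> m [s s0 /(_ x0) sm]; apply: le_trans sm.
  rewrite lerNl -mulN1r -avgZ; apply: avg_le => // y.
  by rewrite mulN1r; apply: le_trans (fM y); rewrite -normrN ler_norm.
have Si : has_inf S by split; [exists M | exists (- M)].
exists (inf S) => e e0.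
have e4 : 0 < e / 2 / 2 by rewrite !divr_gt0.
have [t tP] := uniform_return (fun y => @equi_avg f y _ cf e4).
pose N : R := (size t)%:R.
have t0 : (0 < size t)%N by have [g] := tP x0 x0; case: (t).
have N0 : 0 < N by rewrite ltr0n.
have [m [s s0 sm] mS] := inf_adherent (divr_gt0 (divr_gt0 e0 (ltr0Sn R 1)) N0 : 0 < e / 2 / N) Si.
exists s => // y; rewrite ler_distl; apply/andP; split; last first.
  rewrite (le_trans (sm y))// (le_trans (ltW mS))// lerD2l.
  rewrite ler_pdivrMr// (@le_trans _ _ e)//; first by rewrite ler_pdivrMr// ler_peMr ?ler1n// ltW.
  by rewrite ler_peMr ?ler1n// ltW.
(* Averaging once more over the [N] returns: one of the terms is close to the
   value at [y], the others are at most [m]. Were [avg s f y] below [inf S -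
   e], this bound would lie below the infimum. *)
suff /(ge_inf Si.2) : S (N^-1 * (avg s f y + e / 2 + (N - 1) * m)).
  rewrite mulrC ler_pdivlMr// => H.
  have : m * N < (inf S) * N + e / 2 by rewrite -ltr_pdivlMr// mulrDl mulfK ?gt_eqF.
  have N1 : 1 <= N by rewrite ler1n.
  have : inf S <= m by apply: (ge_inf Si.2); exists s.
  nra.
exists [seq g + h | g <- s, h <- t] => [|x].
  by rewrite size_allpairs muln_gt0 s0.
rewrite -avg_avg /avg -/N ler_pM2l ?invr_gt0//.
have [g gt [z zy zx]] := tP x y.
rewrite (perm_big _ (perm_to_rem gt)) big_cons/= lerD//.
  have := zy s s0; have := zx s s0; rewrite !ler_distl => /andP[a b] /andP[c d].
  rewrite /avg in a b c d *; lra.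
apply: (@le_trans _ _ (\sum_(h <- rem g t) m)).
  by apply: ler_sum => h _; exact: sm.
rewrite big_const_seq count_predT iter_addr_0 size_rem// -mulr_natl.
by rewrite /N -{2}(prednK t0) -natr1 addrK.
Qed.

Definition mean (f : L -> R) : R := xget 0 [set c | is_mean f c].

Lemma meanP (f : L -> R) : continuous f -> is_mean f (mean f).
Proof. by move=> /mean_exists[c fc]; rewrite /mean; case: xgetP => [|/(_ c)]. Qed.

Lemma mean_eq f c : is_mean f c -> mean f = c.
Proof.
move=> fc; rewrite /mean; case: xgetP => [d _ fd|/(_ c)//].
exact: is_mean_unique fd fc.
Qed.

Lemma meanD (f g : L -> R) : continuous f -> continuous g ->
  mean (fun x => f x + g x) = mean f + mean g.
Proof.
move=> cf cg; apply: mean_eq => e e0; have e2 : 0 < e / 2 by rewrite divr_gt0.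
have [s s0 sP] := meanP cf e2; have [t t0 tP] := meanP cg e2.
exists [seq g + h | g <- t, h <- s] => [|x]; first by rewrite size_allpairs muln_gt0 t0.
rewrite avgD -!avg_avg avg_avgC opprD addrACA (splitr e).
rewrite (le_trans (ler_normD _ _))// lerD//; exact: avg_dist.
Qed.

Lemma meanZ (c : R) (f : L -> R) : continuous f -> mean (fun x => c * f x) = c * mean f.
Proof.
move=> cf; apply: mean_eq => e e0.
have e2 : 0 < e / (`|c| + 1) by rewrite divr_gt0// ltr_wpDl.
have [s s0 sP] := meanP cf e2; exists s => // x.
rewrite avgZ -mulrBr normrM (le_trans (ler_wpM2l (normr_ge0 c) (sP x)))//.
by rewrite mulrCA ger_pMr// ler_pdivrMr ?ltr_wpDl// mul1r lerDl.
Qed.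

Lemma mean_cst c : mean (fun=> c) = c.
Proof.
apply: mean_eq => e e0; exists [:: 0] => // x.
by rewrite avg_cst// subrr normr0 ltW.
Qed.

Lemma mean_act g (f : L -> R) : continuous f -> mean (fun x => f (act g x)) = mean f.
Proof.
move=> cf; apply: mean_eq => e e0; have [s s0 sP] := meanP cf e0.
exists s => // x; have := sP (act g x); congr (`|_ * _ - _| <= _).
by apply: eq_bigr => h _; rewrite -!actD addrC.
Qed.

Lemma ler_mean (f g : L -> R) : continuous f -> continuous g ->
  (forall x, f x <= g x) -> mean f <= mean g.
Proof.
move=> cf cg fg; rewrite -subr_ge0 -mulN1r -meanZ// addrC -meanD//; last exact: contZ.
set h := (fun x => _); have ch : continuous h by apply: contD => //; exact: contZ.
apply/ler_addgt0Pl => e e0; have [s s0 /(_ x0)] := meanP ch e0.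
suff : 0 <= avg s h x0 by rewrite ler_distl => ? /andP[_ ?]; lra.
by rewrite /avg mulr_ge0 ?invr_ge0// sumr_ge0// => t _; rewrite /h mulN1r addrC subr_ge0.
Qed.

Lemma mean_norm (f : L -> R) : continuous f -> `|mean f| <= mean (fun x => `|f x|).
Proof.
move=> cf; have cn := cont_norm cf; rewrite ler_norml; apply/andP; split; last first.
  by apply: ler_mean => // x; exact: ler_norm.
rewrite lerNl -mulN1r -meanZ//; apply: ler_mean => //; first exact: contZ.
by move=> x; rewrite mulN1r -normrN ler_norm.
Qed.

Lemma mean_bound (f : L -> R) (c : R) : continuous f -> (forall x, `|f x| <= c) -> `|mean f| <= c.
Proof.
move=> cf fc; apply: (le_trans (mean_norm cf)); rewrite -[leRHS]mean_cst.
by apply: ler_mean => //; [exact: cont_norm|exact: cst_continuous].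
Qed.

Lemma meanB (f g : L -> R) : continuous f -> continuous g ->
  mean (fun x => f x - g x) = mean f - mean g.
Proof.
move=> cf cg; rewrite -mulN1r -meanZ// -meanD//; last exact: contZ.
by congr mean; apply/funext => x; rewrite mulN1r.
Qed.

Lemma mean_sum (I : Type) (r : seq I) (f : I -> L -> R) :
  (forall i, continuous (f i)) ->
  mean (fun x => \sum_(i <- r) f i x) = \sum_(i <- r) mean (f i).
Proof.
move=> cf; elim: r => [|i r IH].
  by rewrite big_nil; under eq_fun do rewrite big_nil; exact: mean_cst.
rewrite big_cons -IH; under eq_fun do rewrite big_cons.
by rewrite meanD//; exact: cont_sum.
Qed.

Lemma mean_gt0 (f : L -> R) y : continuous f -> (forall x, 0 <= f x) -> 0 < f y -> 0 < mean f.
Proof.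
move=> cf f0 fy; pose U := f @^-1` [set z | f y / 2 < z].
have oU : nbhs y U.
  by apply: (cvgr_gt _ (cf y)); lra.
have [t tP] := orbit_cover oU.
have ff g := @cont_act g _ cf; have cs (r : seq G) := @cont_sum _ _ _ r _ ff.
have sumE (r : seq G) : mean (fun x => \sum_(g <- r) f (act g x)) = (size r)%:R * mean f.
  rewrite mean_sum//; under eq_bigr do rewrite mean_act//.
  by rewrite big_const_seq count_predT iter_addr_0 mulr_natl.
have : f y / 2 <= (size t)%:R * mean f.
  rewrite -sumE -[leLHS]mean_cst; apply: ler_mean => //; first exact: cst_continuous.
  move=> x; have [g gt gx] := tP x.
  rewrite (perm_big _ (perm_to_rem gt)) big_cons/= ler_wpDr ?sumr_ge0//.
  exact: ltW.
have := ler0n R (size t); nra.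
Qed.

Lemma mean_dist (f g : L -> R) (e : R) : continuous f -> continuous g ->
  (forall x, `|f x - g x| <= e) -> `|mean f - mean g| <= e.
Proof.
by move=> cf cg fg; rewrite -meanB//; apply: mean_bound => //; exact: contB.
Qed.

Lemma mean_simul (I : eqType) (r : seq I) (h : I -> L -> R) (e : R) :
  (forall i, continuous (h i)) -> 0 < e ->
  exists2 s, (0 < size s)%N &
    forall i, i \in r -> forall x, `|avg s (h i) x - mean (h i)| <= e.
Proof.
move=> ch e0; elim: r => [|i r [s s0 sP]]; first by exists [:: 0].
have [t t0 tP] := meanP (ch i) e0.
exists [seq g + g' | g <- t, g' <- s] => [|j]; first by rewrite size_allpairs muln_gt0 t0.
rewrite inE => /predU1P[->|jr] x; rewrite -avg_avg.
  exact: avg_dist.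
by rewrite avg_avgC; apply: avg_dist => //; exact: sP.
Qed.

(** One average approximates [mean (F^~ y)] for all [y] at once. *)
Lemma mean_fubini (F : L -> L -> R) :
  (forall x, continuous (F x)) -> (forall y, continuous (F^~ y)) ->
  (forall y (e : R), 0 < e -> \forall z \near y, forall x, `|F x y - F x z| <= e) ->
  continuous (fun x => mean (F x)) -> continuous (fun y => mean (F^~ y)) ->
  mean (fun x => mean (F x)) = mean (fun y => mean (F^~ y)).
Proof.
move=> cF1 cF2 eF cm1 cm2; apply/eqP; rewrite -subr_eq0 -normr_le0.
apply/ler_addgt0Pl => e e0; rewrite addr0.
have e4 : 0 < e / 4 by rewrite divr_gt0.
have [ys ysP] := compact_nbhs_cover cptL (fun y => eF y _ e4).
pose h (o : option L) : L -> R := if o is Some y then F^~ y else fun x => mean (F x).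
have ch o : continuous (h o) by case: o => [y|]; rewrite /h; [exact: cF2|exact: cm1].
have [s s0 sP] := @mean_simul _ (None :: map Some ys) h _ ch e4.
have sF y : `|avg s (F^~ y) x0 - mean (F^~ y)| <= e / 4 + e / 4 + e / 4.
  have [z zys zy] := ysP y.
  have H1 := sP (Some z) (mem_behead (map_f Some zys : _ \in behead (_ :: _))) x0.
  have H2 : `|mean (F^~ z) - mean (F^~ y)| <= e / 4 by exact: mean_dist.
  have H3 : `|avg s (F^~ y) x0 - avg s (F^~ z) x0| <= e / 4.
    rewrite -mulN1r -avgZ -avgD -[X in `|X|]subr0; apply: avg_dist => // x.
    by rewrite subr0 mulN1r distrC.
  rewrite /h/= in H1; move: H1 H2 H3; rewrite !ler_distl.
  by move=> /andP[? ?] /andP[? ?] /andP[? ?]; apply/andP; split; lra.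
have ca : continuous (fun y => avg s (F^~ y) x0) by apply: contZ; exact: cont_sum.
have := mean_dist ca cm2 sF.
rewrite [X in mean X - _](_ : _ = fun y => avg s (F^~ y) x0)// /avg.
rewrite meanZ; last exact: cont_sum.
rewrite mean_sum//.
have := sP None (mem_head _ _) x0; rewrite /h /avg/=.
rewrite !ler_distl => /andP[? ?] /andP[? ?].
apply/andP; split; lra.
Qed.

Definition ip (f g : L -> R) := mean (fun x => f x * g x).

Lemma ipC (f g : L -> R) : ip f g = ip g f.
Proof. by congr mean; apply/funext => x; rewrite mulrC. Qed.

Lemma ipDl (f g h : L -> R) : continuous f -> continuous g -> continuous h ->
  ip (fun x => f x + g x) h = ip f h + ip g h.
Proof.
move=> cf cg ch; rewrite -meanD; [|exact: contM|exact: contM].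
by congr mean; apply/funext => x; rewrite mulrDl.
Qed.

Lemma ipZl (c : R) (f h : L -> R) : continuous f -> continuous h ->
  ip (fun x => c * f x) h = c * ip f h.
Proof.
move=> cf ch; rewrite -meanZ; last exact: contM.
by congr mean; apply/funext => x; rewrite mulrA.
Qed.

Lemma ip_ge0 f : continuous f -> 0 <= ip f f.
Proof.
move=> cf; rewrite -[leLHS](mean_cst 0); apply: ler_mean.
- exact: cst_continuous.
- exact: contM.
- by move=> x; rewrite -expr2 sqr_ge0.
Qed.

Lemma ip_eq0 (f : L -> R) : continuous f -> ip f f = 0 -> forall x, f x = 0.
Proof.
move=> cf f0 x; apply/eqP/negP => /negP fx.
have : 0 < ip f f; last by rewrite f0 ltxx.
apply: (@mean_gt0 _ x); first exact: contM.
- by move=> y; rewrite -expr2 sqr_ge0.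
- by rewrite -expr2 exprn_even_gt0.
Qed.

Lemma ip_suml (I : Type) (r : seq I) (c : I -> R) (f : I -> L -> R) (h : L -> R) :
  (forall i, continuous (f i)) -> continuous h ->
  ip (fun x => \sum_(i <- r) c i * f i x) h = \sum_(i <- r) c i * ip (f i) h.
Proof.
move=> cf ch; rewrite /ip; under eq_fun do rewrite mulr_suml.
rewrite mean_sum; last by move=> i; apply: contM => //; exact: contZ.
by apply: eq_bigr => i _; exact: ipZl.
Qed.

Lemma ip_comb (c : R) f h : continuous f -> continuous h ->
  ip (fun x => c * f x + h x) (fun x => c * f x + h x) =
  c ^+ 2 * ip f f + 2 * c * ip f h + ip h h.
Proof.
move=> cf ch; have cz := @contZ _ _ c _ cf; have cq := contD cz ch.
rewrite (ipDl cz ch cq) ipZl// (ipC f) (ipC h) (ipDl cz ch cf) (ipDl cz ch ch).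
by rewrite !ipZl// (ipC h f); ring.
Qed.

(** A substitute for the Cauchy-Schwarz inequality, with a free parameter. *)
Lemma mean_norm_ip (f : L -> R) (d : R) : continuous f -> 0 < d ->
  mean (fun x => `|f x|) <= (d + ip f f / d) / 2.
Proof.
move=> cf d0; have -> : (d + ip f f / d) / 2 = mean (fun x => d / 2 + (2 * d)^-1 * (f x * f x)).
  rewrite meanD; [|exact: cst_continuous|by apply: contZ; exact: contM].
  rewrite mean_cst meanZ; last exact: contM.
  rewrite -/(ip f f); field; lra.
apply: ler_mean; first exact: cont_norm.
  by apply: contD; [exact: cst_continuous|by apply: contZ; exact: contM].
move=> x; rewrite -subr_ge0.
have -> : d / 2 + (2 * d)^-1 * (f x * f x) - `|f x| = (2 * d)^-1 * (d - `|f x|) ^+ 2.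
  by rewrite -expr2 -real_normK ?num_real//; field; lra.
by rewrite mulr_ge0 ?sqr_ge0// invr_ge0 mulr_ge0// ltW.
Qed.

(** * Compact operators that commute with the action *)

Section Operator.
Variable k : L -> L -> R.
Hypothesis kC : forall x y, k x y = k y x.
Hypothesis k_tri : forall x y z, k x z <= k x y + k y z.
Hypothesis k_near : forall x (e : R), 0 < e -> \forall y \near x, k x y < e.
Hypothesis k_act : forall g x y, k (act g x) (act g y) = k x y.

Lemma k_ge0 x y : 0 <= k x y.
Proof.
have k0 z : 0 <= k z z by have := k_tri z z z; lra.
by have := k_tri x y x; have := k0 x; rewrite (kC y x); lra.
Qed.

Lemma k_lip x y z : `|k x y - k x z| <= k y z.
Proof.
have := k_tri x y z; have := k_tri x z y; rewrite (kC z y) ler_norml => ? ?.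
by apply/andP; split; lra.
Qed.

Lemma k_cont x : continuous (k x).
Proof.
move=> y; apply/cvgrPdist_lt => e e0; near=> z.
by apply: le_lt_trans (k_lip _ _ _) _; near: z; exact: k_near.
Unshelve. all: by end_near. Qed.

Lemma k_bound : exists2 C, 0 < C & forall x y, k x y <= C.
Proof.
have [M M0 kM] := compact_bound cptL (k_cont (x := x0)).
exists (M + M); first by rewrite addr_gt0.
move=> x y; apply: (le_trans (k_tri x x0 y)); rewrite (kC x).
by apply: lerD; exact: le_trans (ler_norm _) (kM _).
Qed.

(** An integral operator; for the kernels below it is symmetric, compact, and
    commutes with the action. *)
Definition op (f : L -> R) (x : L) := mean (fun y => k x y * f y).

Lemma op_cont_aux f x : continuous f -> continuous (fun y => k x y * f y).
Proof. by move=> cf; apply: contM => //; exact: k_cont. Qed.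

Lemma op_lip f x x' : continuous f ->
  `|op f x - op f x'| <= k x x' * mean (fun y => `|f y|).
Proof.
move=> cf; rewrite -meanB; [|exact: op_cont_aux|exact: op_cont_aux].
have cB : continuous (fun y => k x y * f y - k x' y * f y).
  by apply: contB; exact: op_cont_aux.
apply: (le_trans (mean_norm cB)); rewrite -meanZ; last exact: cont_norm.
apply: ler_mean; [exact: cont_norm|by apply: contZ; exact: cont_norm|].
move=> y; rewrite -mulrBl normrM ler_wpM2r//.
by rewrite (kC x) (kC x'); exact: k_lip.
Qed.

Lemma op_cont f : continuous f -> continuous (op f).
Proof.
move=> cf x; pose m := mean (fun y => `|f y|).
have m0 : 0 <= m.
  rewrite -[leLHS](mean_cst 0); apply: ler_mean; first exact: cst_continuous.
    exact: cont_norm.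
  by move=> y.
have m1 : 0 < m + 1 by rewrite ltr_wpDl.
apply/cvgrPdist_lt => e e0; have em : 0 < e / (m + 1) by rewrite divr_gt0.
near=> z; apply: le_lt_trans (op_lip _ _ cf) _; rewrite -/m.
apply: (@le_lt_trans _ _ (e / (m + 1) * m)).
  by rewrite ler_wpM2r// ltW//; near: z; exact: k_near.
by rewrite mulrAC ltr_pdivrMr// mulrDr mulr1 ltrDl.
Unshelve. all: by end_near. Qed.

Lemma op_bound f C x : continuous f -> (forall x y, k x y <= C) ->
  `|op f x| <= C * mean (fun y => `|f y|).
Proof.
move=> cf kC'; have cx := op_cont_aux (x := x) cf.
apply: (le_trans (mean_norm cx)); rewrite -meanZ; last exact: cont_norm.
apply: ler_mean; [exact: cont_norm|by apply: contZ; exact: cont_norm|].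
by move=> y; rewrite normrM ler_wpM2r// ger0_norm// k_ge0.
Qed.

Lemma opD f g : continuous f -> continuous g ->
  op (fun x => f x + g x) = fun x => op f x + op g x.
Proof.
move=> cf cg; apply/funext => x; rewrite -meanD; [|exact: op_cont_aux|exact: op_cont_aux].
by congr mean; apply/funext => y; rewrite mulrDr.
Qed.

Lemma opZ (c : R) f : continuous f -> op (fun x => c * f x) = fun x => c * op f x.
Proof.
move=> cf; apply/funext => x; rewrite -meanZ; last exact: op_cont_aux.
by congr mean; apply/funext => y; rewrite mulrCA.
Qed.

Lemma op_act (h : G) f x : continuous f ->
  op f (act h x) = op (fun y => f (act h y)) x.
Proof.
move=> cf; rewrite /op -(mean_act h); last exact: op_cont_aux.
by congr mean; apply/funext => y; rewrite k_act.
Qed.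

Lemma op_sym f g : continuous f -> continuous g -> ip (op f) g = ip f (op g).
Proof.
move=> cf cg; have [C C0 kbd] := k_bound.
have [A A0 fA] := compact_bound cptL cf; have [B B0 gB] := compact_bound cptL cg.
have E1 : (fun x => op f x * g x) = fun x => mean (fun y => k x y * f y * g x).
  apply/funext => x; rewrite mulrC -meanZ; last exact: op_cont_aux.
  by congr mean; apply/funext => y; rewrite mulrC.
have E2 : (fun y => f y * op g y) = fun y => mean (fun x => k x y * f y * g x).
  apply/funext => y; rewrite -meanZ; last exact: op_cont_aux.
  by congr mean; apply/funext => x; rewrite mulrCA mulrA kC.
rewrite /ip E1 E2; apply: mean_fubini.
- move=> x; apply: contM; [exact: op_cont_aux|exact: cst_continuous].
- move=> y; apply: contM => //; apply: contM; last exact: cst_continuous.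
  by under eq_fun do rewrite kC; exact: k_cont.
- move=> y e e0; near=> z => x.
  have kz : k y z < e / (2 * (A * B)).
    by near: z; apply: k_near; rewrite divr_gt0// !mulr_gt0.
  have fz : `|f y - f z| < e / (2 * (C * B)).
    near: z; have /cvgrPdist_lt := cf y; apply; by rewrite divr_gt0// !mulr_gt0.
  rewrite -mulrBl normrM.
  have -> : k x y * f y - k x z * f z = (k x y - k x z) * f y + k x z * (f y - f z) by ring.
  have H1 : `|(k x y - k x z) * f y| <= e / (2 * (A * B)) * A.
    by rewrite normrM ler_pM// (le_trans (k_lip _ _ _))// ltW.
  have H2 : `|k x z * (f y - f z)| <= C * (e / (2 * (C * B))).
    by rewrite normrM ler_pM ?normr_ge0 ?(ltW fz)// ger0_norm ?k_ge0 ?kbd.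
  apply: (@le_trans _ _ ((e / (2 * (A * B)) * A + C * (e / (2 * (C * B)))) * B)).
    by rewrite ler_pM// (le_trans (ler_normD _ _))// lerD.
  by rewrite le_eqVlt; apply/orP; left; apply/eqP; field; rewrite !gt_eqF.
- by rewrite -E1; apply: contM => //; exact: op_cont.
- by rewrite -E2; apply: contM => //; exact: op_cont.
Unshelve. all: by end_near. Qed.

Lemma nbhs_prod_finite (g : L -> R) (e : R) (s : seq L) : 0 < e ->
  nbhs (g : prod_topology (fun _ : L => R)) [set h | forall x, x \in s -> `|g x - h x| < e].
Proof.
move=> e0; elim: s => [|y s IH]; first by
  apply: (@filterS _ (nbhs (g : prod_topology (fun _ : L => R))) _ setT) => //; exact: filterT.
have : nbhs (g : prod_topology (fun _ : L => R)) [set h | `|g y - h y| < e].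
  apply: (@proj_continuous _ (fun _ : L => R) y g [set r | `|g y - r| < e]).
  exact: (@nbhsx_ballx R R (g y) e e0).
have FF := @nbhs_filter (prod_topology (fun _ : L => R)) g.
move=> H; have := @filterI _ _ FF _ _ H IH.
apply: (@filterS _ _ FF) => h [hy hs] x.
by rewrite inE => /predU1P[->//|]; exact: hs.
Unshelve. all: by end_near. Qed.

(** Compactness of the operator, in the form of the Arzela-Ascoli theorem: a
    pointwise cluster point exists by the Tychonoff theorem and has the common
    modulus of continuity [k], which makes the convergence uniform along a
    subsequence. *)
Lemma lipschitz_cluster (u : nat -> L -> R) (B : R) :
  (forall n x, `|u n x| <= B) -> (forall n x y, `|u n x - u n y| <= k x y) ->
  exists g : L -> R, continuous g /\
    forall (e : R) N, 0 < e -> exists2 n, (N <= n)%N & forall x, `|u n x - g x| <= e.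
Proof.
move=> uB ulip.
have cK := @tychonoff L (fun=> R) (fun=> `[- B, B]%classic) (fun=> @segment_compact R _ _).
pose F : set_system (prod_topology (fun _ : L => R)) := u @ \oo.
have FF : ProperFilter F by exact: fmap_proper_filter.
have [|g [_ gF]] := cK F FF.
  by exists 0%N => // n _ x; rewrite /= in_itv/= -ler_norml.
have key (s : seq L) (e : R) N : 0 < e -> exists2 n, (N <= n)%N &
    forall x, x \in s -> `|g x - u n x| < e.
  move=> e0; have [_ [[n Nn <-] nP]] : [set u n | n in [set n | (N <= n)%N]] `&`
      [set h | forall x, x \in s -> `|g x - h x| < e] !=set0.
    apply: gF; last exact: nbhs_prod_finite.
    by exists N => // n /= Nn; exists n.
  by exists n.
have glip x y : `|g x - g y| <= k x y.
  apply/ler_addgt0Pl => e e0; have e2 : 0 < e / 2 by rewrite divr_gt0.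
  have [n _ nP] := key [:: x; y] _ 0%N e2.
  have := nP x; rewrite inE eqxx => /(_ isT); have := nP y; rewrite !inE eqxx orbT => /(_ isT).
  have := ulip n x y; rewrite !ler_norml !ltr_norml.
  by move=> /andP[? ?] /andP[? ?] /andP[? ?]; apply/andP; split; lra.
exists g; split.
  move=> x; apply/cvgrPdist_lt => e e0; near=> z.
  by apply: le_lt_trans (glip _ _) _; near: z; exact: k_near.
move=> e N e0; have e4 : 0 < e / 4 by rewrite divr_gt0.
have [s sP] := compact_nbhs_cover cptL (fun x => k_near x e4).
have [n Nn nP] := key s _ N e4; exists n => // y.
have [x xs /= xy] := sP y; have := nP x xs; have := ulip n x y; have := glip x y.
rewrite !ler_norml !ltr_norml.
by move=> /andP[? ?] /andP[? ?] /andP[? ?]; apply/andP; split; lra.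
Unshelve. all: by end_near. Qed.

Section TopEigenfunction.
Variable W : (L -> R) -> Prop.
Hypothesis W_cont : forall f, W f -> continuous f.
Hypothesis W_lin : forall (c : R) f g, W f -> W g -> W (fun x => c * f x + g x).
Hypothesis W_op : forall f, W f -> W (op f).
Hypothesis W_closed : forall f, continuous f ->
  (forall e : R, 0 < e -> exists2 h, W h & forall x, `|h x - f x| <= e) -> W f.

Lemma W_Z (c : R) f : W f -> W (fun x => c * f x).
Proof.
move=> Wf; have W0 : W (fun x => 0).
  by have := W_lin (-1) Wf Wf; under eq_fun do rewrite mulN1r addNr.
by have := W_lin c Wf W0; under eq_fun do rewrite addr0.
Qed.

Lemma mean_norm_le1 f : continuous f -> ip f f <= 1 -> mean (fun x => `|f x|) <= 1.
Proof.
move=> cf f1; have := mean_norm_ip cf (ltr01 : 0 < 1 :> R).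
by rewrite divr1; lra.
Qed.

(** The supremum [s] of [ip (op f) (op f)] over the unit ball of [W] is an
    eigenvalue of the square of the operator [T]: for a maximising sequence,
    [T (T f) - s f] tends to zero in mean square, while [T f] clusters
    uniformly at some [g], which then satisfies [T (T g) = s g]. *)
Lemma top_eigenfunction h x : W h -> op h x != 0 ->
  exists s g, [/\ 0 < s, W g, exists y, g y != 0 & op (op g) = fun y => s * g y].
Proof.
move=> Wh hx; have [C C0 kbd] := k_bound.
pose S := [set ip (op f) (op f) | f in [set f | W f /\ ip f f <= 1]].
have opC f : W f -> continuous (op f) by move=> Wf; apply: W_cont; exact: W_op.
have ub f y : W f -> ip f f <= 1 -> `|op f y| <= C.
  move=> Wf f1; apply: (le_trans (op_bound _ (W_cont Wf) kbd)).
  by rewrite ger_pMr// mean_norm_le1//; exact: W_cont.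
have Sub : ubound S (C * C).
  move=> _ [f [Wf f1] <-]; apply: le_trans (ler_norm _) _.
  apply: mean_bound => [|y]; first by apply: contM; exact: opC.
  by rewrite normrM ler_pM// ub.
have hh : 0 < ip h h.
  rewrite lt_neqAle ip_ge0 ?andbT; last exact: W_cont.
  apply/negP => /eqP/esym/(ip_eq0 (W_cont Wh)) h0; move/eqP: hx; apply.
  rewrite /op; under eq_fun do rewrite h0 mulr0; exact: mean_cst.
have unit f : W f -> 0 < ip f f -> exists2 c : R, c ^+ 2 * ip f f = 1 & W (fun y => c * f y).
  move=> Wf f0; exists (Num.sqrt (ip f f))^-1; last exact: W_Z.
  by rewrite exprVn sqr_sqrtr ?ltW// mulVf ?gt_eqF.
have ipZZ (c : R) f : continuous f -> ip (fun y => c * f y) (fun y => c * f y) = c ^+ 2 * ip f f.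
  move=> cf; rewrite ipZl//; last exact: contZ.
  by rewrite ipC ipZl// mulrA -expr2.
have Tbig f : W f -> 0 < ip f f -> S (ip (op f) (op f) / ip f f).
  move=> Wf f0; have [c c1 Wc] := unit f Wf f0; exists (fun y => c * f y).
    by split=> //; rewrite ipZZ ?c1//; exact: W_cont.
  rewrite opZ ?ipZZ; [|exact: opC|exact: W_cont].
  by apply: (canRL (mulfK (lt0r_neq0 f0))); rewrite mulrAC c1 mul1r.
have S0 : has_sup S by split; [exists (ip (op h) (op h) / ip h h); exact: Tbig|exists (C * C)].
pose s := sup S.
have s_ge f : W f -> ip (op f) (op f) <= s * ip f f.
  move=> Wf; have := ip_ge0 (W_cont Wf); rewrite le_eqVlt => /predU1P[f0|f0].
    rewrite -f0 mulr0; have -> : op f = fun=> 0.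
      apply/funext => y; rewrite /op; under eq_fun do rewrite (ip_eq0 (W_cont Wf) (esym f0)) mulr0.
      exact: mean_cst.
    by rewrite /ip; under eq_fun do rewrite mulr0; rewrite mean_cst.
  by rewrite -ler_pdivrMr//; apply: sup_upper_bound => //; exact: Tbig.
have s0 : 0 < s.
  apply: (@lt_le_trans _ _ (ip (op h) (op h) / ip h h)); last by apply: sup_upper_bound => //; exact: Tbig.
  rewrite divr_gt0// lt_neqAle ip_ge0 ?andbT; last exact: opC.
  by apply/negP => /eqP/esym/(ip_eq0 (opC _ Wh))/(_ x)/eqP; rewrite (negbTE hx).
have fnP n : exists f, [/\ W f, ip f f <= 1 & s - n.+1%:R^-1 < ip (op f) (op f)].
  have n0 : 0 < n.+1%:R^-1 :> R by rewrite invr_gt0.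
  have [_ [f [Wf f1] <-] fs] := sup_adherent n0 S0.
  by exists f.
pose f n := projT1 (cid (fnP n)).
have fW n : W (f n) by case: (projT2 (cid (fnP n))).
have f1 n : ip (f n) (f n) <= 1 by case: (projT2 (cid (fnP n))).
have fs n : s - n.+1%:R^-1 < ip (op (f n)) (op (f n)) by case: (projT2 (cid (fnP n))).
have [|n y z|g [cg gP]] := @lipschitz_cluster (fun n => op (f n)) C.
- by move=> n y; exact: ub.
- rewrite (le_trans (op_lip _ _ (W_cont (fW n))))// -[leRHS]mulr1.
  by rewrite ler_wpM2l ?k_ge0// mean_norm_le1//; exact: W_cont.
have WT n : W (op (f n)) by exact: W_op.
have Wg : W g.
  apply: W_closed => // e e0; have [n _ nP] := gP e 0%N e0.
  by exists (op (f n)).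
pose r n := fun y => (- s) * f n y + op (op (f n)) y.
have cr n : continuous (r n).
  by apply: contD; [apply: contZ; exact: W_cont|apply: opC; exact: W_op].
(* With [a] for [ip (op (f n)) (op (f n))], the square expands to at most [s
   ^+ 2 - 2 * s * a + s * a], and [a] exceeds [s - n.+1%:R^-1]. *)
have rr n : ip (r n) (r n) <= s / n.+1%:R.
  have cf := W_cont (fW n); have cT := opC _ (fW n); have cTT := opC _ (WT n).
  have cZ := @contZ _ _ (- s) _ cf.
  have := s_ge _ (WT n); have := fs n.
  rewrite /r ip_comb// (ipC (f n)) (op_sym cT cf); set a := ip (op (f n)) _.
  have := f1 n; set b := ip (f n) (f n); set c := ip (op _) (op _) => b1 a1 ca.
  have := ler_wpM2l (ltW (mulr_gt0 s0 s0)) b1; rewrite mulr1.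
  have : s * (s - n.+1%:R^-1) <= s * a by rewrite ler_pM2l// ltW.
  have -> : (- s) ^+ 2 * b + 2 * - s * a + c = s * s * b - 2 * (s * a) + c by ring.
  move: ca; move: (n.+1%:R^-1) => i; rewrite mulrBr.
  by move: (s * a) (s * i) (s * s * b) (s * s) => *; lra.
have Trn n : op (r n) = fun y => (- s) * op (f n) y + op (op (op (f n))) y.
  by rewrite opD ?opZ//; [exact: W_cont|apply: contZ; exact: W_cont|apply: opC; exact: W_op].
have arch (d : R) : 0 < d -> exists N, forall n, (N <= n)%N -> n.+1%:R^-1 <= d.
  move=> d0; exists (Num.bound d^-1) => n Nn; rewrite -[leRHS]invrK.
  rewrite lef_pV2 ?posrE ?invr_gt0//.
  apply: le_trans (ltW (archi_boundP _)) _; first by rewrite invr_ge0 ltW.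
  by rewrite ler_nat leqW.
exists s, g; split=> //.
  apply: contrapT => /forallNP g0.
  have gz y : g y = 0 by apply/eqP; apply: contrapT => /negP; exact: g0.
  pose e := Num.min 1 (s / 4).
  have e0 : 0 < e by rewrite lt_min ltr01 divr_gt0.
  have [N NP] := arch (s / 2) (divr_gt0 s0 (ltr0Sn R 1)).
  have [n Nn nP] := gP e N e0; have := fs n; have := NP n Nn.
  suff : ip (op (f n)) (op (f n)) <= s / 4 by move: (n.+1%:R^-1) => i *; lra.
  apply: (@le_trans _ _ (e * e)); last first.
    apply: (@le_trans _ _ (1 * (s / 4))); last by rewrite mul1r.
    by apply: ler_pM; rewrite ?(ltW e0)// ge_min lexx ?orbT.
  apply: le_trans (ler_norm _) _; apply: mean_bound; first by apply: contM; exact: opC.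
  by move=> y; have := nP y; rewrite gz subr0 normrM => ue; exact: ler_pM.
(* The difference [op (op g) - s g] is compared with [op r] for a late member
   of the sequence; [d] bounds the distance from [g] and [D] the mean square
   of [r], and their contributions [C * (C * d)], [C * D] and [s * d] add up
   to [e]. *)
apply/funext => y; apply/eqP; rewrite -subr_eq0 -normr_le0.
apply/ler_addgt0Pl => e e0; rewrite addr0.
pose d := e / (2 * (C * C + s)); pose D := e / (2 * C).
have d0 : 0 < d by rewrite divr_gt0// mulr_gt0// addr_gt0// mulr_gt0.
have D0 : 0 < D by rewrite divr_gt0// mulr_gt0.
have [N NP] := arch (D * D / s) (divr_gt0 (mulr_gt0 D0 D0) s0).
have [n Nn nP] := gP d N d0; have nN := NP n Nn.
have cu := opC _ (fW n); have cgu : continuous (fun z => (-1) * op (f n) z + g z).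
  by apply: contD => //; exact: contZ.
have H1 : `|op (op (fun z => (-1) * op (f n) z + g z)) y| <= C * (C * d).
  apply: le_trans (op_bound _ (op_cont cgu) kbd) _; rewrite ler_pM2l//.
  apply: le_trans (ler_norm _) _; apply: mean_bound; first by apply: cont_norm; exact: op_cont.
  move=> z; rewrite normr_id; apply: le_trans (op_bound _ cgu kbd) _; rewrite ler_pM2l//.
  apply: le_trans (ler_norm _) _; apply: mean_bound; first exact: cont_norm.
  by move=> w; rewrite normr_id mulN1r addrC distrC.
have H2 : `|op (r n) y| <= C * D.
  apply: le_trans (op_bound _ (cr n) kbd) _; rewrite ler_pM2l//.
  apply: le_trans (mean_norm_ip (cr n) D0) _.
  have : ip (r n) (r n) / D <= D; last by lra.
  rewrite ler_pdivrMr//; apply: le_trans (rr n) _.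
  by move: nN; rewrite ler_pdivlMr// mulrC.
have H3 : `|s * (g y - op (f n) y)| <= s * d.
  by rewrite normrM (gtr0_norm s0) ler_pM2l// distrC.
have E : C * (C * d) + C * D + s * d = e.
  by rewrite /d /D; field; rewrite !gt_eqF// addr_gt0// mulr_gt0.
move: H1 H2; rewrite Trn opD//; last by apply: contZ.
rewrite opZ// opD; [|by apply: contZ; exact: op_cont|exact: op_cont].
rewrite opZ; last exact: op_cont.
move: H3; rewrite -E !ler_norml => /andP[? ?] /andP[? ?] /andP[? ?].
by apply/andP; split; lra.
Qed.

End TopEigenfunction.

Section Eigenpair.
Variable W : (L -> R) -> Prop.
Hypothesis W_cont : forall f, W f -> continuous f.
Hypothesis W_lin : forall (c : R) f g, W f -> W g -> W (fun x => c * f x + g x).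
Hypothesis W_op : forall f, W f -> W (op f).
Hypothesis W_closed : forall f, continuous f ->
  (forall e : R, 0 < e -> exists2 h, W h & forall x, `|h x - f x| <= e) -> W f.
Hypothesis W_act : forall h f, W f -> W (fun x => f (act h x)).

Definition orthonormal n (e : 'I_n -> L -> R) :=
  forall i j, ip (e i) (e j) = (i == j)%:R.

Lemma ip_sum_orthonormal n (e : 'I_n -> L -> R) (c : 'I_n -> R) j :
  (forall i, continuous (e i)) -> orthonormal e ->
  ip (fun x => \sum_i c i * e i x) (e j) = c j.
Proof.
move=> ce oe; rewrite ip_suml// (bigD1 j)//= oe eqxx mulr1 big1 ?addr0//.
by move=> i ij; rewrite oe (negbTE ij) mulr0.
Qed.

Lemma bessel n (e : 'I_n -> L -> R) f :
  (forall i, continuous (e i)) -> orthonormal e -> continuous f ->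
  \sum_i ip f (e i) ^+ 2 <= ip f f.
Proof.
move=> ce oe cf; pose q := fun x => \sum_i ip f (e i) * e i x.
have cq : continuous q by apply: cont_sum => i; exact: contZ.
have qf : ip q f = \sum_i ip f (e i) ^+ 2.
  rewrite ip_suml//; apply: eq_bigr => i _; by rewrite (ipC (e i)) expr2.
have qq : ip q q = \sum_i ip f (e i) ^+ 2.
  rewrite [LHS]ip_suml//; apply: eq_bigr => i _.
  by rewrite (ipC (e i)) ip_sum_orthonormal// expr2.
have := ip_ge0 (contD (@contZ _ _ (-1) _ cq) cf).
by rewrite ip_comb// qf qq; lra.
Qed.

(** Eigenspaces of the square of the operator are finite-dimensional:
    integrate Bessel's inequality for the functions [k x]. *)
Lemma eigenspace_bound n (e : 'I_n -> L -> R) (s C : R) :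
  (forall i, continuous (e i)) -> orthonormal e -> (forall x y, k x y <= C) ->
  (forall i, op (op (e i)) = fun x => s * e i x) -> n%:R * s <= C * C.
Proof.
move=> ce oe kbd eig; have cT i := op_cont (ce i).
have -> : n%:R * s = mean (fun x => \sum_i op (e i) x * op (e i) x).
  rewrite (@mean_sum _ _ (fun i x => op (e i) x * op (e i) x)) => [|i]; last exact: contM.
  rewrite -[n in LHS]card_ord -sum1_card natr_sum mulr_suml; apply: eq_bigr => i _.
  rewrite mul1r -/(ip (op (e i)) (op (e i))) -op_sym// eig ipZl// oe eqxx mulr1.
  by [].
rewrite -[leRHS]mean_cst; apply: ler_mean.
- by apply: cont_sum => i; exact: contM.
- exact: cst_continuous.
move=> x; apply: (@le_trans _ _ (ip (k x) (k x))).
  have := bessel ce oe (k_cont (x := x)); apply: le_trans.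
  by apply: ler_sum => i _; rewrite expr2.
apply: le_trans (ler_norm _) _; apply: mean_bound; first by apply: contM; exact: k_cont.
by move=> y; rewrite normrM ler_pM// ger0_norm ?k_ge0.
Qed.

(** The eigenspace found by maximisation is finite-dimensional and invariant
    under the action. The group acts on it by commuting matrices, which have a
    common eigenvector over the complex numbers; [a] and [b] are its real and
    imaginary parts, and [p + i q] is the eigenvalue. *)
Lemma eigenpair_exists h x : W h -> op h x != 0 ->
  exists a b, [/\ W a, W b, exists y, (a y != 0) || (b y != 0) &
    exists p q : G -> R, forall g y,
      a (act g y) = p g * a y - q g * b y /\ b (act g y) = q g * a y + p g * b y].
Proof.
move=> Wh hx; have [s [g0 [s0 Wg0 [y0 gy0] eg0]]] := top_eigenfunction W_cont W_lin W_op W_closed Wh hx.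
have [C C0 kbd] := k_bound.
pose V f := W f /\ op (op f) = fun y => s * f y.
have VC f : V f -> continuous f by case=> Wf _; exact: W_cont.
have VL (c : R) f g : V f -> V g -> V (fun x => c * f x + g x).
  move=> [Wf ef] [Wg eg]; have cf := W_cont Wf; have cg := W_cont Wg; split; first exact: W_lin.
  rewrite opD//; last exact: contZ.
  rewrite opZ// opD; [|by apply: contZ; exact: op_cont|exact: op_cont].
  rewrite opZ; last exact: op_cont.
  by rewrite ef eg; apply/funext => y; ring.
have V0 f : V f -> V (fun=> 0).
  by move=> Vf; have := VL (-1) f f Vf Vf; under eq_fun do rewrite mulN1r addNr.
have VZ (c : R) f : V f -> V (fun x => c * f x).
  by move=> Vf; have := VL c _ _ Vf (V0 _ Vf); under eq_fun do rewrite addr0.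
have Vg0 : V g0 by [].
have VS n (c : 'I_n -> R) (e : 'I_n -> L -> R) : (forall i, V (e i)) -> V (fun x => \sum_i c i * e i x).
  move=> Ve; elim: (index_enum _) => [|i r IH].
    by under eq_fun do rewrite big_nil; exact: V0 Vg0.
  by under eq_fun do rewrite big_cons; exact: VL.
have VA g f : V f -> V (fun x => f (act g x)).
  move=> [Wf ef]; have cf := W_cont Wf; split; first exact: W_act.
  have -> : op (fun x => f (act g x)) = fun x => op f (act g x).
    by apply/funext => z; rewrite op_act.
  by apply/funext => y; rewrite -op_act ?ef//; exact: op_cont.
pose P n := `[< exists e : 'I_n -> L -> R, (forall i, V (e i)) /\ orthonormal e >].
have P0 : exists n, P n.
  by exists 0%N; apply/asboolP; exists (fun=> g0); split => [[]//|[]//].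
have Pbound n : P n -> (n <= Num.bound (C * C / s))%N.
  move=> /asboolP[e [Ve oe]].
  have := eigenspace_bound (fun i => VC _ (Ve i)) oe kbd (fun i => (Ve i).2).
  rewrite -ler_pdivlMr// => H; rewrite -(ler_nat R); apply: (le_trans H); apply: ltW.
  by apply: archi_boundP; rewrite divr_ge0 ?mulr_ge0// ltW.
(* A maximal orthonormal family spans the eigenspace: a function outside the
   span could be orthogonalised and added to the family. *)
case: (ex_maxnP P0 Pbound) => n /asboolP[e [Ve oe]] nmax.
have ce i := VC _ (Ve i).
have span f : V f -> forall y, f y = \sum_i ip f (e i) * e i y.
  move=> Vf y; apply: contrapT => fy.
  pose q x := \sum_i ip f (e i) * e i x.
  pose r x := (-1) * q x + f x.
  have Vr : V r by apply: VL => //; exact: VS.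
  have cq : continuous q by apply: cont_sum => i; exact: contZ.
  have re i : ip r (e i) = 0.
    rewrite ipDl//; [|by apply: contZ|exact: VC].
    by rewrite ipZl// ip_sum_orthonormal// mulN1r addNr.
  have rr : 0 < ip r r.
    rewrite lt_neqAle ip_ge0 ?andbT; last exact: VC.
    apply/negP => /eqP/esym/(ip_eq0 (VC _ Vr))/(_ y); rewrite /r/q => H; apply: fy.
    by move/eqP: H; rewrite mulN1r addrC subr_eq0 => /eqP.
  pose c := (Num.sqrt (ip r r))^-1; pose r' x := c * r x.
  have cc : c * (c * ip r r) = 1.
    by rewrite mulrA -expr2 /c exprVn sqr_sqrtr ?ltW// mulVf ?gt_eqF.
  have : P n.+1; last by move=> /nmax; rewrite ltnn.
  apply/asboolP; exists (fun i => if unlift ord0 i is Some j then e j else r'); split.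
    by move=> i; case: unliftP => [j _|_]; [exact: Ve|exact: VZ].
  have rC := VC _ Vr; have r'C : continuous r' by exact: contZ.
  have r'e j : ip r' (e j) = 0 by rewrite ipZl// re mulr0.
  move=> i j; case: (unliftP ord0 i) => [i' ->|->]; case: (unliftP ord0 j) => [j' ->|->].
  - by rewrite oe (inj_eq lift_inj).
  - by rewrite ipC r'e.
  - by rewrite r'e.
  - by rewrite eqxx ipZl// ipC ipZl.
have n0 : (0 < n)%N.
  rewrite lt0n; apply/negP => /eqP n0; move: gy0; rewrite (span _ Vg0) big1 ?eqxx//.
  by move=> [i lin]; exfalso; move: lin; rewrite n0.
(* The matrices of the action in the basis [e]. *)
pose A g : 'M[R[i]]_n := \matrix_(i, j) (ip (fun x => e i (act g x)) (e j))%:C%C.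
have eA g i y : e i (act g y) = \sum_j ip (fun x => e i (act g x)) (e j) * e j y.
  by rewrite -(span (fun x => e i (act g x)))//; exact: VA.
have AD g g' : A (g + g') = A g *m A g'.
  apply/matrixP => i j; rewrite !mxE.
  have -> : (fun x => e i (act (g + g') x)) =
      fun x => \sum_l (\sum_m ip (fun x => e i (act g x)) (e m) * ip (fun x => e m (act g' x)) (e l)) * e l x.
    apply/funext => y; rewrite actD eA; under eq_bigr do rewrite eA mulr_sumr.
    rewrite exchange_big/=; apply: eq_bigr => l _; rewrite mulr_suml.
    by apply: eq_bigr => m _; rewrite mulrA.
  rewrite ip_sum_orthonormal// rmorph_sum/=; apply: eq_bigr => l _.
  by rewrite !mxE rmorphM.
have [|v v0 vP] := @common_eigenvector_family _ G n A n0.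
  by move=> g g'; rewrite -!AD addrC.
pose a y := \sum_i complex.Re (v 0 i) * e i y; pose b y := \sum_i complex.Im (v 0 i) * e i y.
have [i vi] : exists i, v 0 i != 0 by apply/rV0Pn.
exists a, b; split; [exact: (VS _ _ _ Ve).1|exact: (VS _ _ _ Ve).1| |].
  apply: contrapT => /forallNP ab.
  have ab0 y : a y = 0 /\ b y = 0.
    by have /negP := ab y; rewrite negb_or !negbK => /andP[/eqP ? /eqP ?].
  have : complex.Re (v 0 i) = 0.
    rewrite -(ip_sum_orthonormal (fun i => complex.Re (v 0 i)) i ce oe).
    have -> : (fun x => \sum_i complex.Re (v 0 i) * e i x) = fun=> 0 by apply/funext => y; case: (ab0 y).
    by rewrite /ip; under eq_fun do rewrite mul0r; rewrite mean_cst.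
  have : complex.Im (v 0 i) = 0.
    rewrite -(ip_sum_orthonormal (fun i => complex.Im (v 0 i)) i ce oe).
    have -> : (fun x => \sum_i complex.Im (v 0 i) * e i x) = fun=> 0 by apply/funext => y; case: (ab0 y).
    by rewrite /ip; under eq_fun do rewrite mul0r; rewrite mean_cst.
  by move: vi; case: (v 0 i) => vr vim /= /[swap] -> /[swap] ->; rewrite eqxx.
pose c g := projT1 (cid (vP g)).
have cP g : v *m A g = c g *: v := projT2 (cid (vP g)).
exists (fun g => complex.Re (c g)), (fun g => complex.Im (c g)) => g y.
have key j : \sum_i v 0 i * (ip (fun x => e i (act g x)) (e j))%:C%C = c g * v 0 j.
  have := congr1 (fun M : 'rV_n => M 0 j) (cP g); rewrite !mxE => <-.
  by apply: eq_bigr => l _; rewrite mxE.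
have keyR j : \sum_i complex.Re (v 0 i) * ip (fun x => e i (act g x)) (e j) =
    complex.Re (c g) * complex.Re (v 0 j) - complex.Im (c g) * complex.Im (v 0 j).
  have := congr1 (@complex.Re R) (key j); case: (c g) (v 0 j) => [c1 c2] [v1 v2] /= <-.
  rewrite raddf_sum/=; apply: eq_bigr => l _.
  by case: (v 0 l) => [u1 u2] /=; rewrite mulr0 subr0.
have keyI j : \sum_i complex.Im (v 0 i) * ip (fun x => e i (act g x)) (e j) =
    complex.Im (c g) * complex.Re (v 0 j) + complex.Re (c g) * complex.Im (v 0 j).
  have := congr1 (@complex.Im R) (key j); case: (c g) (v 0 j) => [c1 c2] [v1 v2] /=.
  rewrite addrC [c2 * _]mulrC => <-.
  rewrite raddf_sum/=; apply: eq_bigr => l _.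
  by case: (v 0 l) => [u1 u2] /=; rewrite mulr0 add0r.
have swap (w : 'I_n -> R) : \sum_i w i * e i (act g y) =
    \sum_j (\sum_i w i * ip (fun x => e i (act g x)) (e j)) * e j y.
  under eq_bigr do rewrite eA mulr_sumr.
  rewrite exchange_big/=; apply: eq_bigr => j _; rewrite mulr_suml.
  by apply: eq_bigr => l _; rewrite mulrA.
split; rewrite /a /b swap.
  under eq_bigr do rewrite keyR mulrBl -!mulrA.
  by rewrite sumrB !mulr_sumr.
under eq_bigr do rewrite keyI mulrDl -!mulrA.
by rewrite big_split/= !mulr_sumr.
Qed.

End Eigenpair.
End Operator.

(** * Eigenfunctions separate points *)

(** An invariant pseudometric, continuous by equicontinuity and separating the
    points that [u] separates. *)
Definition orbit_dist (u : L -> R) (x y : L) : R :=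
  sup [set `|u (act g x) - u (act g y)| | g in [set: G]].

Section OrbitDist.
Variable u : L -> R.
Hypothesis cu : continuous u.

Lemma orbit_dist_has_sup x y :
  has_sup [set `|u (act g x) - u (act g y)| | g in [set: G]].
Proof.
have [M M0 uM] := compact_bound cptL cu; split.
  by exists `|u (act 0 x) - u (act 0 y)|; exists 0.
exists (M + M) => _ [g _ <-].
by rewrite (le_trans (ler_normB _ _))// lerD.
Qed.

Lemma orbit_dist_ge x y g : `|u (act g x) - u (act g y)| <= orbit_dist u x y.
Proof. by apply: sup_upper_bound; [exact: orbit_dist_has_sup|exists g]. Qed.

Lemma orbit_dist_le x y (e : R) :
  (forall g, `|u (act g x) - u (act g y)| <= e) -> orbit_dist u x y <= e.
Proof.
move=> H; apply: ge_sup; first by case: (orbit_dist_has_sup x y).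
by move=> _ [g _ <-].
Qed.

Lemma orbit_distC x y : orbit_dist u x y = orbit_dist u y x.
Proof.
by apply/eqP; rewrite eq_le; apply/andP; split; apply: orbit_dist_le => g;
  rewrite distrC; exact: orbit_dist_ge.
Qed.

Lemma orbit_dist_tri x y z : orbit_dist u x z <= orbit_dist u x y + orbit_dist u y z.
Proof.
apply: orbit_dist_le => g; rewrite -(subrKA (u (act g y))).
by rewrite (le_trans (ler_normD _ _))// lerD// orbit_dist_ge.
Qed.

Lemma orbit_dist_near x (e : R) : 0 < e -> \forall y \near x, orbit_dist u x y < e.
Proof.
move=> e0; have e2 : 0 < e / 2 by rewrite divr_gt0.
near=> y; apply: (@le_lt_trans _ _ (e / 2)); last by lra.
have H : forall g, `|u (act g x) - u (act g y)| < e / 2 by near: y; exact: equi.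
by apply: orbit_dist_le => g; exact: ltW.
Unshelve. all: by end_near. Qed.

Lemma orbit_dist_act h x y : orbit_dist u (act h x) (act h y) = orbit_dist u x y.
Proof.
apply/eqP; rewrite eq_le; apply/andP; split; apply: orbit_dist_le => g.
  by rewrite -!actD; exact: orbit_dist_ge.
have := orbit_dist_ge (act h x) (act h y) (g - h).
by rewrite -!actD subrK.
Qed.

End OrbitDist.

Definition eigenpair (a b : L -> R) := [/\ continuous a, continuous b &
  exists p q : G -> R, forall g y,
    a (act g y) = p g * a y - q g * b y /\ b (act g y) = q g * a y + p g * b y].

(** The functions orthogonal to all joint eigenfunctions form an invariant
    space on which the operator with kernel [orbit_dist u] vanishes, since it
    has no eigenfunction there. If no eigenfunction separated [x] from [y],
    this space would contain the difference of the kernel at [x] and at [y],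
    and that difference would have square mean zero. *)
Lemma eigenpair_separates (u : L -> R) x y : continuous u -> u x != u y ->
  exists a b, eigenpair a b /\ (a x != a y) || (b x != b y).
Proof.
move=> cu uxy; apply: contrapT => /forallNP nsep.
have agree a b : eigenpair a b -> a x = a y /\ b x = b y.
  move=> ab; have /forallNP/(_ b) := nsep a; apply: contra_notP => nab.
  split=> //; apply/negPn/negP; rewrite negb_or !negbK => /andP[/eqP ? /eqP ?].
  by apply: nab.
pose k := orbit_dist u.
have kC : forall x y, k x y = k y x by move=> ? ?; exact: orbit_distC.
have k_tri : forall x y z, k x z <= k x y + k y z by move=> ? ? ?; exact: orbit_dist_tri.
have k_near : forall x (e : R), 0 < e -> \forall y \near x, k x y < e.
  by move=> ? ? ?; exact: orbit_dist_near.
have k_act : forall g x y, k (act g x) (act g y) = k x y by move=> ? ? ?; exact: orbit_dist_act.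
have kc z : continuous (k z) by apply: k_cont.
have opc f : continuous f -> continuous (op k f) by move=> cf; apply: op_cont.
have opDk f g : continuous f -> continuous g -> op k (fun x => f x + g x) = fun x => op k f x + op k g x.
  by move=> cf cg; apply: opD.
have opZk (c : R) f : continuous f -> op k (fun x => c * f x) = fun x => c * op k f x.
  by move=> cf; apply: opZ.
have opAk h f z : continuous f -> op k f (act h z) = op k (fun y => f (act h y)) z.
  by move=> cf; apply: op_act.
have opSk f g : continuous f -> continuous g -> ip (op k f) g = ip f (op k g).
  by move=> cf cg; apply: op_sym.
have eigAD (a b : L -> R) (p q : G -> R) h : (forall g y,
    a (act g y) = p g * a y - q g * b y /\ b (act g y) = q g * a y + p g * b y) ->
    (fun z => a (act h z)) = (fun z => p h * a z + (- q h) * b z) /\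
    (fun z => b (act h z)) = (fun z => q h * a z + p h * b z).
  by move=> pq; split; apply/funext => t; have [Ea Eb] := pq h t; rewrite ?Ea ?Eb ?mulNr.
have eig_op a b : eigenpair a b -> eigenpair (op k a) (op k b).
  move=> [ca cb [p [q pq]]]; split; [exact: opc|exact: opc|exists p, q => g z].
  have [Ea Eb] := eigAD a b p q g pq.
  by rewrite !opAk// Ea Eb !opDk ?opZk ?mulNr//; exact: contZ.
have ip_act f g h : continuous f -> continuous g ->
    ip (fun z => f (act h z)) g = ip f (fun z => g (act (- h) z)).
  move=> cf cg; rewrite /ip -(mean_act (- h)); last by apply: contM => //; exact: cont_act.
  by congr mean; apply/funext => z; rewrite -actD subrr act0.
pose W f := continuous f /\ forall a b, eigenpair a b -> ip f a = 0 /\ ip f b = 0.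
have W_cont f : W f -> continuous f by case.
have W_lin (c : R) f g : W f -> W g -> W (fun x => c * f x + g x).
  move=> [cf Wf] [cg Wg]; split; first by apply: contD => //; exact: contZ.
  move=> a b ab; have [fa fb] := Wf a b ab; have [ga gb] := Wg a b ab.
  have [ca cb _] := ab.
  by rewrite !ipDl ?ipZl//; [rewrite fa fb ga gb mulr0 addr0|exact: contZ|exact: contZ].
have W_op f : W f -> W (op k f).
  move=> [cf Wf]; split; first exact: opc.
  move=> a b ab; have [ca cb _] := ab; rewrite !opSk//.
  by apply: Wf; exact: eig_op.
have W_act h f : W f -> W (fun x => f (act h x)).
  move=> [cf Wf]; split; first exact: cont_act.
  move=> a b ab; have [fa fb] := Wf a b ab; have [ca cb [p [q pq]]] := ab.
  rewrite !ip_act//; have [-> ->] := eigAD a b p q (- h) pq.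
  rewrite !(ipC f) !ipDl ?ipZl//; try exact: contZ.
  by rewrite !(ipC _ f) fa fb !mulr0 addr0.
have W_closed f : continuous f ->
    (forall e : R, 0 < e -> exists2 h, W h & forall x, `|h x - f x| <= e) -> W f.
  move=> cf fW; split=> // a b ab; have [ca cb _] := ab.
  suff H c : continuous c -> (forall h, W h -> ip h c = 0) -> ip f c = 0.
    by split; apply: H => // h [_ /(_ a b ab)[]].
  move=> cc hc; have [M M0 cM] := compact_bound cptL cc.
  apply/eqP; rewrite -normr_le0; apply/ler_addgt0Pl => e e0; rewrite addr0.
  have [h Wh hf] := fW (e / M) (divr_gt0 e0 M0).
  rewrite -[ip f c]subr0 -(hc h Wh); apply: mean_dist; [exact: contM|apply: contM => //; exact: W_cont|].
  move=> z; rewrite -mulrBl normrM -[e](divfK (lt0r_neq0 M0)) ler_pM// distrC; exact: hf.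
have Wnone f : W f -> forall z, op k f z = 0.
  move=> Wf z; apply: contrapT => /eqP fz.
  have [a [b [Wa Wb [t abt] pq]]] : exists a b, [/\ W a, W b, exists y, (a y != 0) || (b y != 0) &
    exists p q : G -> R, forall g y,
      a (act g y) = p g * a y - q g * b y /\ b (act g y) = q g * a y + p g * b y].
    by apply: (@eigenpair_exists k) fz.
  have ab : eigenpair a b by split=> //; exact: W_cont.
  have := ip_eq0 (W_cont _ Wa) (Wa.2 _ _ ab).1 t; have := ip_eq0 (W_cont _ Wb) (Wb.2 _ _ ab).2 t.
  by move=> b0 a0; move: abt; rewrite a0 b0 eqxx.
(* [ip h f] is the difference of [op k f] at [x] and [y]; it vanishes on
   eigenfunctions, which are permuted by the operator, and then on [h] itself,
   so [k x] and [k y] agree. *)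
pose h z := (-1) * k y z + k x z.
have ch : continuous h by apply: contD => //; exact: contZ.
have iph f : continuous f -> ip h f = op k f x - op k f y.
  by move=> cf; rewrite ipDl ?ipZl ?mulN1r 1?addrC//; exact: contZ.
have Wh : W h.
  split=> // a b ab; have [ca cb _] := ab; have [ea eb] := agree _ _ (eig_op _ _ ab).
  by rewrite !iph// ea eb !subrr.
have hh : ip h h = 0 by rewrite iph// !Wnone// subrr.
have := ip_eq0 ch hh x; rewrite /h mulN1r => /eqP; rewrite addrC subr_eq0 => /eqP kxy.
have kxx : k x x <= 0 by apply: orbit_dist_le => // g; rewrite subrr normr0.
have := orbit_dist_ge cu y x 0; rewrite !act0 -/(k y x) -kxy => H.
by have := le_trans H kxx; rewrite normr_le0 subr_eq0 eq_sym (negbTE uxy).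
Qed.

(** The modulus of an eigenfunction is invariant, hence constant by
    minimality, so that a joint eigenfunction can be normalised to take values
    in the circle. *)
Lemma eigenpair_circle a b y : eigenpair a b -> (a y != 0) || (b y != 0) ->
  exists r (chi : L -> circle R) (c : G -> circle R), [/\ 0 < r,
    forall z, a z = r * cre (chi z) /\ b z = r * cim (chi z), continuous chi &
    forall g z, chi (act g z) = c g + chi z].
Proof.
move=> [ca cb [p [q pq]]] aby.
pose N z := a z * a z + b z * b z.
have cN : continuous N by apply: contD; exact: contM.
have N0 z : 0 <= N z by rewrite addr_ge0// -expr2 sqr_ge0.
have NA g z : N (act g z) = (p g ^+ 2 + q g ^+ 2) * N z.
  by rewrite /N; case: (pq g z) => -> ->; ring.
have [m _ mP] := compact_EVT_max (ex_intro _ y I) cptL (continuous_subspaceT cN).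
have {}mP z : N z <= N m by apply: mP; rewrite inE.
have Nm : 0 < N m.
  apply: lt_le_trans (mP y); rewrite /N -!expr2.
  by case/orP: aby => H; [rewrite ltr_pwDl|rewrite ltr_wpDl]; rewrite ?sqr_ge0 ?exprn_even_gt0.
(* The factor by which the action multiplies the squared modulus is compared
   with 1 at the maximum. *)
have pq1 g : p g ^+ 2 + q g ^+ 2 = 1.
  apply/eqP; rewrite eq_le; apply/andP; split.
    by rewrite -(ler_pM2r Nm) mul1r -NA.
  have := NA g (act (- g) m); rewrite -actD subrr act0 => E.
  rewrite -(ler_pM2r Nm) mul1r {1}E ler_wpM2l// addr_ge0 ?sqr_ge0//.
have Nc z : N z = N m.
  apply: contrapT => /eqP Nz; pose O := N @^-1` [set t | t != N m].
  have oO : open O.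
    apply: open_comp => [t _|]; first exact: cN.
    exact: open_neq.
  have [t [Ot [g _ gt]]] := minL m (ex_intro _ z Nz) oO.
  by move: Ot; rewrite /O /= -gt NA pq1 mul1r eqxx.
pose r := Num.sqrt (N m); have r0 : 0 < r by rewrite sqrtr_gt0.
have rr : r ^+ 2 = N m by rewrite sqr_sqrtr ?ltW.
have un z : (a z / r) ^+ 2 + (b z / r) ^+ 2 = 1.
  by rewrite !expr_div_n -mulrDl rr -(Nc z) /N -!expr2 divff// !expr2 -/(N z) Nc gt_eqF.
have uc g : (p g) ^+ 2 + (q g) ^+ 2 = 1 by [].
exists r, (fun z => circle_pt (un z)), (fun g => circle_pt (uc g)); split=> //.
- by move=> z; rewrite /cre /cim /= ![r * _]mulrC !divfK ?gt_eqF.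
- apply: continuous_circle => z.
    by apply: cvgM; [exact: ca|exact: cvg_cst].
  by apply: cvgM; [exact: cb|exact: cvg_cst].
- move=> g z; apply: circle_eq.
    by rewrite creD /cre /cim /=; case: (pq g z) => -> _; ring.
  by rewrite cimD /cre /cim /=; case: (pq g z) => _ ->; ring.
Qed.

Lemma eigenfunctions_separate (u : L -> R) x y : continuous u -> u x != u y ->
  exists (chi : L -> circle R) (c : G -> circle R), [/\ continuous chi,
    forall g z, chi (act g z) = c g + chi z & chi x != chi y].
Proof.
move=> cu uxy; have [a [b [ab sep]]] := eigenpair_separates cu uxy.
have [z abz] : exists z, (a z != 0) || (b z != 0).
  apply: contrapT => /forallNP H; move: sep.
  have Z z : a z = 0 /\ b z = 0.
    by have /negP := H z; rewrite negb_or !negbK => /andP[/eqP ? /eqP ?].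
  by rewrite (Z x).1 (Z x).2 (Z y).1 (Z y).2 eqxx.
have [r [chi [c [r0 rP cchi cP]]]] := eigenpair_circle ab abz.
exists chi, c; split=> //; apply/eqP => E; move: sep.
by rewrite (rP x).1 (rP x).2 (rP y).1 (rP y).2 E !eqxx.
Qed.

End Mean.

(** * Equicontinuity and minimality *)

Lemma compact_uniform_continuity (R : realType) (T : uniformType) (u : T -> R) (e : R) :
  compact [set: T] -> continuous u -> 0 < e ->
  exists2 E, entourage E & forall a b, E (a, b) -> `|u a - u b| < e.
Proof.
move=> cT cu e0; have e2 : 0 < e / 2 by rewrite divr_gt0.
have DP z : exists2 D : set (T * T), entourage D &
    forall a b, D (z, a) -> D (a, b) -> `|u a - u b| < e.
  have : nbhs z [set w | `|u z - u w| < e / 2].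
    have /cvgrPdist_lt := cu z; exact.
  move=> /nbhsP[E entE Ez]; exists (split_ent E); first exact: entourage_split_ent.
  move=> a b za ab.
  have H1 : `|u z - u a| < e / 2 by apply: Ez; apply/xsectionP; exact: split_ent_subset za.
  have H2 : `|u z - u b| < e / 2 by apply: Ez; apply/xsectionP; exact: entourage_split za ab.
  by move: H1 H2; rewrite !ltr_norml => /andP[? ?] /andP[? ?]; apply/andP; split; lra.
pose D z := s2val (cid2 (DP z)).
have entD z : entourage (D z) := s2valP (cid2 (DP z)).
have DD z a b : D z (z, a) -> D z (a, b) -> `|u a - u b| < e := @s2valP' _ _ _ (cid2 (DP z)) a b.
have [s sP] := compact_nbhs_cover cT (fun z => nbhs_entourage z (entD z)).
exists [set ab | forall z, z \in s -> D z ab].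
  elim: s {sP} => [|z s IH]; first by apply: filterS entourageT => ab _ z.
  apply: filterS2 (entD z) IH => ab zab sab z'.
  by rewrite inE => /predU1P[->//|]; exact: sab.
move=> a b ab; have [z zs /xsectionP za] := sP a.
by apply: DD za _; exact: ab.
Qed.

Section Flow.
Variables (G : topologicalZmodType) (X : topologicalType) (act : G -> X -> X).
Hypothesis flowX : is_flow act.

Lemma flow_compact : compact [set: X]. Proof. by case: flowX. Qed.
Lemma flow_hausdorff : hausdorff_space X. Proof. by case: flowX. Qed.
Lemma flow0 x : act 0 x = x. Proof. by case: flowX. Qed.
Lemma flowD g h x : act (g + h) x = act g (act h x). Proof. by case: flowX. Qed.

Lemma flow_act_continuous g : continuous (act g).
Proof.
case: flowX => _ _ _ _ ca x.
apply: (@continuous_comp _ _ _ (fun x => (g, x)) (fun p => act p.1 p.2)); last exact: ca.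
by apply: cvg_pair; [exact: cvg_cst|exact: cvg_id].
Qed.

End Flow.

Section EquicontinuousFlow.
Variables (R : realType) (G : topologicalZmodType) (L : uniformType) (act : G -> L -> L).
Hypothesis flowL : is_flow act.
Hypothesis equiL : uniformly_equicontinuous act.

Lemma flow_equicontinuous (u : L -> R) : continuous u -> forall x (e : R), 0 < e ->
  \forall y \near x, forall g, `|u (act g x) - u (act g y)| < e.
Proof.
move=> cu x e e0.
have [E entE EP] := compact_uniform_continuity (flow_compact flowL) cu e0.
have [D entD DP] := equiL entE.
have : nbhs x (xsection D x) by exact: nbhs_entourage.
by apply: filterS => y /xsectionP xy g; apply: EP; exact: DP.
Qed.

(** If the orbit of [x] missed an open set, a Urysohn function [v] would
    vanish on the orbit and not on the open set. Its supremum over orbits is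
    invariant, continuous by equicontinuity, zero at [x] and not constant. *)
Lemma equicontinuous_minimal :
  (forall f : L -> R, continuous f -> (forall g x, f (act g x) = f x) ->
     forall x y, f x = f y) -> minimal_flow act.
Proof.
move=> inv x O [y Oy] oO; apply: contrapT => nO.
have cO : closed (~` O) by exact: open_closedC.
have nOy : ~ (~` O) y by move=> /(_ Oy).
have : @uniform_separator L [set y] (~` O) by apply: point_uniform_separator cO nOy.
move=> /(@uniform_separatorP L R)[u [cu u01 u0 u1]].
have ub z : 0 <= u z <= 1.
  by have := u01 (u z) (ex_intro2 _ _ z I erefl); rewrite /= in_itv.
pose v z := 1 - u z; have cv : continuous v.
  by move=> z; apply: cvgB; [exact: cvg_cst|exact: cu].
have v1 z : v z <= 1 by have /andP[a b] := ub z; rewrite /v; lra.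
have vx g : v (act g x) = 0.
  rewrite /v; have -> : u (act g x) = 1; last by rewrite subrr.
  by apply: u1; exists (act g x) => // Og; apply: nO; exists (act g x); split=> //; exists g.
have vy : v y = 1.
  by rewrite /v; have -> : u y = 0; [apply: u0; exists y|rewrite subr0].
pose S z := [set v (act g z) | g in [set: G]].
have hS z : has_sup (S z).
  split; first by exists (v (act 0 z)), 0.
  by exists 1 => _ [g _ <-].
pose f z := sup (S z).
have fge z g : v (act g z) <= f z by apply: sup_upper_bound; [exact: hS|exists g].
have fle z (c : R) : (forall g, v (act g z) <= c) -> f z <= c.
  move=> H; apply: ge_sup; first by case: (hS z).
  by move=> _ [g _ <-].
have fact h z : f (act h z) = f z.
  apply/eqP; rewrite eq_le; apply/andP; split; apply: fle => g.
    by rewrite -(flowD flowL).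
  by rewrite -[g](subrK h) (flowD flowL).
have cf : continuous f.
  move=> z; apply/cvgrPdist_le => e e0; near=> w.
  have H : forall g, `|v (act g z) - v (act g w)| < e by near: w; exact: flow_equicontinuous.
  rewrite ler_norml lerNl opprB !lerBlDr; apply/andP; split; apply: fle => g;
    have := H g; have := fge z g; have := fge w g; rewrite ltr_norml => ? ? /andP[? ?]; lra.
have := inv f cf fact x y; have : f x <= 0 by apply: fle => g; rewrite vx.
have := fge y 0; rewrite (flow0 flowL) vy => a b c; move: a b; rewrite c => a b.
by have := le_trans a b; rewrite ler10.
Unshelve. all: by end_near. Qed.

End EquicontinuousFlow.

(** * Lifting circle-valued functions on simplices *)

Section Simplex.
Variables (R : realType) (n : nat).
Local Notation Dn := (std_simplex R n).
Implicit Types (z w : Dn) (t : R).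

Lemma simplex_ge0 z j : 0 <= (\val z) 0 j.
Proof. by have /set_mem[] := valP z. Qed.

Lemma simplex_sum z : \sum_j (\val z) 0 j = 1.
Proof. by have /set_mem[] := valP z. Qed.

Lemma simplex_le1 z j : (\val z) 0 j <= 1.
Proof.
rewrite -(simplex_sum z) (bigD1 j)//= lerDl sumr_ge0// => i _; exact: simplex_ge0.
Qed.

Lemma coord_simplex_continuous j : continuous (fun z => (\val z) 0 j).
Proof.
have valc : continuous (set_val : Dn -> 'rV[R]_n.+1).
  by move=> y; apply: (@initial_continuous _ _ set_val).
by move=> z; apply: continuous_comp (valc z) (@coord_continuous _ _ _ _ _ _).
Qed.

Lemma nbhs_simplex z (U : set Dn) : nbhs z U ->
  exists2 d : R, 0 < d & forall w, (forall j, `|(\val z) 0 j - (\val w) 0 j| < d) -> U w.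
Proof.
move=> [_ [/= [W oW <-] /= Wz] WU].
have : nbhs (set_val z : 'rV[R]_n.+1) W by exact: open_nbhs_nbhs.
move=> /nbhs_ballP[d /= d0 dW]; exists d => // w wd; apply: WU; apply: dW.
by split=> // i j; rewrite ord1 -ball_normE/=; exact: wd.
Qed.

Lemma nbhs_simplexI z (d : R) : 0 < d ->
  nbhs z [set w : Dn | forall j, `|(\val z) 0 j - (\val w) 0 j| < d].
Proof.
move=> d0; apply: (@filter_forall _ _ _ (nbhs z)) => j.
by have /cvgrPdist_lt := @coord_simplex_continuous j z; exact.
Qed.

Lemma cont_simplex (T : topologicalType) (f : T -> Dn) :
  (forall j, continuous (fun x => (\val (f x)) 0 j)) -> continuous f.
Proof.
move=> cf x U /nbhs_simplex[d d0 dU].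
have : \forall y \near x, forall j, `|(\val (f x)) 0 j - (\val (f y)) 0 j| < d.
  apply: (@filter_forall _ _ _ (nbhs x)) => j.
  by have /cvgrPdist_lt := cf j x; exact.
by apply: filterS => y; exact: dU.
Qed.

Lemma simplex_compact : compact [set: Dn].
Proof.
have cA : compact (std_simplex R n).
  apply: (@subclosed_compact _ _ [set v : 'rV[R]_n.+1 | forall i, `[0, 1]%classic (v ord0 i)]); last 2 first.
  - exact: (@rV_compact R n.+1 (fun=> `[0, 1]%classic) (fun=> @segment_compact R 0 1)).
  - move=> x [x0 x1] j; rewrite /= in_itv/= x0/= -x1 (bigD1 j)//= lerDl.
    by rewrite sumr_ge0.
  have -> : std_simplex R n = (\bigcap_(j in [set: 'I_n.+1]) [set x : 'rV[R]_n.+1 | 0 <= x 0 j])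
      `&` [set x | \sum_j x 0 j = 1].
    apply/seteqP; split=> x [x0 x1]; split=> //; first by move=> j _; exact: x0.
    by move=> j; exact: (x0 j I).
  apply: closedI.
    apply: closed_bigI => j _.
    apply: (@closed_comp _ _ (fun x : 'rV[R]_n.+1 => x 0 j) [set r | 0 <= r]) => [x _|].
      exact: coord_continuous.
    exact: closed_ge.
  apply: (@closed_comp _ _ (fun x : 'rV[R]_n.+1 => \sum_j x 0 j) [set r | r = 1]) => [x _|].
    apply: (@cont_sum R _ _ _ (fun j (x : 'rV[R]_n.+1) => x 0 j)) => j.
    exact: coord_continuous.
  exact: closed_eq.
move=> F FF _.
have [|x [Ax xF]] := cA ((set_val : Dn -> 'rV[R]_n.+1) @ F) _.
  have valA (w : Dn) : std_simplex R n (set_val w) by apply: set_mem; exact: (valP w).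
  by apply: (@filterS _ F _ setT) => [w _|]; [exact: valA|exact: filterT].
exists (exist _ x (mem_set Ax)); split=> // A U FA [_ [/= [W oW <-] /= Wx] WU].
have [_ [[w Aw <-] Ww]] := xF [set set_val w | w in A] W
  (filterS (fun w Aw => ex_intro2 _ _ w Aw erefl) FA) (open_nbhs_nbhs (conj oW Wx)).
by exists w; split=> //; exact: WU.
Qed.

Definition clamp t : R := Num.max 0 (Num.min t 1).

Lemma clamp_ge0 t : 0 <= clamp t. Proof. by rewrite le_max lexx. Qed.
Lemma clamp_le1 t : clamp t <= 1. Proof. by rewrite ge_max ler01 ge_min lexx orbT. Qed.
Lemma clamp_id t : 0 <= t <= 1 -> clamp t = t.
Proof. by move=> /andP[t0 t1]; rewrite /clamp min_l// max_r. Qed.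

Lemma continuous_clamp : continuous clamp.
Proof.
move=> t; apply: (@continuous_max _ _ (fun=> 0) (fun t => Num.min t 1)); first exact: cvg_cst.
by apply: (@continuous_min _ _ id (fun=> 1)); [exact: cvg_id|exact: cvg_cst].
Qed.

Let mix_proof z w t : Dn ((1 - clamp t) *: \val z + clamp t *: \val w).
Proof.
have t0 := clamp_ge0 t; have t1 := clamp_le1 t.
split=> [j|].
  by rewrite !mxE addr_ge0// mulr_ge0 ?simplex_ge0// subr_ge0.
under eq_bigr do rewrite !mxE.
by rewrite big_split/= -!mulr_sumr !simplex_sum !mulr1 subrK.
Qed.

Definition mix z w t : Dn :=
  @exist _ _ ((1 - clamp t) *: \val z + clamp t *: \val w) (mem_set (mix_proof z w t)).

Lemma mixE z w t j : (\val (mix z w t)) 0 j =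
  (1 - clamp t) * (\val z) 0 j + clamp t * (\val w) 0 j.
Proof. by rewrite !mxE. Qed.

Lemma mix0 z w : mix z w 0 = z.
Proof. by apply/val_inj/rowP => j; rewrite mixE clamp_id ?lexx ?ler01// subr0 mul1r mul0r addr0. Qed.

Lemma mix1 z w : mix z w 1 = w.
Proof. by apply/val_inj/rowP => j; rewrite mixE clamp_id ?lexx ?ler01// subrr mul1r mul0r add0r. Qed.

Lemma continuous_mix (T : topologicalType) z (g : T -> Dn) (h : T -> R) :
  continuous g -> continuous h -> continuous (fun x => mix z (g x) (h x)).
Proof.
move=> cg ch; apply: cont_simplex => j; under eq_fun do rewrite mixE.
have cc : continuous (fun x => clamp (h x)).
  by move=> x; apply: continuous_comp; [exact: ch|exact: continuous_clamp].
have cgj : continuous (fun x => (\val (g x)) 0 j).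
  by move=> x; apply: (@continuous_comp _ _ _ g (fun z => (\val z) 0 j));
    [exact: cg|exact: coord_simplex_continuous].
move=> x; apply: cvgD; apply: cvgM; [|exact: cvg_cst|exact: cc|exact: cgj].
by apply: cvgB; [exact: cvg_cst|exact: cc].
Qed.

(** Uniform continuity, in the form needed to lift: on small scales the
    quotient of two values stays in the right half of the circle, where [parg]
    inverts [cexp]. *)
Lemma simplex_uniform (f : Dn -> circle R) : continuous f ->
  exists2 d : R, 0 < d & forall z w,
    (forall j, `|(\val z) 0 j - (\val w) 0 j| < d) -> 0 < cre (f w - f z).
Proof.
move=> cf; have q0 : 0 < 1 / 4 :> R by rewrite divr_gt0.
have dP z : exists2 d : R, 0 < d & forall w,
    (forall j, `|(\val z) 0 j - (\val w) 0 j| < d) ->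
    `|cre (f z) - cre (f w)| < 1 / 4 /\ `|cim (f z) - cim (f w)| < 1 / 4.
  apply: nbhs_simplex.
  have H1 : \forall w \near z, `|cre (f z) - cre (f w)| < 1 / 4.
    by have /cvgrPdist_lt := @cont_cre _ _ _ cf z; exact.
  have H2 : \forall w \near z, `|cim (f z) - cim (f w)| < 1 / 4.
    by have /cvgrPdist_lt := @cont_cim _ _ _ cf z; exact.
  by apply: filterS2 H1 H2 => w ? ?; split.
pose d z := s2val (cid2 (dP z)).
have d0 z : 0 < d z := s2valP (cid2 (dP z)).
have dd z w := @s2valP' _ _ _ (cid2 (dP z)) w.
have [s sP] := compact_nbhs_cover simplex_compact
  (fun z => nbhs_simplexI z (divr_gt0 (d0 z) (ltr0Sn R 1))).
have [e e0 es] : exists2 e : R, 0 < e & forall z, z \in s -> e <= d z / 2.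
  elim: s {sP} => [|z s [e e0 es]]; first by exists 1.
  exists (Num.min e (d z / 2)); first by rewrite lt_min e0 divr_gt0.
  move=> w; rewrite inE => /predU1P[->|/es H]; first by rewrite ge_min lexx orbT.
  by rewrite ge_min H.
exists e => // z w zw; have [x xs /= xz] := sP z.
have dx := d0 x.
have [a1 b1] : `|cre (f x) - cre (f z)| < 1 / 4 /\ `|cim (f x) - cim (f z)| < 1 / 4.
  apply: dd => j; apply: lt_trans (xz j) _; by rewrite ltr_pdivrMr// ltr_pMr// ltr1n.
have [a2 b2] : `|cre (f x) - cre (f w)| < 1 / 4 /\ `|cim (f x) - cim (f w)| < 1 / 4.
  apply: dd => j; have : `|(\val x) 0 j - (\val z) 0 j| < d x / 2 := xz j.
  move=> xzj; rewrite -/(d x) [d x]splitr -(subrKA ((\val z) 0 j)).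
  apply: le_lt_trans (ler_normD _ _) _; apply: ltrD => //.
  by apply: lt_le_trans (zw j) _; exact: es.
have := cre2Dcim2 (f z); have := cre2Dcim2 (f w); rewrite creD creN cimN.
move: a1 b1 a2 b2; rewrite !ltr_norml.
move: (cre (f x)) (cim (f x)) (cre (f z)) (cim (f z)) (cre (f w)) (cim (f w)).
move=> a b a' b' c d' /andP[? ?] /andP[? ?] /andP[? ?] /andP[? ?] e1 e2.
have -> : c * a' - d' * - b' = 1 - ((a' - c) ^+ 2 + (b' - d') ^+ 2) / 2.
  have -> : (a' - c) ^+ 2 + (b' - d') ^+ 2 = (a' ^+ 2 + b' ^+ 2) + (c ^+ 2 + d' ^+ 2) - 2 * (c * a' + d' * b') by ring.
  by rewrite e1 e2; field.
have : (a' - c) ^+ 2 <= 1 / 4 by nra.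
have : (b' - d') ^+ 2 <= 1 / 4 by nra.
lra.
Qed.

End Simplex.

Section Lift.
Variables (R : realType) (n : nat).
Local Notation Dn := (std_simplex R n).

(** Only differences are prescribed, since a lift is determined up to a
    constant. *)
Definition is_lift (f : Dn -> circle R) (theta : Dn -> R) :=
  continuous theta /\ forall z w, f z - f w = cexp (theta z - theta w).

Lemma lift_unique f theta theta' z w : is_lift f theta -> is_lift f theta' ->
  theta z - theta w = theta' z - theta' w.
Proof.
move=> [ct tP] [ct' tP'].
(* Two lifts differ by a path in the fibre over zero. *)
pose h (t : R) := (theta (mix w z t) - theta w) - (theta' (mix w z t) - theta' w).
have cm : continuous (fun t : R => mix w z t).
  by apply: continuous_mix => t; [exact: cvg_cst|exact: cvg_id].
have ch : continuous h.
  move=> t; apply: cvgB; apply: cvgB; try exact: cvg_cst.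
    by apply: (@continuous_comp _ _ _ (mix w z) theta); [exact: cm|exact: ct].
  by apply: (@continuous_comp _ _ _ (mix w z) theta'); [exact: cm|exact: ct'].
have := @cexp_eq0_itv R h ch; rewrite /h mix0 mix1 !subrr => H.
have : 0 = theta z - theta w - (theta' z - theta' w).
  by apply: H => t _; rewrite cexpB -tP -tP' subrr.
by move=> /esym/eqP; rewrite subr_eq0 => /eqP.
Qed.

(** The lift at [z] adds up the small arguments picked up along the segment
    from a vertex to [z], cut into [N] equal steps. *)
Lemma lift_exists (f : Dn -> circle R) : continuous f -> exists theta, is_lift f theta.
Proof.
move=> cf; have [d d0 dP] := simplex_uniform cf.
have z0P : Dn (\row_(j < n.+1) (j == ord0)%:R).
  split=> [j|]; first by rewrite mxE ler0n.
  rewrite (bigD1 ord0)//= mxE eqxx big1 ?addr0// => j j0.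
  by rewrite mxE (negbTE j0).
pose z0 : Dn := @exist _ _ (\row_(j < n.+1) (j == ord0)%:R) (mem_set z0P).
pose N := (Num.bound d^-1).+1; pose s k : R := k%:R / N%:R.
have Nd : N%:R^-1 < d.
  rewrite -[ltRHS]invrK ltf_pV2 ?posrE ?invr_gt0//.
  apply: lt_le_trans (archi_boundP _) _; first by rewrite invr_ge0 ltW.
  by rewrite ler_nat.
have s01 k : (k <= N)%N -> 0 <= s k <= 1.
  by move=> kN; rewrite divr_ge0//= ler_pdivrMr ?ltr0n// mul1r ler_nat.
pose step k z := f (mix z0 z (s k.+1)) - f (mix z0 z (s k)).
have cmk k : continuous (fun z => mix z0 z (s k)).
  by apply: (@continuous_mix _ _ _ z0 id (fun=> s k)); [move=> z; exact: cvg_id|exact: cst_continuous].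
have cfk k : continuous (fun z => f (mix z0 z (s k))).
  by move=> z; apply: (@continuous_comp _ _ _ (fun z => mix z0 z (s k)) f); [exact: cmk|exact: cf].
have cstep k : continuous (step k) by apply: cont_circleB.
have stepP k z : (k < N)%N -> 0 < cre (step k z).
  move=> kN; apply: dP => j; rewrite !mixE (clamp_id (s01 _ (ltnW kN))) (clamp_id (s01 _ kN)).
  have -> : (1 - s k) * (\val z0) 0 j + s k * (\val z) 0 j -
     ((1 - s k.+1) * (\val z0) 0 j + s k.+1 * (\val z) 0 j) =
     (s k.+1 - s k) * ((\val z0) 0 j - (\val z) 0 j) by ring.
  have -> : s k.+1 - s k = N%:R^-1 by rewrite /s -mulrBl -natrB// subSnn mul1r.
  rewrite normrM gtr0_norm ?invr_gt0 ?ltr0n//; apply: le_lt_trans Nd.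
  rewrite ger_pMr ?invr_gt0 ?ltr0n// ler_norml.
  have := simplex_ge0 z0 j; have := simplex_ge0 z j; have := simplex_le1 z0 j.
  have := simplex_le1 z j; move=> ? ? ? ?; apply/andP; split; lra.
pose theta z := \sum_(k < N) parg (step k z).
have e0 z : cexp (theta z) = f z - f z0.
  have E m : (m <= N)%N -> cexp (\sum_(k < m) parg (step k z)) = f (mix z0 z (s m)) - f z0.
    elim: m => [_|m IH mN]; first by rewrite big_ord0 cexp0 /s mul0r mix0 subrr.
    rewrite big_ord_recr/= cexpD IH 1?ltnW// cexp_parg; last exact: stepP.
    by rewrite /step addrC addrA subrK.
  by rewrite /theta E// /s divff ?pnatr_eq0// mix1.
exists theta; split.
  apply: cont_sum => k z; apply: (@continuous_comp _ _ _ (step k) (@parg R)); first exact: cstep.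
  by apply: continuous_parg; exact: stepP.
by move=> z w; rewrite cexpB !e0 opprB addrA subrK.
Qed.

End Lift.

(** * The degree of a circle-valued function along a chain *)

Section Chains.
Variables (R : realType) (X : topologicalType).

Let origin_proof : std_simplex R 0 (const_mx 1).
Proof. by split=> [j|]; rewrite ?big_ord1 mxE// ler01. Qed.

Definition origin : std_simplex R 0 := @exist _ _ (const_mx 1) (mem_set origin_proof).

Lemma originE (z : std_simplex R 0) : z = origin.
Proof.
apply/val_inj/rowP => j; rewrite ord1 mxE.
by have := simplex_sum z; rewrite big_ord1.
Qed.

Definition vertex0 : std_simplex R 1 := face 1 origin.
Definition vertex1 : std_simplex R 1 := face 0 origin.

Lemma vertex0E j : (\val vertex0) 0 j = (j == 0)%:R.
Proof.
rewrite mxE; case: unliftP => [k ->|->]; rewrite ?mxE//.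
by have -> : (lift 1 k == 0) = true by rewrite ord1 -val_eqE.
Qed.

Lemma vertex1E j : (\val vertex1) 0 j = (j == 1)%:R.
Proof.
rewrite mxE; case: unliftP => [k ->|->]; rewrite ?mxE//.
by have -> : (lift 0 k == 1) = true by rewrite ord1 -val_eqE.
Qed.

Lemma face_originE n (i : 'I_n.+2) (z : std_simplex R n) j :
  (\val (face i z)) 0 j = if unlift i j is Some k then (\val z) 0 k else 0.
Proof. by rewrite mxE. Qed.

Lemma triangle_vertices :
  [/\ face (0 : 'I_3) vertex1 = face (1 : 'I_3) vertex1,
      face (0 : 'I_3) vertex0 = face (inord 2 : 'I_3) vertex1 &
      face (1 : 'I_3) vertex0 = face (inord 2 : 'I_3) vertex0].
Proof.
have fE (i j : 'I_3) (v : 'I_2) (w : std_simplex R 1) :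
    (forall k, (\val w) 0 k = (k == v)%:R) ->
    (\val (face i w)) 0 j = (j == lift i v)%:R.
  move=> wE; rewrite face_originE; case: unliftP => [k ->|->].
    by rewrite wE (inj_eq lift_inj).
  by rewrite (negbTE (neq_lift _ _)).
have L (a b : 'I_3) (v w : 'I_2) : lift a v = lift b w -> forall z z' : std_simplex R 1,
    (forall k, (\val z) 0 k = (k == v)%:R) -> (forall k, (\val z') 0 k = (k == w)%:R) ->
    face a z = face b z'.
  by move=> E z z' zE z'E; apply/val_inj/rowP => j; rewrite (fE _ _ v)// (fE _ _ w)// E.
split.
- apply: (L _ _ 1 1); [|exact: vertex1E|exact: vertex1E]; exact: val_inj.
- apply: (L _ _ 0 1); [|exact: vertex0E|exact: vertex1E].
  by apply: val_inj; rewrite /= inordK.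
- apply: (L _ _ 0 0); [|exact: vertex0E|exact: vertex0E].
  by apply: val_inj; rewrite /= inordK.
Qed.

Definition point_simplex (x : X) : singular_simplex R X 0 := cst x.

Lemma point_simplexE (s : singular_simplex R X 0) : s = point_simplex (s origin).
Proof. by apply/continuousEP => z; rewrite (originE z). Qed.

Definition point_chain (x : X) : chain R X 0 := << point_simplex x >>.

Lemma boundary1 (s : singular_simplex R X 1) :
  boundary (<< s >> : chain R X 1) = point_chain (s vertex1) - point_chain (s vertex0).
Proof.
rewrite /boundary liftU scale1r /simplex_boundary !big_ord_recl big_ord0 addr0 expr0 scale1r.
rewrite expr1 scaleN1r; congr (<< _ >> - << _ >>).
  by rewrite [LHS]point_simplexE.
by rewrite [LHS]point_simplexE /= /vertex0; congr (point_simplex (s (face _ _))); apply: val_inj.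
Qed.

Lemma boundary2 (s : singular_simplex R X 2) :
  boundary (<< s >> : chain R X 2) =
    (<< (s \o @face R 1 0 : singular_simplex R X 1) >> : chain R X 1)
  - (<< (s \o @face R 1 1 : singular_simplex R X 1) >> : chain R X 1)
  + (<< (s \o @face R 1 (inord 2) : singular_simplex R X 1) >> : chain R X 1).
Proof.
rewrite /boundary liftU scale1r /simplex_boundary !big_ord_recl big_ord0 addr0 expr0 scale1r.
rewrite expr1 scaleN1r sqrrN expr1n scale1r addrA.
congr (_ - << _ >> + << _ >>); apply/continuousEP => z /=; congr (s (face _ _)); apply: val_inj => //=.
by rewrite inordK.
Qed.

(** The variation of the argument of [phi] along a path, measured by any of
    its lifts. *)
Definition variation (phi : X -> circle R) (s : singular_simplex R X 1) : R :=
  let theta := xget (fun=> 0) [set theta | is_lift (phi \o s) theta] in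
  theta vertex1 - theta vertex0.

Lemma comp_simplex_continuous n (phi : X -> circle R) (s : singular_simplex R X n) :
  continuous phi -> continuous (phi \o s).
Proof. by move=> cp z; apply: continuous_comp; [exact: cts_fun|exact: cp]. Qed.

Lemma variationE phi (s : singular_simplex R X 1) theta : is_lift (phi \o s) theta ->
  variation phi s = theta vertex1 - theta vertex0.
Proof.
move=> lt; rewrite /variation; case: xgetP => [t _ lt'|/(_ theta)//].
exact: lift_unique lt' lt.
Qed.

Definition degree (phi : X -> circle R) (c : chain R X 1) : R :=
  free_sum (variation phi) c.

Lemma degreeB phi : zmod_morphism (degree phi).
Proof. exact: free_sumB. Qed.

Lemma degree1 phi s : degree phi << s >> = variation phi s.
Proof. exact: free_sum1. Qed.

Lemma boundaryB n : zmod_morphism (@boundary R X n).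
Proof. exact: boundary_is_additive. Qed.

(** On a 2-simplex [phi] has a single lift, whose variations along the three
    edges cancel. *)
Lemma degree_boundary phi (c : chain R X 2) : continuous phi -> degree phi (boundary c) = 0.
Proof.
move=> cp.
apply: (@free_additive_eq _ _ (fun c => degree phi (boundary (c : chain R X 2))) (fun=> 0)).
- by move=> a b; rewrite boundaryB degreeB.
- by move=> a b; rewrite subrr.
move=> s; have [theta [ct tP]] := lift_exists (@comp_simplex_continuous _ phi s cp).
have lf i : is_lift (phi \o (s \o @face R 1 i)) (theta \o @face R 1 i).
  split=> [z|z w]; last exact: tP.
  by apply: continuous_comp; [exact: continuous_face|exact: ct].
rewrite boundary2 (zmod_morphD (degreeB phi)) degreeB !degree1 !(variationE (lf _)) /=.
by have [-> -> ->] := triangle_vertices; ring.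
Qed.

(** The exponential of the degree telescopes to the values of [phi] at the end
    points; on cycles the degree is therefore a multiple of [2 pi]. *)
Lemma degree_lift phi c : continuous phi ->
  cexp (degree phi c) = free_sum (fun s : singular_simplex R X 0 => phi (s origin)) (boundary c).
Proof.
move=> cp; move: c.
apply: (@free_additive_eq _ _ (fun c => cexp (degree phi c))
  (fun c => free_sum (fun s : singular_simplex R X 0 => phi (s origin)) (boundary (c : chain R X 1)))).
- by move=> a b; rewrite degreeB cexpB.
- by move=> a b; rewrite boundaryB free_sumB.
move=> s; have [theta lt] := lift_exists (@comp_simplex_continuous _ phi s cp).
rewrite degree1 (variationE lt) boundary1 free_sumB !free_sum1/=.
by case: lt => _ /(_ vertex1 vertex0) <-.
Qed.

Lemma degreeD phi psi c : continuous phi -> continuous psi ->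
  degree (fun x => phi x + psi x) c = degree phi c + degree psi c.
Proof.
move=> cp cq; move: c; apply: free_additive_eq.
- exact: degreeB.
- by move=> a b; rewrite !degreeB opprD addrACA.
move=> s; have [t [ct tP]] := lift_exists (@comp_simplex_continuous _ phi s cp).
have [u [cu uP]] := lift_exists (@comp_simplex_continuous _ psi s cq).
rewrite !degree1 (variationE (conj ct tP)) (variationE (conj cu uP)).
rewrite (@variationE _ _ (fun z => t z + u z)); first by ring.
split; [exact: contD|move=> z w /=].
transitivity (cexp (t z - t w) + cexp (u z - u w)).
  by rewrite -tP -uP /= opprD addrACA.
by rewrite -cexpD; congr cexp; ring.
Qed.

(** Being in the same path component, expressed by chains: the relation is an
    equivalence for algebraic reasons, with no concatenation of paths, and is
    the one that zeroth homology sees. *)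
Definition homologous (x y : X) := exists d : chain R X 1,
  boundary d = point_chain x - point_chain y.

Lemma homologous_sym x y : homologous x y -> homologous y x.
Proof. by move=> [d dE]; exists (- d); rewrite (zmod_morphN (@boundaryB 0)) dE opprB. Qed.

Lemma homologous_trans x y z : homologous x y -> homologous y z -> homologous x z.
Proof.
by move=> [d dE] [e eE]; exists (d + e); rewrite (zmod_morphD (@boundaryB 0)) dE eE addrA subrK.
Qed.

Lemma homologous_simplex (s : singular_simplex R X 1) z : homologous (s z) (s vertex0).
Proof.
have cm : continuous (fun w : std_simplex R 1 => mix vertex0 z ((\val w) 0 1)).
  by apply: (@continuous_mix _ _ _ _ (fun=> z)); [exact: cst_continuous|exact: coord_simplex_continuous].
exists << (s \o mkcts cm : singular_simplex R X 1) >>.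
by rewrite boundary1 /= /mkcts vertex0E vertex1E /= mix0 mix1.
Qed.

Lemma homologous_eq (M : zmodType) (w : X -> M) x y :
  (forall s : singular_simplex R X 1, w (s vertex1) = w (s vertex0)) ->
  homologous x y -> w x = w y.
Proof.
move=> ws [d dE].
pose W (c : chain R X 0) := free_sum (fun s : singular_simplex R X 0 => w (s origin)) c.
suff : W (boundary d) = 0.
  by rewrite dE /W free_sumB !free_sum1 => /eqP; rewrite subr_eq0 => /eqP.
apply: (@free_additive_eq _ _ (fun d => W (boundary (d : chain R X 1))) (fun=> 0)).
- by move=> a b; rewrite boundaryB /W free_sumB.
- by move=> a b; rewrite subrr.
by move=> s; rewrite boundary1 /W free_sumB !free_sum1 /= ws subrr.
Qed.

Lemma path_simplex (V : set X) x y : path_connected R V -> V x -> V y ->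
  exists s : singular_simplex R X 1, [/\ s vertex0 = x, s vertex1 = y & forall z, V (s z)].
Proof.
move=> [_ pV] Vx Vy; have [p [cp p0 p1 pim]] := pV x y Vx Vy.
have c1 z : `[0, 1]%classic ((\val (z : std_simplex R 1)) 0 1).
  by rewrite /= in_itv/= simplex_ge0 simplex_le1.
have cs : continuous (fun z : std_simplex R 1 => p ((\val z) 0 1)).
  pose I01 := `[0, 1]%classic : set R.
  pose q (z : std_simplex R 1) : I01 := @exist _ _ ((\val z) 0 1) (mem_set (c1 z)).
  have cq : continuous q.
    apply: (@continuous_comp_initial _ _ _ (set_val : I01 -> R)).
    exact: coord_simplex_continuous.
  move/subspace_sigL_continuousP: cp => cp z.
  by apply: (@continuous_comp _ _ _ q (sigL I01 p)); [exact: cq|exact: cp].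
exists (mkcts cs); split; rewrite /mkcts.
- by rewrite -[LHS]/(p ((\val vertex0) 0 1)) vertex0E.
- by rewrite -[LHS]/(p ((\val vertex1) 0 1)) vertex1E.
- by move=> z; apply: pim; exists ((\val z) 0 1).
Qed.

End Chains.

(** * Components, winding numbers and logarithms *)

Lemma homologous_push (R : realType) (X Y : topologicalType) (h : X -> Y) (x y : X) :
  continuous h -> homologous R x y -> homologous R (h x) (h y).
Proof.
move=> ch [d dE].
pose push (c : chain R X 1) : chain R Y 1 :=
  free_sum (fun s : singular_simplex R X 1 => << (mkcts ch \o s : singular_simplex R Y 1) >>) c.
pose P (c : chain R X 0) : chain R Y 0 :=
  free_sum (fun s : singular_simplex R X 0 => point_chain R (h (s (origin R)))) c.
exists (push d); have -> : boundary (push d) = P (boundary d).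
  apply: (@free_additive_eq _ _ (fun d => boundary (push (d : chain R X 1)))
    (fun d => P (boundary (d : chain R X 1)))).
  - by move=> a b; rewrite /push free_sumB boundaryB.
  - by move=> a b; rewrite boundaryB /P free_sumB.
  by move=> s; rewrite /push free_sum1 !boundary1 /P free_sumB !free_sum1.
by rewrite dE /P free_sumB !free_sum1.
Qed.

Lemma finite_representatives (T : eqType) (E : T -> T -> Prop) (s : seq T) :
  exists t : seq T, (forall x, x \in s -> exists2 y, y \in t & E x y \/ x = y) /\
    forall x0 i j, (i < size t)%N -> (j < size t)%N ->
      E (nth x0 t i) (nth x0 t j) -> E (nth x0 t j) (nth x0 t i) -> i = j.
Proof.
elim: s => [|x s [t [ts tE]]]; first by exists [::].
have [[y yt xy]|nxy] := pselect (exists2 y, y \in t & E x y).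
  exists t; split=> // z; rewrite inE => /predU1P[->|/ts//].
  by exists y => //; left.
exists (x :: t); split=> [z|x0 [|i] [|j]//=].
- rewrite inE => /predU1P[->|/ts[y yt zy]]; first by exists x; [exact: mem_head|right].
  by exists y => //; rewrite inE yt orbT.
- by move=> _ jt H _; exfalso; apply: nxy; exists (nth x0 t j) => //; exact: mem_nth.
- by move=> it _ _ H; exfalso; apply: nxy; exists (nth x0 t i) => //; exact: mem_nth.
- by rewrite !ltnS => it jt H1 H2; congr _.+1; exact: tE H1 H2.
Qed.

Section HomologyClass.
Variables (R : realType) (X : topologicalType) (n : nat).
Local Open Scope quotient_scope.

Definition hclass (z : Defs.cycle R X n) : homology R X n :=
  \pi_(Quotient.quot (@is_boundary R X n)) z.

Lemma hclassB : zmod_morphism hclass.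
Proof. exact: (raddfB \pi_(Quotient.quot (@is_boundary R X n))). Qed.

Lemma hclass_ind (P : homology R X n -> Prop) : (forall z, P (hclass z)) -> forall h, P h.
Proof. by move=> H h; elim/quotW: h => z; exact: H. Qed.

Lemma hclass_eq0 z : hclass z = 0 <-> exists d, \val z = boundary d.
Proof.
have -> : 0 = hclass 0 by rewrite (zmod_morph0 hclassB).
split=> [/eqP|H].
  by rewrite -Quotient.idealrBE subr0 unfold_in /= => /asboolP.
by apply/eqP; rewrite -Quotient.idealrBE subr0 unfold_in /=; apply/asboolP.
Qed.

Lemma hclass_lift (M : zmodType) (D : chain R X n -> M) :
  zmod_morphism D -> (forall d, D (boundary d) = 0) ->
  exists D' : homology R X n -> M, zmod_morphism D' /\ forall z, D' (hclass z) = D (\val z).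
Proof.
move=> DB D0; pose D' (h : homology R X n) := D (\val (repr h)).
have D'E z : D' (hclass z) = D (\val z).
  have [d dE] : exists d, \val (repr (hclass z) - z) = boundary d.
    apply/hclass_eq0; rewrite hclassB; apply/eqP; rewrite subr_eq0; apply/eqP; exact: reprK.
  apply/eqP; rewrite -subr_eq0 -DB; apply/eqP; rewrite -[RHS](D0 d); congr D.
  by rewrite -dE raddfB.
exists D'; split=> // a b; elim/hclass_ind: a => a; elim/hclass_ind: b => b.
by rewrite -hclassB !D'E raddfB DB.
Qed.

End HomologyClass.

Section Components.
Variables (R : realType) (K : topologicalType).
Hypothesis cptK : compact [set: K].
Hypothesis lpcK : locally_path_connected R K.

Lemma homologous_near (x : K) : \forall y \near x, homologous R y x.
Proof.
have [V [oV Vx _ pV]] := lpcK (filterT : nbhs x setT).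
have : nbhs x V by exact: open_nbhs_nbhs.
apply: filterS => y Vy; have [s [s0 s1 _]] := path_simplex pV Vx Vy.
by rewrite -s1 -s0; exact: homologous_simplex.
Qed.

(** By local path-connectedness the classes of [homologous] are open, so
    finitely many of them cover. *)
Lemma components_finite : exists n (cls : K -> 'I_n) (p : 'I_n -> K),
  (forall i, cls (p i) = i) /\ forall x y, cls x = cls y <-> homologous R x y.
Proof.
have [s sP] := compact_nbhs_cover cptK homologous_near.
have [t [ts tE]] := finite_representatives (homologous R (X := K)) s.
have ex y : exists i : 'I_(size t), homologous R y (tnth (in_tuple t) i).
  have [x xs yx] := sP y; have [z zt xz] := ts x xs.
  have it : (index z t < size t)%N by rewrite index_mem.
  exists (Ordinal it); rewrite (tnth_nth z)/= nth_index//.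
  by case: xz => [xz|<-//]; exact: homologous_trans yx xz.
pose cls y := projT1 (cid (ex y)).
have clsP y : homologous R y (tnth (in_tuple t) (cls y)) := projT2 (cid (ex y)).
have inj i j : homologous R (tnth (in_tuple t) i) (tnth (in_tuple t) j) -> i = j.
  move=> ij; apply: val_inj; move: ij; set x0 := tnth _ i.
  rewrite /x0 !(tnth_nth x0)/= => ij.
  by apply: (tE x0) => //; exact: homologous_sym.
exists (size t), cls, (tnth (in_tuple t)); split=> [i|x y].
  by apply/esym/inj; exact: clsP.
split=> [xy|xy].
  by apply: homologous_trans (clsP x) _; rewrite xy; apply: homologous_sym; exact: clsP.
apply: inj; apply: homologous_trans (clsP y).
by apply: homologous_trans xy; apply: homologous_sym; exact: clsP.
Qed.

Variables (n : nat) (cls : K -> 'I_n) (p : 'I_n -> K).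
Hypothesis clsp : forall i, cls (p i) = i.
Hypothesis clsE : forall x y, cls x = cls y <-> homologous R x y.

Lemma cls_near x : \forall y \near x, cls y = cls x.
Proof. by apply: filterS (homologous_near x) => y /clsE. Qed.

Lemma betti0_components : betti R K 0 = n.
Proof.
have dimn : betti_spec R K 0 n.
  have cy0 (c : chain R K 0) : c \in @is_cycle R K 0 by [].
  pose cyc c : Defs.cycle R K 0 := Sub c (cy0 c).
  pose w0 i (c : chain R K 0) : int :=
    free_sum (fun s : singular_simplex R K 0 => (cls (s (origin R)) == i)%:R) c.
  have wB i : zmod_morphism (w0 i) by exact: free_sumB.
  have w0b i d : w0 i (boundary d) = 0.
    apply: (@free_additive_eq _ _ (fun d => w0 i (boundary (d : chain R K 1))) (fun=> 0)).
    - by move=> a b; rewrite boundaryB wB.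
    - by move=> a b; rewrite subrr.
    move=> s; rewrite boundary1 wB /w0 !free_sum1/=.
    have -> : cls (s (vertex1 R)) = cls (s (vertex0 R)); last by rewrite subrr.
    by apply/clsE; exact: homologous_simplex.
  pose w i := projT1 (cid (hclass_lift (wB i) (w0b i))).
  have wP i : zmod_morphism (w i) /\ forall z, w i (hclass z) = w0 i (\val z) :=
    projT2 (cid (hclass_lift (wB i) (w0b i))).
  apply: (@has_dim_coordinates _ n (fun i => hclass (cyc (point_chain R (p i)))) w).
  - by move=> i; case: (wP i).
  - by move=> i j; rewrite (wP i).2 /w0 /= free_sum1/= clsp eq_sym.
  have gen (c : chain R K 0) : exists (k : 'I_n -> int) (d : chain R K 1),
      c = \sum_i point_chain R (p i) *~ k i + boundary d.
    elim/freeg_ind: c => [|q s c [k [d cE]]].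
      exists (fun=> 0), 0; rewrite (zmod_morph0 (@boundaryB R K 0)) addr0.
      by rewrite big1// => i _; rewrite mulr0z.
    have [e eE] : homologous R (s (origin R)) (p (cls (s (origin R)))) by apply/clsE; rewrite clsp.
    exists (fun i => q * (i == cls (s (origin R)))%:R + k i), (e *~ q + d).
    have -> : q *: << s >> = point_chain R (s (origin R)) *~ q :> chain R K 0.
      by rewrite -scaler_int intz /point_chain -point_simplexE.
    rewrite (zmod_morphD (@boundaryB R K 0)) (zmod_morphMz (@boundaryB R K 0)) eE cE.
    have sumE (m : int) j : \sum_i point_chain R (p i) *~ (m * (i == j)%:R + k i) =
        point_chain R (p j) *~ m + \sum_i point_chain R (p i) *~ k i.
      under eq_bigr do rewrite mulrzDr.
      rewrite big_split/= (bigD1 j)//= eqxx mulr1 [X in _ + X + _]big1 ?addr0//.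
      by move=> i ij; rewrite (negbTE ij) mulr0 mulr0z.
    rewrite sumE.
    by rewrite mulrzBl addrACA subrKC.
  move=> a; elim/hclass_ind: a => z; have [k [d zE]] := gen (\val z).
  exists k; apply/eqP; rewrite -subr_eq0.
  have HM := zmod_morphMz (@hclassB R K 0).
  under eq_bigr do rewrite -HM.
  rewrite -(zmod_morph_sum (@hclassB R K 0)) -hclassB; apply/eqP/hclass_eq0; exists d.
  have vB : zmod_morphism (\val : Defs.cycle R K 0 -> chain R K 0).
    by move=> x y; exact: raddfB.
  rewrite vB (zmod_morph_sum vB); under eq_bigr do rewrite (zmod_morphMz vB).
  by rewrite zE [X in X - _]addrC addrK.
rewrite /betti; case: xgetP => [k _ dimk|/(_ n)//].
exact: has_dim_unique dimk dimn.
Qed.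

(** The degree of [phi] kills boundaries and is a multiple of [2 pi] on
    cycles. *)
Lemma winding_exists (phi : K -> circle R) : continuous phi ->
  exists D : homology R K 1 -> int, zmod_morphism D /\
    forall z : Defs.cycle R K 1, degree phi (\val z) = (pi *+ 2) * (D (hclass z))%:~R.
Proof.
move=> cp; have [D [DB DE]] := hclass_lift (@degreeB R K phi) (fun d => degree_boundary d cp).
have p2 : pi *+ 2 != 0 :> R by rewrite mulrn_eq0/= gt_eqF// pi_gt0.
have Dint h : exists k : int, D h = (pi *+ 2) * k%:~R.
  elim/hclass_ind: h => z; rewrite DE; apply: cexp_eq0.
  rewrite degree_lift//; have /eqP -> : boundary (\val z) == 0 by exact: valP z.
  by rewrite (zmod_morph0 (free_sumB _)).
pose W h := projT1 (cid (Dint h)).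
have WE h : D h = (pi *+ 2) * (W h)%:~R := projT2 (cid (Dint h)).
exists W; split=> [a b|z]; last by rewrite -WE DE.
apply: (@intr_inj R); apply: (mulfI p2).
by rewrite -WE DB !WE rmorphB mulrBr.
Qed.

(** The logarithm at [x] is the degree of [phi] along a chain from the
    representative of the class of [x]; without winding the choice of the
    chain is immaterial. Near [x] it varies by the principal argument, because
    a neighbourhood where the argument is small contains paths that join [x]
    to the points nearby. *)
Lemma logarithm_exists (phi : K -> circle R) : continuous phi ->
  (forall z : Defs.cycle R K 1, degree phi (\val z) = 0) ->
  exists2 f : K -> R, continuous f &
    forall x y, cls x = cls y -> phi x - phi y = cexp (f x - f y).
Proof.
move=> cp deg0.
have deg0' (c : chain R K 1) : boundary c = 0 -> degree phi c = 0.
  move=> /eqP c0; exact: (deg0 (Sub c c0)).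
have ex x : homologous R x (p (cls x)) by apply/clsE; rewrite clsp.
pose d x := projT1 (cid (ex x)).
have dE x : boundary (d x) = point_chain R x - point_chain R (p (cls x)) := projT2 (cid (ex x)).
pose f x := degree phi (d x).
have fs (s : singular_simplex R K 1) :
    f (s (vertex1 R)) - f (s (vertex0 R)) = variation phi s.
  have cs : cls (s (vertex1 R)) = cls (s (vertex0 R)) by apply/clsE; exact: homologous_simplex.
  rewrite /f -degreeB -degree1; apply/eqP; rewrite -subr_eq0 -degreeB.
  apply/eqP/deg0'; rewrite !boundaryB boundary1 !dE cs.
  by rewrite opprB addrA subrK subrr.
exists f; last first.
  move=> x y xy; rewrite /f -degreeB degree_lift// boundaryB !dE xy.
  by rewrite opprB addrA subrK free_sumB !free_sum1.
move=> x; apply/cvgrPdist_lt => e e0.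
pose psi y := phi y - phi x.
have cpsi : continuous psi by apply: cont_circleB => //; exact: cst_continuous.
have psix : psi x = 0 by rewrite /psi subrr.
(* Near [x] the principal argument of [psi] is itself a lift, small by
   continuity. *)
have N1 : \forall y \near x, 0 < cre (psi y).
  by apply: (cvgr_gt _ (@cont_cre _ _ _ cpsi x)); rewrite psix cre0 ltr01.
have N2 : \forall y \near x, `|parg (psi y)| < e.
  have cx : {for x, continuous (@parg R \o psi)}.
    by apply: continuous_comp; [exact: cpsi|apply: continuous_parg; rewrite psix cre0 ltr01].
  have /cvgrPdist_lt/(_ e e0) := cx; apply: filterS => y /=.
  by rewrite psix parg0 sub0r normrN.
have [V [oV Vx VU pV]] := lpcK (filterI N1 N2).
have : nbhs x V by exact: open_nbhs_nbhs.
apply: filterS => y Vy; have [s [s0 s1 sV]] := path_simplex pV Vx Vy.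
rewrite distrC -s1 -[in X in _ - X]s0 fs (@variationE _ _ _ _ (fun z => parg (psi (s z)))).
  rewrite s0 s1 psix parg0 subr0; by have [] := VU y Vy.
have pos z : 0 < cre (psi (s z)) by have [] := VU _ (sV z).
split=> [z|z w].
  apply: (@continuous_comp _ _ _ (psi \o s) (@parg R)); last by apply: continuous_parg; exact: pos.
  by apply: continuous_comp; [exact: cts_fun|exact: cpsi].
by rewrite cexpB !cexp_parg// /psi /= opprB addrA subrK.
Qed.

End Components.

(** * The characters of a factor and the first Betti number *)

Lemma cont_circle_sum (R : realType) (T : topologicalType) (I : Type) (r : seq I)
    (chi : I -> T -> circle R) (c : I -> int) :
  (forall i, continuous (chi i)) -> continuous (fun x => \sum_(i <- r) chi i x *~ c i).
Proof.
move=> cc; elim: r => [|i r IH].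
  by under eq_fun do rewrite big_nil; exact: cst_continuous.
under eq_fun do rewrite big_cons; apply: cont_circleD => //.
have cn k : continuous (fun x => chi i x *+ k).
  elim: k => [|k IHk]; first by under eq_fun do rewrite mulr0n; exact: cst_continuous.
  by under eq_fun do rewrite mulrS; exact: cont_circleD.
case: (c i) => k; first exact: cn.
by under eq_fun do rewrite NegzE mulrNz; apply: cont_circleN; exact: cn.
Qed.

Lemma degree_sum (R : realType) (X : topologicalType) (I : Type) (r : seq I)
    (chi : I -> X -> circle R) (c : I -> int) z :
  (forall i, continuous (chi i)) ->
  degree (fun x => \sum_(i <- r) chi i x *~ c i) z =
  \sum_(i <- r) (c i)%:~R * degree (chi i) z.
Proof.
move=> cc.
have d0 : degree (fun=> 0 : circle R) z = 0.
  have c0 : continuous (fun _ : X => 0 : circle R) by exact: cst_continuous.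
  have := degreeD z c0 c0; under eq_fun do rewrite addr0.
  by move=> /eqP; rewrite -subr_eq0 opprD addNKr oppr_eq0 => /eqP.
have dM i (k : int) : degree (fun x => chi i x *~ k) z = k%:~R * degree (chi i) z.
  have cn j : continuous (fun x => chi i x *+ j).
    by have := @cont_circle_sum R X 'I_1 (index_enum _) (fun=> chi i) (fun=> j%:Z) (fun=> cc i);
      under eq_fun do rewrite big_ord1.
  have dn j : degree (fun x => chi i x *+ j) z = j%:R * degree (chi i) z.
    elim: j => [|j IH]; first by under eq_fun do rewrite mulr0n; rewrite d0 mul0r.
    under eq_fun do rewrite mulrS.
    by rewrite degreeD// IH -natr1 mulrDl mul1r addrC.
  case: k => j; first by rewrite dn.
  have cN : continuous (fun x => - (chi i x *+ j.+1)) by exact: cont_circleN.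
  have := degreeD z cN (cn j.+1); under eq_fun do rewrite addNr.
  rewrite d0 dn => /esym/eqP; rewrite addr_eq0 => /eqP E.
  under eq_fun do rewrite NegzE mulrNz; rewrite E NegzE.
  by rewrite mulrNz mulNr.
elim: r => [|i r IH]; first by under eq_fun do rewrite big_nil; rewrite big_nil d0.
under eq_fun do rewrite big_cons.
rewrite degreeD ?big_cons ?dM ?IH//; last exact: cont_circle_sum.
have := @cont_circle_sum R X 'I_1 (index_enum _) (fun=> chi i) (fun=> c i) (fun=> cc i).
by under eq_fun do rewrite big_ord1.
Qed.

Section Characters.
Variables (R : realType) (G : topologicalZmodType) (L : topologicalType).
Variables (actL : G -> L -> L) (y0 : L).
Hypothesis flowL : is_flow actL.
Hypothesis minL : minimal_flow actL.

(** The eigenfunctions of the flow, normalised at the base point: they are the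
    characters of the compact group that [L] turns out to be, with identity
    [y0]. *)
Definition char (chi : L -> circle R) := [/\ continuous chi, chi y0 = 0 &
  forall g x, chi (actL g x) = chi (actL g y0) + chi x].

Definition torsion_char chi := char chi /\ exists2 k, (0 < k)%N & chi *+ k = 0.

Lemma fct_mulrn (chi : L -> circle R) k x : (chi *+ k) x = chi x *+ k.
Proof. by elim: k => [|k IH]; rewrite ?mulr0n// !mulrS -IH. Qed.

Lemma fct_mulrz (chi : L -> circle R) (k : int) x : (chi *~ k) x = chi x *~ k.
Proof.
case: k => k; first exact: fct_mulrn.
by rewrite NegzE !mulrNz -[LHS]/(- ((chi *+ k.+1) x)) fct_mulrn.
Qed.

Lemma char0 : char 0.
Proof.
split=> //; first exact: cst_continuous.
by move=> g x; rewrite addr0.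
Qed.

Lemma charB chi psi : char chi -> char psi -> char (chi - psi).
Proof.
move=> [cc c0 cE] [cp p0 pE]; split.
- exact: cont_circleB.
- by rewrite -[LHS]/(chi y0 - psi y0) c0 p0 subrr.
- move=> g x; rewrite -[LHS]/(chi (actL g x) - psi (actL g x)) cE pE.
  by rewrite opprD addrACA.
Qed.

Lemma charN chi : char chi -> char (- chi).
Proof. by move=> cc; rewrite -sub0r; apply: charB => //; exact: char0. Qed.

Lemma charD chi psi : char chi -> char psi -> char (chi + psi).
Proof. by move=> cc cp; rewrite -[psi]opprK; apply: charB => //; exact: charN. Qed.

Lemma charMn chi k : char chi -> char (chi *+ k).
Proof.
move=> cc; elim: k => [|k IH]; first by rewrite mulr0n; exact: char0.
by rewrite mulrS; exact: charD.
Qed.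

Lemma charMz chi (k : int) : char chi -> char (chi *~ k).
Proof.
by move=> cc; case: k => k; [exact: charMn|rewrite NegzE mulrNz; apply: charN; exact: charMn].
Qed.

Lemma char_sum (I : Type) (r : seq I) (chi : I -> L -> circle R) (c : I -> int) :
  (forall i, char (chi i)) -> char (\sum_(i <- r) chi i *~ c i).
Proof.
move=> cc; elim: r => [|i r IH]; first by rewrite big_nil; exact: char0.
by rewrite big_cons; apply: charD => //; exact: charMz.
Qed.

Lemma char_eigenvalueB chi g h : char chi ->
  chi (actL (g - h) y0) = chi (actL g y0) - chi (actL h y0).
Proof.
move=> [_ c0 cE]; have aD := flowD flowL; apply/eqP.
by rewrite eq_sym subr_eq -cE -aD subrK.
Qed.

Lemma char_eigenvalueMn chi g k : char chi ->
  chi (actL (g *+ k) y0) = chi (actL g y0) *+ k.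
Proof.
move=> [_ c0 cE]; elim: k => [|k IH]; first by rewrite !mulr0n (flow0 flowL).
by rewrite !mulrS (flowD flowL) cE IH.
Qed.

Lemma char_eq0 chi : char chi -> (forall g, chi (actL g y0) = 0) -> chi = 0.
Proof.
move=> [cc _ _] c0; apply/funext => x; apply: contrapT => cx.
pose O := (fun y => cre (chi y)) @^-1` [set t | t != 1].
have oO : open O.
  by apply: open_comp => [t _|]; [exact: cont_cre|exact: open_neq].
have Ox : O x by apply/eqP => /cre_eq1.
have [t [Ot [g _ gt]]] := minL y0 (ex_intro _ x Ox) oO.
by move: Ot; rewrite /O /= -gt c0 cre0 eqxx.
Qed.

Section Factor.
Variables (K : topologicalType) (act : G -> K -> K) (q : K -> L).
Hypothesis flowK : is_flow act.
Hypothesis cq : continuous q.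
Hypothesis qE : equivariant act actL q.
Variables (n : nat) (cls : K -> 'I_n) (p : 'I_n -> K).
Hypothesis clsp : forall i, cls (p i) = i.
Hypothesis clsE : forall x y, cls x = cls y <-> homologous R x y.

Lemma cls_act g x y : cls x = cls y -> cls (act g x) = cls (act g y).
Proof.
move=> /clsE xy; apply/clsE; apply: homologous_push xy.
exact: flow_act_continuous.
Qed.

(** Let [f] be a logarithm of [chi] on one component. For [g] in the
    stabiliser of the component the increment of [f] from [x] to [g x] is
    independent of [x], so it is multiplied by [k] when [g] is replaced by [g
    *+ k]; as [f] is bounded, it vanishes, and with it the eigenvalue of [g].
    Every element of the group has a multiple, by at most [n], in the
    stabiliser. *)
Lemma torsion_of_logarithm chi i (f : K -> R) : char chi -> continuous f ->
  (forall x y, cls x = i -> cls y = i -> chi (q x) - chi (q y) = cexp (f x - f y)) ->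
  chi *+ n`! = 0.
Proof.
move=> cchi cf logf; have [cc c0 cE] := cchi.
have aD := flowD flowK; have a0 := flow0 flowK; have aC := flow_act_continuous flowK.
pose x0 := p i; have x0i : cls x0 = i by exact: clsp.
have stab g : cls (act g x0) = i -> chi (actL g y0) = 0.
  move=> gi; pose h x := f (act g x) - f x.
  have gcls x : cls x = i -> cls (act g x) = i.
    by move=> xi; rewrite -gi; apply: cls_act; rewrite xi x0i.
  have ch : continuous h.
    move=> x; apply: cvgB; last exact: cf.
    by apply: (@continuous_comp _ _ _ (act g) f); [exact: aC|exact: cf].
  (* Along a path in the component the increment varies within a fibre of the
     covering. *)
  have hx x : cls x = i -> h x = h x0.
    move=> xi; pose w y := if cls y == i then h y else 0.
    suff : w x = w x0 by rewrite /w xi x0i eqxx.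
    apply: (@homologous_eq R); last by apply/clsE; rewrite xi x0i.
    move=> s.
    have sz z : cls (s z) = cls (s (vertex0 R)) by apply/clsE; exact: homologous_simplex.
    rewrite /w (sz (vertex1 R)); case: eqP => // si.
    have cs : continuous (fun t : R => h (s (mix (vertex0 R) (vertex1 R) t)) - h (s (vertex0 R))).
      move=> t; apply: cvgB; last exact: cvg_cst.
      apply: (@continuous_comp _ _ _ (fun t => s (mix (vertex0 R) (vertex1 R) t)) h); last exact: ch.
      apply: (@continuous_comp _ _ _ (fun t => mix (vertex0 R) (vertex1 R) t) s); last exact: cts_fun.
      by apply: (@continuous_mix _ _ _ _ (fun=> vertex1 R) id); [exact: cst_continuous|move=> u; exact: cvg_id].
    have := cexp_eq0_itv cs; rewrite mix0 mix1 subrr => H.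
    apply/eqP; rewrite -subr_eq0; apply/eqP/esym/H => t _.
    set z := mix _ _ t; have zi : cls (s z) = i by rewrite sz.
    have -> : h (s z) - h (s (vertex0 R)) =
      (f (act g (s z)) - f (act g (s (vertex0 R)))) - (f (s z) - f (s (vertex0 R))).
      by rewrite /h; ring.
    rewrite cexpB -(logf _ _ (gcls _ zi) (gcls _ si)) -(logf _ _ zi si) !qE.
    by rewrite (cE g (q (s z))) (cE g (q (s (vertex0 R)))) opprD addrACA subrr add0r subrr.
  (* The increments accumulate linearly, against the bound on [f]. *)
  have iter k : cls (act (g *+ k) x0) = i /\ f (act (g *+ k) x0) = f x0 + h x0 *+ k.
    elim: k => [|k [IH1 IH2]]; first by rewrite mulr0n a0 addr0.
    rewrite mulrS aD; split; first exact: gcls.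
    by have := hx _ IH1; rewrite {1}/h mulrS => /eqP; rewrite subr_eq => /eqP ->; rewrite IH2; ring.
  have [M M0 fM] := compact_bound (flow_compact flowK) cf.
  have h0 : h x0 = 0.
    apply/eqP; apply/negPn/negP => hn0.
    have hp : 0 < `|h x0| by rewrite normr_gt0.
    pose k := Num.bound (2 * M / `|h x0|).
    have : 2 * M / `|h x0| < k%:R by apply: archi_boundP; rewrite divr_ge0// mulr_ge0// ltW.
    rewrite ltr_pdivrMr// => Hk.
    have : 2 * M < `|h x0 *+ k| by rewrite normrMn -[X in _ < X]mulr_natl.
    have -> : h x0 *+ k = f (act (g *+ k) x0) - f x0 by rewrite (iter k).2 [f x0 + _]addrC addrK.
    rewrite ltNge => /negP; apply; apply: le_trans (ler_normB _ _) _.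
    by rewrite mulr_natl mulr2n lerD.
  have := logf (act g x0) x0 gi x0i; rewrite -/(h x0) h0 cexp0 qE cE.
  by rewrite addrK.
apply: char_eq0; first exact: charMn.
move=> g; rewrite fct_mulrn -char_eigenvalueMn//.
pose F (k : 'I_n.+1) := cls (act (g *+ k) x0).
(* Among the [n.+1] points [g *+ k] applied to [x0], two lie in the same
   component. *)
have [k [l [kl Fkl]]] : exists k l : 'I_n.+1, (k < l)%N /\ F k = F l.
  apply: contrapT => nex; have /leq_card : injective F; last by rewrite !card_ord ltnn.
  move=> k l Fkl; apply: val_inj; case: (ltngtP k l) => // kl; exfalso; apply: nex.
    by exists k, l.
  by exists l, k.
have gm : chi (actL (g *+ (l - k)) y0) = 0.
  apply: stab; rewrite mulrnBr ?(ltnW kl)// addrC aD -x0i.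
  rewrite -[in RHS](a0 x0) -(addNr (g *+ k)) [in RHS]aD.
  by apply/esym/cls_act.
have /dvdnP[c ->] : (l - k %| n`!)%N.
  by rewrite dvdn_fact// subn_gt0 kl/= (leq_trans (leq_subr _ _))// -ltnS.
by rewrite mulnC mulrnA char_eigenvalueMn// gm mul0rn.
Qed.

Hypothesis cptK : compact [set: K].
Hypothesis lpcK : locally_path_connected R K.

Lemma char_comp_continuous chi : char chi -> continuous (chi \o q).
Proof. by move=> [cc _ _] x; apply: continuous_comp; [exact: cq|exact: cc]. Qed.

Lemma char_degree_torsion chi : char chi ->
  (forall z : Defs.cycle R K 1, degree (chi \o q) (\val z) = 0) -> 'I_n ->
  chi *+ n`! = 0.
Proof.
move=> cc deg0 i.
have [f cf fP] := logarithm_exists lpcK clsp clsE (char_comp_continuous cc) deg0.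
by apply: (torsion_of_logarithm (i := i) cc cf) => x y xi yi; apply: fP; rewrite xi yi.
Qed.

Lemma degree_comp_sum (I : Type) (r : seq I) (chi : I -> L -> circle R) (c : I -> int) z :
  (forall i, char (chi i)) ->
  degree ((\sum_(i <- r) chi i *~ c i) \o q) z = \sum_(i <- r) (c i)%:~R * degree (chi i \o q) z.
Proof.
move=> cc; rewrite -degree_sum; last by move=> i; exact: char_comp_continuous.
congr degree; apply/funext => x /=; rewrite fct_sumE; apply: eq_bigr => i _.
exact: fct_mulrz.
Qed.

Lemma degree_compB chi psi z : char chi -> char psi ->
  degree ((chi - psi) \o q) z = degree (chi \o q) z - degree (psi \o q) z.
Proof.
move=> cc cp.
have := @degree_comp_sum bool [:: true; false] (fun b => if b then chi else psi)
   (fun b => if b then 1 else - 1) z (fun b => if b return char (if b then chi else psi) then cc else cp).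
rewrite !big_cons !big_nil /= !addr0 mulrNz mul1r mulN1r => <-.
by congr degree; rewrite mulr1z.
Qed.

(** A character without winding has a logarithm, hence finite order: up to
    torsion a character is determined by its winding numbers along finitely
    many homology classes. *)
Lemma character_basis (i0 : 'I_n) r : betti_spec R K 1 r ->
  exists m (b : 'I_m -> L -> circle R), [/\ forall j, char (b j),
    forall chi, char chi -> exists c : 'I_m -> int,
      torsion_char (chi - \sum_j b j *~ c j) &
    forall c : 'I_m -> int, torsion_char (\sum_j b j *~ c j) -> forall j, c j = 0].
Proof.
move=> dimr; have [a aP] := has_dim_detect dimr.
have p2 : pi *+ 2 != 0 :> R by rewrite mulrn_eq0/= gt_eqF// pi_gt0.
pose W (chi : L -> circle R) : homology R K 1 -> int :=
  if pselect (char chi) is left cc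
  then projT1 (cid (winding_exists (char_comp_continuous cc))) else fun=> 0.
have WP chi : char chi -> zmod_morphism (W chi) /\ forall z : Defs.cycle R K 1,
    degree (chi \o q) (\val z) = (pi *+ 2) * (W chi (hclass z))%:~R.
  move=> cc; rewrite /W; case: pselect => // cc'.
  exact: (projT2 (cid (winding_exists (char_comp_continuous cc')))).
have WB chi psi h : char chi -> char psi -> W (chi - psi) h = W chi h - W psi h.
  move=> cc cp; elim/hclass_ind: h => z; apply: (@intr_inj R); apply: (mulfI p2).
  rewrite rmorphB mulrBr -(WP _ cc).2 -(WP _ cp).2 -(WP _ (charB cc cp)).2.
  exact: degree_compB.
(* The winding numbers along the detecting classes, extended by zero to all
   indices and all functions. *)
pose phi (k : nat) chi := if insub k is Some i then W chi (a i) else 0.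
have [|||m [b [bc bgen bind]]] := @image_lattice_basis (L -> circle R) r char phi.
- exact: char0.
- exact: charB.
- move=> k chi psi cc cp; rewrite /phi; case: insub => [i|]; last by rewrite subrr.
  exact: WB.
have tors chi : char chi -> (forall i, (i < r)%N -> phi i chi = 0) -> torsion_char chi.
  move=> cc c0; split=> //; exists n`!; first exact: fact_gt0.
  apply: char_degree_torsion i0 => // z; rewrite (WP _ cc).2.
  suff -> : (W chi (hclass z))%:~R = 0 :> R by rewrite mulr0.
  have [WM _] := WP _ cc.
  have : (W chi (hclass z))%:~R = 0 :> rat.
    apply: (aP (fun h => (W chi h)%:~R)) => [x y|i]; first by rewrite WM rmorphB.
    by have := c0 i (ltn_ord i); rewrite /phi valK => ->.
  by move=> /eqP; rewrite intr_eq0 => /eqP ->.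
exists m, b; split=> // [chi cc|c [cc [k k0 kc]]].
  have [c cP] := bgen chi cc; exists c; apply: tors => //.
  by apply: charB => //; exact: char_sum.
apply: bind => i ir; rewrite /phi insubT /=.
set chi := \sum_j _ in cc kc *; set h := a _.
have W0 : W 0 h = 0 by rewrite -(subrr chi) WB// subrr.
have WN psi : char psi -> W (- psi) h = - W psi h.
  by move=> cp; rewrite -sub0r WB// ?W0 ?sub0r//; exact: char0.
have WM l : W (chi *+ l) h = W chi h *+ l.
  elim: l => [|l IH]; first by rewrite !mulr0n.
  rewrite !mulrS -IH -{1}[chi *+ l]opprK WB//; last by apply: charN; exact: charMn.
  by rewrite WN ?opprK//; exact: charMn.
have := WM k; rewrite kc W0 => /esym/eqP.
by rewrite mulrn_eq0 gtn_eqF//= => /eqP.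
Qed.

(** The basis characters restricted to a single component of [K], and extended
    by zero, have independent winding numbers, because a combination without
    winding would be torsion already by its logarithm on that component. There
    are [n * m] such restrictions. *)
Lemma character_rank m (b : 'I_m -> L -> circle R) r : betti_spec R K 1 r ->
  (forall j, char (b j)) ->
  (forall c : 'I_m -> int, torsion_char (\sum_j b j *~ c j) -> forall j, c j = 0) ->
  (n * m <= r)%N.
Proof.
move=> dimr bc bind.
have p2 : pi *+ 2 != 0 :> R by rewrite mulrn_eq0/= gt_eqF// pi_gt0.
(* The restriction of [b l.2] to the component [l.1]. *)
pose chi (l : 'I_n * 'I_m) x := if cls x == l.1 then b l.2 (q x) else 0.
have cchi l : continuous (chi l).
  move=> x; have H := cls_near lpcK clsE x.
  have [xl|xl] := eqVneq (cls x) l.1.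
    have cb := char_comp_continuous (bc l.2).
    have E : \forall y \near x, (b l.2 \o q) y = chi l y.
      by apply: filterS H => y yx; rewrite /chi yx xl eqxx.
    have Ex : chi l x = (b l.2 \o q) x by rewrite /chi xl eqxx.
    by rewrite /continuous_at Ex; apply: cvg_trans (cb x); exact: near_eq_cvg.
  have E : \forall y \near x, (fun=> 0) y = chi l y.
    by apply: filterS H => y yx; rewrite /chi yx (negbTE xl).
  have Ex : chi l x = 0 by rewrite /chi (negbTE xl).
  by rewrite /continuous_at Ex; apply: cvg_trans (@cvg_cst _ 0 _ (nbhs x) _); exact: near_eq_cvg.
pose W l := projT1 (cid (winding_exists (cchi l))).
have WP l : zmod_morphism (W l) /\ forall z : Defs.cycle R K 1,
    degree (chi l) (\val z) = (pi *+ 2) * (W l (hclass z))%:~R :=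
  projT2 (cid (winding_exists (cchi l))).
have -> : (n * m = #|{: 'I_n * 'I_m}|)%N by rewrite card_prod !card_ord.
apply: (@has_dim_independent _ r _ (fun l => W (enum_val l)) dimr).
  by move=> l; case: (WP (enum_val l)).
move=> c c0 l0; pose d (l : 'I_n * 'I_m) := c (enum_rank l).
suff dz l : d l = 0 by have := dz (enum_val l0); rewrite /d enum_valK.
have deg0 (z : Defs.cycle R K 1) : degree (fun x => \sum_l chi l x *~ d l) (\val z) = 0.
  rewrite degree_sum//.
  transitivity ((pi *+ 2) * (\sum_l d l * W l (hclass z))%:~R : R).
    rewrite rmorph_sum mulr_sumr; apply: eq_bigr => i _.
    by rewrite (WP i).2 rmorphM/=; ring.
  rewrite (reindex (@enum_val _ {: 'I_n * 'I_m})); last first.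
    by apply: onW_bij; exists enum_rank; [exact: enum_valK|exact: enum_rankK].
  under eq_bigr do rewrite /d enum_valK.
  by rewrite c0 mulr0.
have cphi : continuous (fun x => \sum_l chi l x *~ d l) by exact: cont_circle_sum.
have [f cf fP] := logarithm_exists lpcK clsp clsE cphi deg0.
case: l => i; suff : forall j, d (i, j) = 0 by [].
apply: bind; split; first exact: char_sum.
exists n`!; first exact: fact_gt0.
have restr x : cls x = i -> \sum_l chi l x *~ d l = (\sum_j b j *~ d (i, j)) (q x).
  move=> xi; rewrite fct_sumE.
  transitivity (\sum_i \sum_j chi (i, j) x *~ d (i, j)).
    by rewrite pair_bigA/=; apply: eq_bigr => -[].
  rewrite (bigD1 i)//= [X in _ + X]big1 ?addr0.
    by apply: eq_bigr => j _; rewrite /chi xi eqxx fct_mulrz.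
  by move=> k ki; rewrite big1// => j _; rewrite /chi xi eq_sym (negbTE ki) mul0rz.
apply: (torsion_of_logarithm (i := i) (char_sum _ _ bc) cf) => x y xi yi.
by rewrite -!restr//; apply: fP; rewrite xi yi.
Qed.

End Factor.
End Characters.

(** * Characters of finite order and the zeroth Betti number *)

Section FiniteQuotient.
Variables (G : zmodType) (P : {pred G}).
Hypothesis P0 : zmod_closed P.

HB.instance Definition _ := GRing.isZmodClosed.Build G P P0.

Local Open Scope quotient_scope.

Lemma finite_quotient n (f : G -> 'I_n) : (forall g h, f g = f h -> g - h \in P) ->
  exists (F : finZmodType) (q : G -> F), [/\ zmod_morphism q,
    forall a, exists g, q g = a, forall g h, q g = q h <-> g - h \in P & (#|F| <= n)%N].
Proof.
move=> fP; pose Q : zmodType := Quotient.quot P.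
pose pr : G -> Q := \pi_(Quotient.quot P).
have prE g h : pr g = pr h <-> g - h \in P.
  by rewrite Quotient.idealrBE; split=> [E|/eqP//]; apply/eqP.
have prB : zmod_morphism pr by move=> g h; exact: (raddfB \pi_(Quotient.quot P)).
have prS a : exists g, pr g = a by exists (repr a); exact: reprK.
have [s sK] := choice prS.
pose F0 (u : Q) := f (s u).
have F0I : injective F0 by move=> u v /fP /prE; rewrite !sK.
pose F1 (i : 'I_n) : option Q := if pselect (exists u, F0 u = i) is left H then Some (projT1 (cid H)) else None.
have F0K : pcancel F0 F1.
  move=> u; rewrite /F1; case: pselect => [H|[]]; last by exists u.
  by congr Some; apply: F0I; case: cid.
pose cQ := PCanIsCountable F0K.
pose QC : countType := HB.pack Q cQ.
pose fQ := @PCanIsFinite QC _ F0 F1 F0K.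
pose F : finZmodType := HB.pack Q cQ fQ.
exists F, pr; split=> //.
by rewrite -[leqRHS]card_ord; exact: (@leq_card F _ F0 F0I).
Qed.
End FiniteQuotient.

Section TorsionClasses.
Variables (R : realType) (G : topologicalZmodType) (L : topologicalType).
Variables (actL : G -> L -> L) (y0 : L).
Hypothesis flowL : is_flow actL.
Hypothesis minL : minimal_flow actL.

Local Notation torsion := (@torsion_char R G L actL y0).

(** The classes are the cosets of the annihilator of the characters of finite
    order: in the end, the connected components of [L]. *)
Definition torsion_equiv (x y : L) := forall tau, torsion tau -> tau x = tau y.

Lemma torsion_equiv_sym x y : torsion_equiv x y -> torsion_equiv y x.
Proof. by move=> xy tau tt; rewrite xy. Qed.

Lemma torsion_equiv_trans y x z : torsion_equiv x y -> torsion_equiv y z -> torsion_equiv x z.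
Proof. by move=> xy yz tau tt; rewrite xy// yz. Qed.

Lemma torsion_equiv_actB g h :
  torsion_equiv (actL g y0) (actL h y0) <-> torsion_equiv (actL (g - h) y0) y0.
Proof.
split=> E tau tt; have [tc _] := tt; have [_ t0 _] := tc.
  by rewrite (char_eigenvalueB flowL)// E// subrr t0.
by apply/eqP; rewrite -subr_eq0 -(char_eigenvalueB flowL)// E// t0.
Qed.

Lemma torsion_equiv_act g x y : torsion_equiv x y -> torsion_equiv (actL g x) (actL g y).
Proof.
by move=> xy tau tt; have [[_ _ tE] _] := tt; rewrite (tE g x) (tE g y) xy.
Qed.

Definition torsion_stabilizer : {pred G} := [pred g | `[< torsion_equiv (actL g y0) y0 >]].

Lemma torsion_stabilizer_zmod_closed : zmod_closed torsion_stabilizer.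
Proof.
split=> [|g h]; rewrite !unfold_in /=.
  by apply/asboolP; rewrite (flow0 flowL).
move=> /asboolP gP /asboolP hP; apply/asboolP/torsion_equiv_actB.
by apply: torsion_equiv_trans gP _; exact: torsion_equiv_sym.
Qed.

Section Factor.
Variables (K : topologicalType) (act : G -> K -> K) (q : K -> L).
Hypothesis cq : continuous q.
Hypothesis surj_q : forall y, exists x, q x = y.
Variables (n : nat) (cls : K -> 'I_n) (p : 'I_n -> K).
Hypothesis clsp : forall i, cls (p i) = i.
Hypothesis clsE : forall x y, cls x = cls y <-> homologous R x y.

(** A character of finite order lifts along a path to a real function that
    takes values in a discrete set. *)
Lemma cls_torsion_equiv x y : cls x = cls y -> torsion_equiv (q x) (q y).
Proof.
move=> /clsE xy tau [tc [k k0 tk]].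
apply: (homologous_eq (w := tau \o q)) xy => s.
have cc := char_comp_continuous cq tc.
have cs : continuous (fun z => (tau \o q) (s z)).
  by move=> z; apply: (@continuous_comp _ _ _ s (tau \o q)); [exact: cts_fun|exact: cc].
have [th [cth thP]] := lift_exists cs.
pose v0 := vertex0 R; pose v1 := vertex1 R.
(* Multiplied by the order of [tau], the lift stays in the fibre over zero. *)
have cf : continuous (fun t : R => k%:R * (th (mix v0 v1 t) - th v0)).
  apply: contZ; apply: contB; last exact: cst_continuous.
  move=> t; apply: (@continuous_comp _ _ _ (fun t => mix v0 v1 t) th); last exact: cth.
  by apply: (@continuous_mix _ _ _ _ (fun=> v1) id); [exact: cst_continuous|move=> u; exact: cvg_id].
have cexpMn (t : R) j : cexp (j%:R * t) = cexp t *+ j.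
  by elim: j => [|j IH]; rewrite ?mul0r ?cexp0// -natr1 mulrDl mul1r cexpD IH mulrSr.
have tauk z : tau z *+ k = 0 by rewrite -fct_mulrn tk.
have := cexp_eq0_itv cf; rewrite mix0 mix1 subrr mulr0 => H.
have /esym/eqP : 0 = k%:R * (th v1 - th v0).
  by apply: H => t _; rewrite cexpMn -thP mulrnBl !tauk subrr.
rewrite mulf_eq0 pnatr_eq0 gtn_eqF//= => /eqP E.
by apply/eqP; rewrite -subr_eq0; have := thP v1 v0; rewrite E cexp0 => /= ->.
Qed.

(** Finitely many closed classes are open. By minimality each of them meets
    the orbit of [y0], so that they correspond to the cosets of the stabiliser
    of one of them in the group. *)
Lemma torsion_classes : exists (F : finZmodType) (qG : G -> F) (cl : L -> F),
  [/\ [/\ (#|F| <= n)%N, zmod_morphism qG & forall a, exists g, qG g = a],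
      [/\ forall x y, cl x = cl y <-> torsion_equiv x y, cl y0 = 0 &
          forall g x, cl (actL g x) = qG g + cl x] &
      forall x, \forall z \near x, cl z = cl x].
Proof.
have near : forall x, \forall z \near x, torsion_equiv z x.
  move=> x.
  have : \forall z \near x, forall i : 'I_n, torsion_equiv z (q (p i)) -> torsion_equiv (q (p i)) x.
    apply: (@filter_forall _ _ _ (nbhs x)) => i.
    have [E|] := pselect (torsion_equiv (q (p i)) x); first by apply: filterE.
    move=> /existsNP[tau /not_implyP[tt ne]].
    have cc : continuous (fun z => cre (tau z - tau (q (p i)))).
      by apply: cont_cre; apply: cont_circleB; [by case: tt => -[]|exact: cst_continuous].
    have : \forall z \near x, cre (tau z - tau (q (p i))) != 1.
      pose O := (fun z => cre (tau z - tau (q (p i)))) @^-1` [set t | t != 1].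
      apply: (@open_nbhs_nbhs _ x O); split.
        by apply: open_comp => [t _|]; [exact: cc|exact: open_neq].
      by apply/eqP => /cre_eq1/eqP; rewrite subr_eq0 => /eqP E; apply: ne.
    by apply: filterS => z + zi; rewrite zi// subrr cre0 eqxx.
  apply: filterS => z H; have [k kz] := surj_q z.
  have zi : torsion_equiv z (q (p (cls k))).
    by rewrite -kz; apply: cls_torsion_equiv; rewrite clsp.
  exact: torsion_equiv_trans zi (H _ zi).
have orb x : exists g, torsion_equiv (actL g y0) x.
  have [U [oU Ux] UP] : exists2 U, open_nbhs x U & U `<=` [set z | torsion_equiv z x].
    by have : nbhs x [set z | torsion_equiv z x]; [exact: near|rewrite nbhsE].
  have [z [/UP Uz [g _ gz]]] := minL y0 (ex_intro _ x Ux) oU.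
  by exists g; move: Uz; rewrite /= gz.
have [s sP] := choice (fun g => surj_q (actL g y0)).
have [F [qG [qB qS qE Fn]]] : exists (F : finZmodType) (qG : G -> F),
    [/\ zmod_morphism qG, forall a, exists g, qG g = a,
      forall g h, qG g = qG h <-> g - h \in torsion_stabilizer & (#|F| <= n)%N].
  apply: (finite_quotient torsion_stabilizer_zmod_closed (f := cls \o s)) => g h /= E.
  rewrite unfold_in /=; apply/asboolP/torsion_equiv_actB.
  by rewrite -!sP; exact: cls_torsion_equiv.
have qP g h : qG g = qG h <-> torsion_equiv (actL g y0) (actL h y0).
  by rewrite qE unfold_in /=; split=> [/asboolP/torsion_equiv_actB//|E]; apply/asboolP/torsion_equiv_actB.
have [t tP] := choice orb.
exists F, qG, (qG \o t); split=> //=.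
- split=> [x y||g x].
  + rewrite qP; split=> E.
      by apply: torsion_equiv_trans (torsion_equiv_trans E (tP y)); exact: torsion_equiv_sym.
    by apply: torsion_equiv_trans (torsion_equiv_trans E (torsion_equiv_sym (tP y))).
  + by rewrite -(zmod_morph0 qB); apply/qP; rewrite (flow0 flowL).
  + rewrite -(zmod_morphD qB); apply/qP; rewrite (flowD flowL).
    apply: torsion_equiv_trans (tP _) _; apply/torsion_equiv_act/torsion_equiv_sym; exact: tP.
- move=> x; apply: filterS (near x) => z zx; apply/qP.
  by apply: torsion_equiv_trans (torsion_equiv_trans zx (torsion_equiv_sym (tP x))).
Qed.

End Factor.
End TorsionClasses.

(** * Equidistribution in the torus *)

Section Coordinates.
Variables (R : realType) (G : topologicalZmodType) (L : topologicalType).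
Variables (actL : G -> L -> L) (y0 : L).
Hypothesis flowL : is_flow actL.
Hypothesis minL : minimal_flow actL.
Hypothesis equi : forall u : L -> R, continuous u -> forall x (e : R), 0 < e ->
  \forall y \near x, forall g, `|u (actL g x) - u (actL g y)| < e.

Variables (F : finZmodType) (qG : G -> F) (cl : L -> F).
Hypothesis qB : zmod_morphism qG.
Hypothesis qS : forall a, exists g, qG g = a.
Hypothesis cl0 : cl y0 = 0.
Hypothesis clE : forall g x, cl (actL g x) = qG g + cl x.
Hypothesis cl_near : forall x, \forall z \near x, cl z = cl x.

Local Notation char := (@char R G L actL y0).
Local Notation torsion_char := (@torsion_char R G L actL y0).
Local Notation mean := (@mean R G L actL).

Let cpt := flow_compact flowL.
Let aD := flowD flowL.
Let aC := flow_act_continuous flowL.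
Let mZ := @meanZ R G L actL cpt aD aC minL equi y0.
Let mD := @meanD R G L actL cpt aD aC minL equi y0.

Lemma fin_zmod_mulrn_card (A : finZmodType) (a : A) : a *+ #|A| = 0.
Proof.
apply: (@addrI _ (\sum_(x : A) x)); rewrite addr0 [RHS](reindex_inj (addrI a)).
by rewrite big_split /= sumr_const addrC.
Qed.

Definition indicator a x : R := (cl x == a)%:R.

Lemma indicator_continuous a : continuous (indicator a).
Proof.
move=> x; have E : \forall z \near x, (fun=> indicator a x) z = indicator a z.
  by apply: filterS (cl_near x) => z zx; rewrite /indicator zx.
by apply: cvg_trans (near_eq_cvg E) _; exact: cvg_cst.
Qed.

Lemma indicator_bound a x : 0 <= indicator a x <= 1.
Proof. by rewrite /indicator; case: eqP => _ /=; rewrite ?lexx ler01. Qed.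

Lemma mean_indicator_gt0 a : 0 < mean (indicator a).
Proof.
have [g ga] := qS a.
apply: (@mean_gt0 R G L actL cpt aD aC minL equi y0 _ (actL g y0)).
- exact: indicator_continuous.
- by move=> x; case/andP: (indicator_bound a x).
- by rewrite /indicator clE cl0 addr0 ga eqxx ltr01.
Qed.

(** Some element of the stabiliser of the class rotates the character:
    otherwise the eigenvalues would have finite order, hence so would the
    character. The vector of the two means, of the real and of the imaginary
    part, is then fixed by a nontrivial rotation of the plane. *)
Lemma mean_indicator_char (chi : L -> circle R) a s : char chi -> ~ torsion_char chi ->
  mean (fun x => indicator a x * cre (chi x + s)) = 0.
Proof.
move=> cc nt; have [cchi c0 cE] := cc.
have [g [g0 gchi]] : exists g, qG g = 0 /\ chi (actL g y0) != 0.
  apply: contrapT => ng; apply: nt; split=> //; exists #|F|.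
    by apply/card_gt0P; exists 0.
  apply: (char_eq0 minL (charMn _ cc)).
  move=> g; rewrite fct_mulrn -(char_eigenvalueMn flowL)//; apply: contrapT => /eqP gn.
  apply: ng; exists (g *+ #|F|); split=> //.
  by rewrite (zmod_morphMn qB) fin_zmod_mulrn_card.
pose A x := indicator a x * cre (chi x + s); pose B x := indicator a x * cim (chi x + s).
have cs : continuous (fun x => chi x + s) by apply: cont_circleD => //; exact: cst_continuous.
have cA : continuous A by apply: contM; [exact: indicator_continuous|exact: cont_cre].
have cB : continuous B by apply: contM; [exact: indicator_continuous|exact: cont_cim].
set u := chi (actL g y0) in gchi.
have mact := @mean_act R G L actL cpt aD aC minL equi y0 g.
have ind_act x : indicator a (actL g x) = indicator a x by rewrite /indicator clE g0 add0r.
(* Invariance of the mean under [g], which multiplies the character by [u]. *)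
have EA : mean A = cre u * mean A + - cim u * mean B.
  rewrite -[LHS]mact// -!mZ// -mD; [|exact: contZ..].
  by congr mean; apply/funext => x; rewrite /A /B ind_act cE -/u -addrA; set v := chi x + s; rewrite creD; ring.
have EB : mean B = cre u * mean B + cim u * mean A.
  rewrite -[LHS]mact// -!mZ// -mD; [|exact: contZ..].
  by congr mean; apply/funext => x; rewrite /A /B ind_act cE -/u -addrA; set v := chi x + s; rewrite cimD; ring.
have u1 : cre u < 1.
  by rewrite lt_neqAle cre_le1 andbT; apply: contra gchi => /eqP/cre_eq1/eqP.
have : ((1 - cre u) ^+ 2 + cim u ^+ 2) * mean A = 0.
  have E1 : (1 - cre u) * mean A = - cim u * mean B by lra.
  have E2 : (1 - cre u) * mean B = cim u * mean A by lra.
  by rewrite mulrDl expr2 -mulrA E1 mulrCA E2; ring.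
move=> /eqP; rewrite mulf_eq0 => /orP[|/eqP//].
by rewrite paddr_eq0 ?sqr_ge0// sqrf_eq0 => /andP[/eqP H _]; move: u1; lra.
Qed.

Variables (m : nat) (b : 'I_m -> L -> circle R).
Hypothesis bc : forall j, char (b j).
Hypothesis bind : forall c : 'I_m -> int, torsion_char (\sum_j b j *~ c j) -> forall j, c j = 0.

Definition shifted_char (c : 'I_m -> int) (s : 'I_m -> circle R) x : circle R :=
  \sum_j (b j x + s j) *~ c j.

Lemma shifted_char_continuous c s : continuous (shifted_char c s).
Proof.
apply: cont_circle_sum => j; apply: cont_circleD; last exact: cst_continuous.
by case: (bc j).
Qed.

(** Trigonometric polynomials in the coordinates should have means over a
    class that are unaffected by translations of the torus. The factor [cre]
    of an arbitrary character makes the property stable under multiplication. *)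
Definition translation_invariant a (P : ('I_m -> circle R) -> L -> R) :=
  (forall s, continuous (P s)) /\ forall c tau s s',
    mean (fun x => indicator a x * (P s x * cre (shifted_char c s x + tau))) =
    mean (fun x => indicator a x * (P s' x * cre (shifted_char c s' x + tau))).

Lemma translation_invariant1 a : translation_invariant a (fun _ _ => 1).
Proof.
split=> [s|c tau s s']; first exact: cst_continuous.
have [/forallP c0|] := boolP [forall j, c j == 0].
  suff E s1 : shifted_char c s1 = fun=> 0 by rewrite !E.
  by apply/funext => x; apply: big1 => j _; rewrite (eqP (c0 j)) mulr0z.
rewrite negb_forall => /existsP[j cj].
suff H s1 : mean (fun x => indicator a x * (1 * cre (shifted_char c s1 x + tau))) = 0 by rewrite !H.
have E : (fun x => indicator a x * (1 * cre (shifted_char c s1 x + tau))) =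
    fun x => indicator a x * cre ((\sum_j b j *~ c j) x + (\sum_j s1 j *~ c j + tau)).
  apply/funext => x; rewrite mul1r addrA fct_sumE; congr (_ * cre (_ + _)).
  by rewrite -big_split; apply: eq_bigr => i _; rewrite mulrzDl fct_mulrz.
rewrite E; apply: mean_indicator_char; first exact: char_sum.
by move=> /bind/(_ j)/eqP; rewrite (negbTE cj).
Qed.

Lemma cre_mul (z w : circle R) : cre z * cre w = (cre (z + w) + cre (z - w)) / 2.
Proof. by rewrite !creD creN cimN; field. Qed.

(** The product of two cosines is a sum of two cosines. *)
Lemma translation_invariantM a P j : translation_invariant a P ->
  translation_invariant a (fun s x => P s x * ((1 + cre (b j x + s j)) / 2)).
Proof.
move=> [cP PE]; have bj s : continuous (fun x => b j x + s j).
  by apply: cont_circleD; [case: (bc j)|exact: cst_continuous].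
have cb s : continuous (fun x => (1 + cre (b j x + s j)) / 2).
  apply: contM; last exact: cst_continuous.
  by apply: contD; [exact: cst_continuous|exact: cont_cre].
split=> [s|c tau s s']; first exact: contM.
(* Multiplication by [cre] of the [j]-th coordinate shifts the [j]-th exponent
   by [1] and [-1]. *)
pose d (e : int) i := c i + e * (i == j)%:Z.
have dE (e : int) s1 x : shifted_char (d e) s1 x = shifted_char c s1 x + (b j x + s1 j) *~ e.
  rewrite /shifted_char /d; under eq_bigr do rewrite mulrzDr.
  rewrite big_split/=; congr (_ + _).
  rewrite (bigD1 j)//= eqxx mulr1 big1 ?addr0// => i ij.
  by rewrite (negbTE ij) mulr0 mulr0z.
have cI s1 c1 : continuous (fun x => indicator a x * (P s1 x * cre (shifted_char c1 s1 x + tau))).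
  apply: contM; first exact: indicator_continuous.
  apply: contM => //; apply: cont_cre; apply: cont_circleD; last exact: cst_continuous.
  exact: shifted_char_continuous.
have key s1 : mean (fun x => indicator a x *
    (P s1 x * ((1 + cre (b j x + s1 j)) / 2) * cre (shifted_char c s1 x + tau))) =
  2^-1 * mean (fun x => indicator a x * (P s1 x * cre (shifted_char c s1 x + tau))) +
  (4^-1 * mean (fun x => indicator a x * (P s1 x * cre (shifted_char (d 1) s1 x + tau))) +
   4^-1 * mean (fun x => indicator a x * (P s1 x * cre (shifted_char (d (-1)) s1 x + tau)))).
  rewrite -(mZ 2^-1 (cI s1 c)) -(mZ 4^-1 (cI s1 (d 1))) -(mZ 4^-1 (cI s1 (d (-1)))).
  have c1 := contZ (c := 4^-1) (cI s1 (d 1)); have c2 := contZ (c := 4^-1) (cI s1 (d (-1))).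
  rewrite -(mD c1 c2) -(mD (contZ (c := 2^-1) (cI s1 c)) (contD c1 c2)).
  congr mean; apply/funext => x; rewrite !dE mulr1z mulrN1z.
  set u := b j x + s1 j; set v := shifted_char c s1 x.
  have := cre_mul (v + tau) u; rewrite [v + u + tau]addrAC [v - u + tau]addrAC => E.
  transitivity (indicator a x * (P s1 x * (2^-1 * cre (v + tau) + 2^-1 * (cre (v + tau) * cre u)))).
    by field.
  by rewrite E; field.
by rewrite !key (PE c tau s s') (PE (d 1) tau s s') (PE (d (-1)) tau s s').
Qed.

(** A trigonometric polynomial with values between 0 and 1, equal to 1 exactly
    where [b j x = - s j] for all [j]. *)
Definition bump (s : 'I_m -> circle R) x : R := \prod_j ((1 + cre (b j x + s j)) / 2).

Lemma translation_invariant_bump a N :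
  translation_invariant a (fun s x => bump s x ^+ N).
Proof.
elim: N => [|N IH]; first exact: translation_invariant1.
have aux (r : seq 'I_m) P : translation_invariant a P ->
    translation_invariant a (fun s x => P s x * \prod_(j <- r) ((1 + cre (b j x + s j)) / 2)).
  elim: r P => [|j r IHr] P PT.
    suff -> : (fun s x => P s x * \prod_(j <- [::]) ((1 + cre (b j x + s j)) / 2)) = P by [].
    by apply/funext => s; apply/funext => x; rewrite big_nil mulr1.
  have := IHr _ (translation_invariantM j PT); congr translation_invariant.
  by apply/funext => s; apply/funext => x; rewrite big_cons !mulrA.
have := aux (index_enum _) _ IH; congr translation_invariant.
by apply/funext => s; apply/funext => x; rewrite exprSr.
Qed.

Lemma mean_bump_shift a N s s' :
  mean (fun x => indicator a x * bump s x ^+ N) = mean (fun x => indicator a x * bump s' x ^+ N).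
Proof.
have [_ /(_ (fun=> 0) 0 s s')] := translation_invariant_bump a N.
have E s1 : (fun x => indicator a x * (bump s1 x ^+ N * cre (shifted_char (fun=> 0) s1 x + 0))) =
    fun x => indicator a x * bump s1 x ^+ N.
  apply/funext => x; rewrite /shifted_char big1 => [|j _]; last by rewrite mulr0z.
  by rewrite addr0 cre0 mulr1.
by rewrite !E.
Qed.

Lemma bump_factor (u : circle R) : 0 <= (1 + cre u) / 2 <= 1.
Proof.
have := cre_le1 u; have := cre_le1 (- u).
have : -1 <= cre u by have := cre2Dcim2 u; have := sqr_ge0 (cim u); nra.
lra.
Qed.

Lemma bump_bound s x : 0 <= bump s x <= 1.
Proof.
apply/andP; split; first by apply: prodr_ge0 => j _; case/andP: (bump_factor (b j x + s j)).
by apply: prodr_ile1 => j _; exact: bump_factor.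
Qed.

Lemma bump_continuous s : continuous (bump s).
Proof. by have [H _] := translation_invariant_bump 0 1; exact: H. Qed.

Lemma bump_lt1 s x j : b j x + s j != 0 -> bump s x < 1.
Proof.
move=> bs; rewrite /bump (bigD1 j)//=.
have u1 : (1 + cre (b j x + s j)) / 2 < 1.
  suff : cre (b j x + s j) < 1 by lra.
  by rewrite lt_neqAle cre_le1 andbT; apply: contra bs => /eqP/cre_eq1/eqP.
apply: le_lt_trans u1; apply: ler_piMr; first by case/andP: (bump_factor (b j x + s j)).
by apply: prodr_ile1 => i _; exact: bump_factor.
Qed.

(** Weyl's equidistribution argument. If the class [a] avoided the coordinates
    [t], the bump at [t] would be at most some [q < 1] on the class, so its
    powers would have means at most [q ^+ N]. At every point one of finitely
    many translates of the bump exceeds a fixed [q' > q], and powers of the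
    translates have the same means: this bounds [q' ^+ N] by a constant
    multiple of [q ^+ N]. *)
Lemma coordinates_surjective a (t : 'I_m -> circle R) :
  exists x, cl x = a /\ forall j, b j x = t j.
Proof.
apply: contrapT => nx; pose s0 j := - t j.
pose f x := indicator a x * bump s0 x.
have cind : continuous (indicator a) by exact: indicator_continuous.
have cf : continuous f by apply: contM => //; exact: bump_continuous.
have f0 x : 0 <= f x.
  by case/andP: (indicator_bound a x) => ? _; case/andP: (bump_bound s0 x) => ? _; exact: mulr_ge0.
have f1 x : f x < 1.
  rewrite /f /indicator; case: eqP => [xa|_]; last by rewrite mul0r ltr01.
  rewrite mul1r; have [j jt] : exists j, b j x <> t j.
    by apply: contrapT => nj; apply: nx; exists x; split=> // j; apply: contrapT => ?; apply: nj; exists j.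
  by apply: (@bump_lt1 _ _ j); rewrite subr_eq0; apply/eqP.
have cg : continuous (fun x => (1 - f x)^-1).
  move=> x; apply: cvgV; first by have := f1 x; rewrite -subr_gt0 => /lt0r_neq0.
  by apply: cvgB; [exact: cvg_cst|exact: cf].
(* The bound [q] is found as [1 - M^-1], where [M] bounds the inverse of [1 -
   f]. *)
have [M M0 MP] := compact_bound cpt cg.
pose q := 1 - M^-1.
have fq x : f x <= q.
  have p : 0 < 1 - f x by rewrite subr_gt0.
  have := MP x; rewrite ger0_norm ?invr_ge0 ?(ltW p)// => H.
  rewrite /q lerBrDr -lerBrDl -[1 - f x]invrK lef_pV2 ?posrE ?invr_gt0//.
have q0 : 0 <= q by exact: le_trans (f0 y0) (fq y0).
have q1 : q < 1 by rewrite /q ltrBlDr ltrDl invr_gt0.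
pose q' := (1 + q) / 2.
have q'0 : 0 < q' by rewrite /q'; lra.
have qq' : q < q' by rewrite /q'; lra.
have q'1 : q' < 1 by rewrite /q'; lra.
pose U (z : L) := bump (fun j => - b j z) @^-1` [set r | q' < r].
have nU z : nbhs z (U z).
  have cb : continuous (bump (fun j => - b j z)) by exact: bump_continuous.
  apply: (cvgr_gt _ (cb z)).
  by rewrite /bump big1 // => j _; rewrite subrr cre0 divff// pnatr_eq0.
have [S SP] := compact_nbhs_cover cpt nU.
pose c0 := mean (indicator a).
have cbN s N : continuous (fun x => indicator a x * bump s x ^+ N).
  by apply: contM => //; have [H _] := translation_invariant_bump a N; exact: H.
(* The exponent is positive so that the indicator is absorbed: [f ^+ N] is the
   indicator times the power of the bump. *)
have key N : (0 < N)%N -> c0 * q' ^+ N <= (size S)%:R * q ^+ N.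
  move=> N0.
  apply: (@le_trans _ _ (mean (fun x => \sum_(z <- S) indicator a x * bump (fun j => - b j z) x ^+ N))).
    rewrite /c0 mulrC -mZ//.
    apply: (@ler_mean R G L actL cpt aD aC minL equi y0).
    - exact: contZ.
    - by apply: cont_sum.
    - move=> x; have [z zS] := SP x; rewrite /U /= => zx.
      case/andP: (indicator_bound a x) => i0 _.
      rewrite (big_rem z zS)/= mulrC.
      apply: (@le_trans _ _ (indicator a x * bump (fun j => - b j z) x ^+ N)).
        by apply: ler_wpM2l => //; apply: lerXn2r; rewrite ?nnegrE ?(ltW q'0)// ?ltW// (lt_trans q'0).
      rewrite lerDl; apply: sumr_ge0 => w _; apply: mulr_ge0 => //.
      by apply: exprn_ge0; case/andP: (bump_bound (fun j => - b j w) x).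
  rewrite (@mean_sum R G L actL cpt aD aC minL equi y0)//.
  rewrite (eq_bigr (fun=> mean (fun x => indicator a x * bump s0 x ^+ N))); last first.
    by move=> z _; exact: mean_bump_shift.
  rewrite big_const_seq count_predT iter_addr_0 -[X in X <= _]mulr_natl.
  apply: ler_wpM2l; first exact: ler0n.
  rewrite -[leRHS](@mean_cst R G L actL aD y0).
  apply: (@ler_mean R G L actL cpt aD aC minL equi y0) => //; first exact: cst_continuous.
  move=> x; apply: (@le_trans _ _ (f x ^+ N)); last by apply: lerXn2r; rewrite ?nnegrE.
  rewrite /f exprMn; apply: ler_wpM2r; first by apply: exprn_ge0; case/andP: (bump_bound s0 x).
  by rewrite /indicator; case: eqP => _; rewrite ?expr1n// ?mulr0n ?exprn_ge0.
have c0p : 0 < c0 by exact: mean_indicator_gt0.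
pose rho := q / q'.
have r0 : 0 <= rho by rewrite divr_ge0// ltW.
have r1 : rho < 1 by rewrite ltr_pdivrMr// mul1r.
have H N : (0 < N)%N -> c0 <= (size S)%:R * rho ^+ N.
  by move=> N0; rewrite expr_div_n mulrA ler_pdivlMr ?exprn_gt0//; exact: key.
have cr : (fun N => (size S)%:R * rho ^+ N) @ \oo --> (0 : R).
  rewrite -[X in _ --> X](mulr0 (size S)%:R); apply: cvgM; first exact: cvg_cst.
  by apply: cvg_expr; rewrite ger0_norm.
have := cvgr_lt _ cr c0 c0p; case=> N _ NP.
have := NP N.+1 (leqnSn N); rewrite /= => /(le_lt_trans (H N.+1 isT)).
by rewrite ltxx.
Qed.

End Coordinates.

(** * The isomorphism with a flow of rotations *)

Lemma separated_hausdorff (R : realType) (X : topologicalType) :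
  (forall x y : X, x <> y -> exists2 f : X -> R, continuous f & f x <> f y) ->
  hausdorff_space X.
Proof.
move=> sep x y xy; apply: contrapT => /sep[f cf]; apply.
apply: (@Rhausdorff R) => A B fA fB; have [z [Az Bz]] := xy _ _ (cf x A fA) (cf y B fB).
by exists (f z).
Qed.

Lemma compact_hausdorff_homeomorphism (X Y : topologicalType) (f : X -> Y) (g : Y -> X) :
  compact [set: X] -> hausdorff_space Y -> continuous f -> cancel f g -> cancel g f ->
  homeomorphism f.
Proof.
move=> cX hY cf fK gK; split=> //; exists g; split=> //.
apply/continuous_closedP => C cC.
suff -> : g @^-1` C = f @` C.
  apply: compact_closed hY _; apply: continuous_compact; first exact: continuous_subspaceT.
  exact: subclosed_compact cC cX _.
apply/seteqP; split=> [y Cy|_ [x Cx <-]]; first by exists (g y); rewrite ?gK.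
by rewrite /= fK.
Qed.

Section FinTorus.
Variables (R : realType) (F : finZmodType) (m : nat).
Local Notation H := (fin_torus R F m).

Lemma fin_torus_hausdorff : hausdorff_space H.
Proof.
apply: (@separated_hausdorff R) => x y xy.
have [E|/eqP ne] := eqVneq x.1 y.1; last first.
  exists (fun z : H => (z.1 == x.1)%:R); last by rewrite eqxx eq_sym; move: ne; case: eqP => //= _ _ /eqP; rewrite oner_eq0.
  move=> z.
  have E : \forall w \near z, (fun=> (z.1 == x.1)%:R) w = (w.1 == x.1)%:R :> R.
    have : \forall w \near z, w.1 = z.1 :> F.
      have c1 : (fun w : H => w.1 : discrete_topology F) @ z --> (z.1 : discrete_topology F) by exact: cvg_fst.
      by apply: (c1 [set u | u = z.1]).
    by apply: filterS => w ->.
  by apply: cvg_trans (near_eq_cvg E) _; exact: cvg_cst.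
have [j nj] : exists j, x.2 j <> y.2 j.
  apply: contrapT => nj; apply: xy; rewrite [x]surjective_pairing [y]surjective_pairing E.
  congr (_, _); apply/funext => j; apply: contrapT => ?; apply: nj; by exists j.
have cj : continuous (fun z : H => z.2 j).
  move=> z; apply: (@continuous_comp H (prod_topology (fun _ : 'I_m => circle R)) _ (fun z => z.2) (fun t => t j)).
    exact: cvg_snd.
  exact: proj_continuous.
have [Ec|/eqP nc] := eqVneq (cre (x.2 j)) (cre (y.2 j)).
  exists (fun z => cim (z.2 j)); first exact: cont_cim.
  by move=> Es; apply: nj; exact: circle_eq.
by exists (fun z => cre (z.2 j)) => //; exact: cont_cre.
Qed.

Lemma continuous_fin_torus (X : topologicalType) (cl : X -> F) (b : 'I_m -> X -> circle R) :
  (forall x, \forall z \near x, cl z = cl x) -> (forall j, continuous (b j)) ->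
  continuous (fun x => (cl x, fun j => b j x) : H).
Proof.
move=> cn cb x.
apply: (@cvg_pair _ _ _ _ (nbhs (cl x : discrete_topology F))
   (nbhs ((fun j => b j x) : prod_topology (fun _ : 'I_m => circle R)))).
  move=> A Ax; apply: filterS (cn x) => z zx; rewrite /= zx.
  exact: (nbhs_singleton Ax).
apply/cvg_sup => j A [B [[C oC <-] Cx] BA].
by apply: filterS BA _; apply: (cb j x); apply: open_nbhs_nbhs.
Qed.

End FinTorus.

(** Transport of the flow along an equivariant bijection, whose inverse is
    continuous because [L] is compact. *)
Lemma rotation_flow (R : realType) (G : topologicalZmodType) (L : topologicalType)
    (actL : G -> L -> L) (F : finZmodType) m (f : L -> fin_torus R F m) (a : G -> fin_torus R F m) :
  is_flow actL -> minimal_flow actL -> continuous f -> injective f ->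
  (forall h, exists x, f x = h) -> (forall g x, f (actL g x) = a g + f x) ->
  exists actH : G -> fin_torus R F m -> fin_torus R F m,
    [/\ is_flow actH /\ minimal_flow actH, acts_by_rotations actH & isomorphic_flows actL actH].
Proof.
move=> flowL minL cf fI fS fE; have [j jK] := choice fS.
have fK : cancel f j by move=> x; apply: fI.
have hf := compact_hausdorff_homeomorphism (flow_compact flowL) (@fin_torus_hausdorff R F m) cf fK jK.
have [_ [j' [cj' fK' _]]] := hf.
have cj : continuous j by have -> : j = j' by apply/funext => y; rewrite -{2}[y]jK fK'.
exists (fun g h => f (actL g (j h))); split; [split; first split|..].
- have -> : [set: fin_torus R F m] = f @` [set: L].
    by apply/seteqP; split=> // h _; exists (j h).
  by apply: continuous_compact (flow_compact flowL); exact: continuous_subspaceT.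
- exact: fin_torus_hausdorff.
- by move=> h; rewrite (flow0 flowL).
- by move=> g g' h; rewrite (flowD flowL) fK.
- have [_ _ _ _ ca] := flowL => p.
  apply: (@continuous_comp _ _ _ (fun p : G * fin_torus R F m => actL p.1 (j p.2)) f); last exact: cf.
  apply: (@continuous_comp _ _ _ (fun p : G * fin_torus R F m => (p.1, j p.2)) (fun p : G * L => actL p.1 p.2)); last exact: ca.
  apply: (@cvg_pair _ _ _ _ (nbhs p.1) (nbhs (j p.2))); first exact: cvg_fst.
  by apply: (@continuous_comp _ _ _ (fun p : G * fin_torus R F m => p.2) j); [exact: cvg_snd|exact: cj].
- move=> h O [z Oz] oO.
  have oP : open (f @^-1` O) by apply: open_comp => // x _; exact: cf.
  have [x [Ox [g _ gx]]] : f @^-1` O `&` range (actL^~ (j h)) !=set0.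
    by apply: minL => //; exists (j z); rewrite /= jK.
  by exists (f x); split=> //; exists g => //; rewrite gx.
- by move=> g; exists (a g) => h; rewrite fE jK.
- by exists f; split=> // g x; rewrite fK.
Qed.

(** Eigenfunctions separate points, and each of them is, up to a constant, a
    character of finite order times a combination of the basis. *)
Lemma coordinates_injective (R : realType) (G : topologicalZmodType) (L : uniformType)
    (actL : G -> L -> L) (y0 : L) (F : finZmodType) (cl : L -> F) m (b : 'I_m -> L -> circle R) :
  is_flow actL -> minimal_flow actL -> uniformly_equicontinuous actL ->
  (forall x y, cl x = cl y <-> @torsion_equiv R G L actL y0 x y) ->
  (forall chi, @char R G L actL y0 chi -> exists c : 'I_m -> int,
     @torsion_char R G L actL y0 (chi - \sum_j b j *~ c j)) ->
  forall x y, cl x = cl y -> (forall j, b j x = b j y) -> x = y.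
Proof.
move=> flowL minL equiL clP bgen x y /clP xy bxy; apply: contrapT => nxy.
have cy : closed [set y] by apply: accessible_closed_set1; exact: hausdorff_accessible (flow_hausdorff flowL).
have nyx : ~ [set y] x by [].
have : @uniform_separator L [set x] [set y] by exact: point_uniform_separator cy nyx.
move=> /(@uniform_separatorP L R)[u [cu _ u0 u1]].
have ux : u x = 0 by apply: u0; exists x.
have uy : u y = 1 by apply: u1; exists y.
have uxy : u x != u y by rewrite ux uy eq_sym oner_eq0.
have equi (v : L -> R) := @flow_equicontinuous R G L actL flowL equiL v.
have [chi [c [cchi chiE nchi]]] := eigenfunctions_separate (flow_compact flowL) (flow0 flowL)
  (flowD flowL) (flow_act_continuous flowL) minL equi y0 cu uxy.
pose psi z := chi z - chi y0.
have cpsi : @char R G L actL y0 psi.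
  split; first by apply: cont_circleB => //; exact: cst_continuous.
    by rewrite /psi subrr.
  by move=> g z; rewrite /psi !chiE addrK addrA.
have [d dT] := bgen _ cpsi.
have := xy _ dT; rewrite -[LHS]/(psi x - _) -[RHS]/(psi y - _).
have -> : (\sum_j b j *~ d j) x = (\sum_j b j *~ d j) y.
  by rewrite !fct_sumE; apply: eq_bigr => j _; rewrite !fct_mulrz bxy.
by move=> /addIr/addIr E; move: nchi; rewrite E eqxx.
Qed.

Theorem theorem3p2 (R : realType) (G : topologicalZmodType)
    (K : topologicalType) (act : G -> K -> K)
    (flowK : is_flow act)
    (K_nonempty : [set: K] !=set0)
    (K_lpc : locally_path_connected R K)
    (K_b1 : finite_betti R K 1)
    (K_or_G : metrizable R K \/ separable G)
    (inv_cst : forall f : K -> R[i]^o, continuous f -> invariant_fun act f ->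
       exists c, forall x, f x = c)
    (L : uniformType) (actL : G -> L -> L)
    (factorL : is_factor act actL)
    (equiL : uniformly_equicontinuous actL) :
  exists (F : finZmodType) (m : nat)
         (actH : G -> fin_torus R F m -> fin_torus R F m),
    [/\ (#|F| <= betti R K 0)%N,
        m%:R <= (betti R K 1)%:R / (betti R K 0)%:R :> rat,
        is_flow actH /\ minimal_flow actH,
        acts_by_rotations actH
      & isomorphic_flows actL actH].
Proof.
have [flowL [q [cq qS qE]]] := factorL; have [k0 _] := K_nonempty.
have surj_q y : exists x, q x = y by have [x _ <-] := qS y I; exists x.
have minL : minimal_flow actL.
  apply: (@equicontinuous_minimal R G L actL flowL equiL) => f cf fE x y.
  have cfq : continuous (f \o q) by move=> z; apply: continuous_comp; [exact: cq|exact: cf].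
  have [|c fc] := inv_cst (fun z => ((f \o q) z +i* 0)%C : R[i]^o)
     (continuous_complex cfq (@cst_continuous _ _ 0)).
    by move=> g z /=; rewrite qE fE.
  have [[u <-] [v <-]] := (surj_q x, surj_q y).
  by have := etrans (fc u) (esym (fc v)) => -[].
have cptK := flow_compact flowK.
have [n [cls [p [clsp clsE]]]] := components_finite cptK K_lpc.
have b0 : betti R K 0 = n := betti0_components clsp clsE.
have b1 : betti_spec R K 1 (betti R K 1).
  by rewrite /betti; case: xgetP => // nb; have [r rP] := K_b1; case: (nb r).
pose y0 := q k0; pose i0 := cls k0.
have [m [b [bc bgen bind]]] := character_basis y0 flowL minL flowK cq qE clsp clsE K_lpc i0 b1.
have nm := character_rank flowL minL flowK cq qE clsp clsE K_lpc b1 bc bind.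
have [F [qG [cl [[Fn qB qGS] [clP cl0 clE] cl_near]]]] :=
  torsion_classes y0 flowL minL cq surj_q clsp clsE.
have equi (v : L -> R) := @flow_equicontinuous R G L actL flowL equiL v.
have [||||actH [flowH rotH isoH]] := @rotation_flow R G L actL F m
   (fun x => (cl x, fun j => b j x)) (fun g => (qG g, fun j => b j (actL g y0))) flowL minL.
- by apply: continuous_fin_torus => // j; case: (bc j).
- move=> x y [xy bxy]; apply: (coordinates_injective flowL minL equiL clP bgen xy) => j.
  exact: (congr1 (fun f => f j) bxy).
- move=> [a t]; have [x [xa xt]] := coordinates_surjective flowL minL equi qB qGS cl0 clE cl_near bc bind a t.
  by exists x; rewrite xa; congr (_, _); apply/funext.
- move=> g x; rewrite clE; congr (_, _); apply/funext => j.
  by case: (bc j) => _ _ ->.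
exists F, m, actH; split=> //; rewrite b0//.
rewrite ler_pdivlMr ?ltr0n ?(leq_trans _ (ltn_ord i0))//.
by rewrite -natrM ler_nat mulnC.
Qed.
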